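(* Let $W(\nu)$, $0\le\nu\le1$, be a standard Wiener process, let $h,g:[0,1]\to\mathbb{R}$ be continuous functions with $\int_0^1 g(q)^2\,dq=1$, and let $$U(\nu)=W(\nu)-\int_0^1 g(r)\,dW(r)\int_0^\nu h(r)\,dr,\qquad 0\le\nu\le1.$$ Let $\varphi_1,\varphi_2,\psi_2$ be the functions built from $h$ and $g$ as described in the context, and suppose that $\varphi_2(r)>0$ for all $r\in[0,1)$. Then the process $$L[U](\nu)=U(\nu)+\int_0^\nu\int_0^r\frac{\varphi_1(r)\,h(q)+\psi_2(r)\,g(q)}{\varphi_2(r)}\,dU(q)\,dr,\qquad 0\le\nu\le1,$$ is a Wiener process, i.e. $L[U](\nu)=w_\nu$ for some standard Wiener process $w_\nu$, $0\le\nu\le1$.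
   Context: For a continuous deterministic function $f$, $\int_0^r f(q)\,dU(q)$ means $\int_0^r f(q)\,dW(q)-\left(\int_0^1 g\,dW\right)\int_0^r f(q)h(q)\,dq$. Since positivity of $\varphi_2$ is assumed only on $[0,1)$, the value $L[U](1)$ is understood as the limit of $L[U](\nu)$ as $\nu\uparrow1$. For $r\in[0,1]$ put $$I_1=\int_0^r g(q)^2dq,\quad I_2=\int_0^r h(q)g(q)\,dq,\quad I_3=\int_0^r h(q)\,dq,\quad I_4=\int_0^r h(q)^2dq,\quad I_5=\int_0^r g(q)\,dq,$$ and write $h=h(r)$, $g=g(r)$, $a=1-I_2$, $b=1-I_1$, $K=a^2+bI_4$. Then $$\varphi_1(r)=aK\,g-bK\,h+\left(a^2I_5-bI_4I_5-2abI_3\right)hg+a\left(aI_3+I_4I_5\right)g^2+b\left(bI_3-aI_5\right)h^2,$$ $$\varphi_2(r)=K\left[K+\left(aI_5-bI_3\right)h+\left(aI_3+I_4I_5\right)g\right],$$ $$\psi_2(r)=aK\,h+I_4K\,g+\left(a^2I_3-bI_3I_4+2aI_4I_5\right)hg+a\left(aI_5-bI_3\right)h^2+I_4\left(aI_3+I_4I_5\right)g^2.$$ *)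

(* Defs.v *)
From HB Require Import structures.
From mathcomp Require Import all_boot all_order all_algebra.
From mathcomp Require Import all_classical all_reals all_analysis measurable_realfun.

Set Implicit Arguments.
Unset Strict Implicit.
Unset Printing Implicit Defensive.

Import Order.TTheory GRing.Theory Num.Theory.
Import numFieldNormedType.Exports.

Local Open Scope classical_set_scope.
Local Open Scope ring_scope.

(* Each [B i] may be [setT], so the product rule for the whole family contains
   the product rules for all its subfamilies. *)
Definition independent_RVs d (T : measurableType d) (R : realType)
    (P : probability T R) (n : nat) (X : 'I_n -> {RV P >-> R}) : Prop :=
  forall B : 'I_n -> set R, (forall i, measurable (B i)) ->
    P (\bigcap_(i in [set: 'I_n]) (X i @^-1` B i)) =
    (\prod_(i < n) P (X i @^-1` B i))%E.

Definition increment d (T : measurableType d) (R : realType)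
    (P : probability T R) (W : R -> {RV P >-> R}) (s t : R) : {RV P >-> R} :=
  (W t : {mfun T >-> R}) - (W s : {mfun T >-> R}).

(* Processes are indexed by the whole of [R], but only times in [0, 1] are
   constrained.  The second parameter of [normal_prob] is the standard
   deviation; the value 0 must be avoided there, since the library does not take
   [normal_prob m 0] to be the Dirac mass. *)
Definition standard_wiener d (T : measurableType d) (R : realType)
    (P : probability T R) (W : R -> {RV P >-> R}) : Prop :=
  [/\ {ae P, forall x, W 0 x = 0},
      {ae P, forall x, {within `[0, 1], continuous (fun t => W t x)}},
      forall s t, 0 <= s -> s < t -> t <= 1 ->
        forall B : set R, measurable B ->
          distribution P (increment W s t) B = normal_prob 0 (Num.sqrt (t - s)) B &
      forall (n : nat) (t : nat -> R),
        0 <= t 0%N -> (forall i, (i < n)%N -> t i <= t i.+1) -> t n <= 1 ->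
        independent_RVs (fun i : 'I_n => increment W (t i) (t i.+1))].

Definition riemann_sum d (T : measurableType d) (R : realType)
    (P : probability T R) (W : R -> {RV P >-> R}) (f : R -> R) (r : R)
    (n : nat) (x : T) : R :=
  \sum_(i < n) f (r * i%:R / n%:R) *
    (W (r * i.+1%:R / n%:R) x - W (r * i%:R / n%:R) x).

(* For f continuous on [0, r], the mean-square limit of the Riemann sums over
   the uniform partitions of [0, r] is the Wiener integral of f; it is unique up
   to almost sure equality. *)
Definition is_wiener_integral d (T : measurableType d) (R : realType)
    (P : probability T R) (W : R -> {RV P >-> R}) (f : R -> R) (r : R)
    (X : {RV P >-> R}) : Prop :=
  ('E_P[(fun x => (X x - riemann_sum W f r n x) ^+ 2)%R] @[n --> \oo] --> 0)%E.

Definition wiener_integral d (T : measurableType d) (R : realType)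
    (P : probability T R) (W : R -> {RV P >-> R}) (f : R -> R) (r : R)
    : {RV P >-> R} :=
  xget (cst 0 : {mfun T >-> R}) [set X | is_wiener_integral W f r X].

Definition int0 (R : realType) (f : R -> R) (r : R) : R :=
  \int[lebesgue_measure]_(q in `[0, r]) f q.

Definition process_U d (T : measurableType d) (R : realType)
    (P : probability T R) (W : R -> {RV P >-> R}) (h g : R -> R)
    (nu : R) (x : T) : R :=
  W nu x - wiener_integral W g 1 x * int0 h nu.

Definition U_integral d (T : measurableType d) (R : realType)
    (P : probability T R) (W : R -> {RV P >-> R}) (h g : R -> R)
    (f : R -> R) (r : R) (x : T) : R :=
  wiener_integral W f r x -
  wiener_integral W g 1 x * int0 (fun q => f q * h q) r.

Section coefficients.
Context {R : realType}.
Implicit Types (h g : R -> R) (r : R).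

Definition I1 g r : R := int0 (fun q => g q ^+ 2) r.
Definition I2 h g r : R := int0 (fun q => h q * g q) r.
Definition I3 h r : R := int0 h r.
Definition I4 h r : R := int0 (fun q => h q ^+ 2) r.
Definition I5 g r : R := int0 g r.

Definition coef_a h g r : R := 1 - I2 h g r.
Definition coef_b g r : R := 1 - I1 g r.
Definition coef_K h g r : R := coef_a h g r ^+ 2 + coef_b g r * I4 h r.

Definition phi1 h g r : R :=
  let: (a, b, K) := (coef_a h g r, coef_b g r, coef_K h g r) in
  let: (i3, i4, i5) := (I3 h r, I4 h r, I5 g r) in
  a * K * g r - b * K * h r
  + (a ^+ 2 * i5 - b * i4 * i5 - 2 * a * b * i3) * h r * g r
  + a * (a * i3 + i4 * i5) * g r ^+ 2
  + b * (b * i3 - a * i5) * h r ^+ 2.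

Definition phi2 h g r : R :=
  let: (a, b, K) := (coef_a h g r, coef_b g r, coef_K h g r) in
  let: (i3, i4, i5) := (I3 h r, I4 h r, I5 g r) in
  K * (K + (a * i5 - b * i3) * h r + (a * i3 + i4 * i5) * g r).

Definition psi2 h g r : R :=
  let: (a, b, K) := (coef_a h g r, coef_b g r, coef_K h g r) in
  let: (i3, i4, i5) := (I3 h r, I4 h r, I5 g r) in
  a * K * h r + i4 * K * g r
  + (a ^+ 2 * i3 - b * i3 * i4 + 2 * a * i4 * i5) * h r * g r
  + a * (a * i5 - b * i3) * h r ^+ 2
  + i4 * (a * i3 + i4 * i5) * g r ^+ 2.

Definition kernel_L h g r (q : R) : R :=
  (phi1 h g r * h q + psi2 h g r * g q) / phi2 h g r.

End coefficients.

(* For each r separately the inner stochastic integral is defined only up to a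
   null set depending on r.  To integrate it pathwise in r one takes, as usual,
   a version with almost surely continuous paths; two such versions are
   indistinguishable on [0, 1). *)
Definition is_inner_version d (T : measurableType d) (R : realType)
    (P : probability T R) (W : R -> {RV P >-> R}) (h g : R -> R)
    (J : R -> {RV P >-> R}) : Prop :=
  (forall r, r \in `[0, 1[ ->
     {ae P, forall x, J r x = U_integral W h g (kernel_L h g r) r x}) /\
  {ae P, forall x, {within `[0, 1[, continuous (fun r => J r x)}}.

Definition inner_integral d (T : measurableType d) (R : realType)
    (P : probability T R) (W : R -> {RV P >-> R}) (h g : R -> R)
    : R -> {RV P >-> R} :=
  xget (fun=> cst 0 : {mfun T >-> R}) [set J | is_inner_version W h g J].

Definition transform_lt1 d (T : measurableType d) (R : realType)
    (P : probability T R) (W : R -> {RV P >-> R}) (h g : R -> R)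
    (nu : R) (x : T) : R :=
  process_U W h g nu x + int0 (fun r => inner_integral W h g r x) nu.

Definition transform_L d (T : measurableType d) (R : realType)
    (P : probability T R) (W : R -> {RV P >-> R}) (h g : R -> R)
    (nu : R) (x : T) : R :=
  if nu < 1 then transform_lt1 W h g nu x
  else lim (transform_lt1 W h g t x @[t --> 1^'-]).

(* Main.v *)
(* Fix r.  The inner stochastic integral J_r is the combination
   alpha(r) N^h_r + beta(r) N^g_r of N^e_r = int_0^r e dU (e = h, g), and the
   coefficients alpha = phi1/phi2, beta = psi2/phi2 are exactly those for which
   E[J_r N^e_q] = - d/dr E[N^1_r N^e_q] for q <= r.  Hence the increments of
   L[U] over [s, t] are orthogonal to all N^e_q with q <= s, in particular to
   L[U](s); since the drift has second moment O((t - s)^2) on [s, t], the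
   function t |-> E[L[U](t)^2] has derivative 1, so L[U] has the covariance of a
   Wiener process on [0, 1[.  Everything lives in the Gaussian space spanned by
   W, where orthogonality is independence and the covariance determines the law.
   A dyadic chaining argument (fourth moments of Gaussians) provides versions
   with uniformly continuous paths on [0, 1[: it gives the continuous version of
   J, and, applied to L[U] itself, the limit at 1. *)

Require Import Defs.
From mathcomp Require Import all_boot all_order all_algebra.
From mathcomp Require Import all_classical all_reals all_analysis measurable_realfun.
From mathcomp Require Import ring lra zify.
Import Order.TTheory GRing.Theory Num.Theory.
Import numFieldNormedType.Exports.
Local Open Scope classical_set_scope.
Local Open Scope ring_scope.

Set Implicit Arguments.
Unset Strict Implicit.
Unset Printing Implicit Defensive.

(** L[U] is the innovation process of U: -J_r is the projection of the infinitesimal increment of U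
    on its past. Two variables N^h_r, N^g_r suffice to express it because the covariance of dU_r
    with N^e_q depends on e only through the integrals of e h and e g over [0, q]. For h = g = 1, U
    is the Brownian bridge and J_r = U_r / (1 - r). This example shows the main obstacle: the
    coefficients of the drift may blow up at 1. Bounds on the drift are therefore confined to [0, t]
    with t < 1, and the chaining that reaches the endpoint relies on the covariance of L[U] instead,
    which no longer involves the coefficients. Expanding that covariance directly would produce
    double integrals of alpha and beta; orthogonality and a first-order estimate avoid them. Laws
    are tested on the functions cos (l x + th). The free phase th stands for the real and imaginary
    parts of a characteristic function, so that real integrals are enough. *)

Lemma measurable_cos_comp d (T : measurableType d) (R : realType) (F : T -> R) :
  measurable_fun setT F -> measurable_fun setT (fun x => cos (F x)).
Proof.
by apply: measurableT_comp; exact: (continuous_measurable_fun (@continuous_cos R)).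
Qed.

(** * Mean-square calculus *)

Section Rintegral_dominated.
Context d (T : measurableType d) (R : realType) (mu : {measure set T -> \bar R}).

Lemma Rintegral_cvg (f_ : nat -> T -> R) (f g : T -> R) :
  (forall n, measurable_fun setT (f_ n)) -> measurable_fun setT f ->
  mu.-integrable setT (EFin \o g) ->
  (forall n x, `|f_ n x| <= g x) ->
  {ae mu, forall x, f_ n x @[n --> \oo] --> f x} ->
  mu.-integrable setT (EFin \o f) /\
  \int[mu]_x f_ n x @[n --> \oo] --> \int[mu]_x f x.
Proof.
move=> mf_ mf ig fg fcv.
have [|||||fi _ cv] := @dominated_convergence _ _ _ mu setT measurableT
   (fun n => EFin \o f_ n) (EFin \o f) (EFin \o g).
- by move=> n; exact/measurable_EFinP.
- exact/measurable_EFinP.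
- by apply: filterS fcv => x fx _; apply: cvg_EFin => //; exact: nearW.
- exact: ig.
- by apply/aeW => x n _; rewrite lee_fin.
split => //.
apply: fine_cvg; rewrite /Rintegral fineK; last exact: integrable_fin_num.
exact: cv.
Qed.

End Rintegral_dominated.

Section bounded_expectation.
Context d (T : measurableType d) (R : realType) (P : probability T R).
Implicit Types X Y f : T -> R.

Lemma bounded_integrable f M : measurable_fun setT f ->
  (forall x, `|f x| <= M) -> P.-integrable setT (EFin \o f).
Proof.
move=> mf fM; apply: measurable_bounded_integrable => //.
  by rewrite (le_lt_trans (probability_le1 _ _)) ?ltry.
exists M; split; first exact: num_real.
by move=> N MN x _ /=; rewrite (le_trans (fM x))// ltW.
Qed.

Lemma Rintegral_bounded_cvg (f_ : nat -> T -> R) f M :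
  (forall n, measurable_fun setT (f_ n)) -> measurable_fun setT f ->
  (forall n x, `|f_ n x| <= M) ->
  {ae P, forall x, f_ n x @[n --> \oo] --> f x} ->
  \int[P]_x f_ n x @[n --> \oo] --> \int[P]_x f x.
Proof.
move=> mf_ mf fM fcv.
have iM : P.-integrable setT (EFin \o cst M) by exact: (@bounded_integrable _ `|M|).
by have [] := @Rintegral_cvg _ _ _ P f_ f (cst M) mf_ mf iM fM fcv.
Qed.

Lemma probability_Rintegral_cst (c : R) : \int[P]_x c = c.
Proof. by rewrite Rintegral_cst//= probability_setT mulr1. Qed.

End bounded_expectation.

Section square_integrable.
Context d (T : measurableType d) (R : realType) (P : probability T R).
Implicit Types X Y Z : T -> R.

(** These are functions and not classes modulo null sets, so that paths keep a meaning; almost sure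
    equality is passed through [ip_eq_ae] and [L2_eq_ae]. *)
Definition L2 X :=
  measurable_fun setT X /\ P.-integrable setT (EFin \o (fun x => X x ^+ 2)).

Definition ip X Y := \int[P]_x (X x * Y x).

Lemma L2_integrableM X Y : L2 X -> L2 Y ->
  P.-integrable setT (EFin \o (fun x => X x * Y x)).
Proof.
move=> [mX iX] [mY iY].
apply: (le_integrable _ _ _ (integrableD _ iX iY)) => //.
  by apply/measurable_EFinP; exact: measurable_funM.
move=> x _ /=; rewrite lee_fin normrM [leRHS]ger0_norm; last first.
  by rewrite addr_ge0// sqr_ge0.
rewrite -(real_normK (num_real (X x))) -(real_normK (num_real (Y x))).
have := sqr_ge0 (`|X x| - `|Y x|).
have := normr_ge0 (X x); have := normr_ge0 (Y x).
by nra.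
Qed.

Lemma L2_bounded X M : measurable_fun setT X -> (forall x, `|X x| <= M) -> L2 X.
Proof.
move=> mX XM; split => //; apply: (@bounded_integrable _ _ _ _ _ (M ^+ 2)).
  exact: measurable_funX.
by move=> x; rewrite normrX lerXn2r// ?nnegrE// (le_trans _ (XM x)).
Qed.

Lemma L2_cst (c : R) : L2 (fun=> c).
Proof. by apply: (@L2_bounded _ `|c|). Qed.

Lemma L2_integrable X : L2 X -> P.-integrable setT (EFin \o X).
Proof.
move=> LX; apply: eq_integrable (L2_integrableM LX (L2_cst 1)) => //.
by move=> x _ /=; rewrite mulr1.
Qed.

Lemma L2D X Y : L2 X -> L2 Y -> L2 (fun x => X x + Y x).
Proof.
move=> LX LY; have [mX iX] := LX; have [mY iY] := LY.
split; first exact: measurable_funD.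
have iXY := L2_integrableM LX LY.
have := integrableD measurableT (integrableD measurableT iX iY)
  (integrableZl measurableT 2 iXY).
apply: eq_integrable => //.
by move=> x _ /=; rewrite -EFinM -!EFinD; congr EFin; ring.
Qed.

Lemma L2Z (c : R) X : L2 X -> L2 (fun x => c * X x).
Proof.
move=> [mX iX]; split; first exact: measurable_funM.
have := integrableZl measurableT (c ^+ 2) iX; apply: eq_integrable => //.
by move=> x _ /=; rewrite -EFinM; congr EFin; ring.
Qed.

Lemma L2B X Y : L2 X -> L2 Y -> L2 (fun x => X x - Y x).
Proof.
move=> LX LY; have := L2D LX (L2Z (-1) LY).
by under eq_fun do rewrite mulN1r.
Qed.

Lemma L2_sum (I : Type) (s : seq I) (F : I -> T -> R) :
  (forall i, L2 (F i)) -> L2 (fun x => \sum_(i <- s) F i x).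
Proof.
move=> LF; elim: s => [|i s ih].
  by under eq_fun do rewrite big_nil; exact: L2_cst.
by under eq_fun do rewrite big_cons; exact: L2D.
Qed.

Lemma ipC X Y : ip X Y = ip Y X.
Proof. by apply: eq_Rintegral => x _; rewrite mulrC. Qed.

Lemma ipDl X Y Z : L2 X -> L2 Y -> L2 Z ->
  ip (fun x => X x + Y x) Z = ip X Z + ip Y Z.
Proof.
move=> LX LY LZ; rewrite /ip -RintegralD//; try exact: L2_integrableM.
by apply: eq_Rintegral => x _; rewrite mulrDl.
Qed.

Lemma ipZl (c : R) X Z : L2 X -> L2 Z -> ip (fun x => c * X x) Z = c * ip X Z.
Proof.
move=> LX LZ; rewrite /ip -RintegralZl//; last exact: L2_integrableM.
by apply: eq_Rintegral => x _; rewrite mulrA.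
Qed.

Lemma ipBl X Y Z : L2 X -> L2 Y -> L2 Z ->
  ip (fun x => X x - Y x) Z = ip X Z - ip Y Z.
Proof.
move=> LX LY LZ; rewrite /ip -RintegralB//; try exact: L2_integrableM.
by apply: eq_Rintegral => x _; rewrite mulrBl.
Qed.

Lemma ipDr X Y Z : L2 X -> L2 Y -> L2 Z ->
  ip Z (fun x => X x + Y x) = ip Z X + ip Z Y.
Proof. by move=> LX LY LZ; rewrite ipC ipDl// !(ipC Z). Qed.

Lemma ipBr X Y Z : L2 X -> L2 Y -> L2 Z ->
  ip Z (fun x => X x - Y x) = ip Z X - ip Z Y.
Proof. by move=> LX LY LZ; rewrite ipC ipBl// !(ipC Z). Qed.

Lemma ipZr (c : R) X Z : L2 X -> L2 Z -> ip Z (fun x => c * X x) = c * ip Z X.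
Proof. by move=> LX LZ; rewrite ipC ipZl// (ipC Z). Qed.

Lemma ip_suml (I : Type) (s : seq I) (F : I -> T -> R) Z :
  (forall i, L2 (F i)) -> L2 Z ->
  ip (fun x => \sum_(i <- s) F i x) Z = \sum_(i <- s) ip (F i) Z.
Proof.
move=> LF LZ; elim: s => [|i s ih].
  rewrite big_nil; under [X in ip X _]eq_fun do rewrite big_nil.
  by rewrite /ip; under eq_Rintegral do rewrite mul0r; rewrite probability_Rintegral_cst.
rewrite big_cons -ih; under [X in ip X _]eq_fun do rewrite big_cons.
by rewrite ipDl//; exact: L2_sum.
Qed.

Lemma ip_ge0 X : 0 <= ip X X.
Proof. by apply: Rintegral_ge0 => x _; rewrite -expr2 sqr_ge0. Qed.

Lemma ip_eq_ae X Y Z : {ae P, forall x, X x = Y x} ->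
  measurable_fun setT X -> measurable_fun setT Y -> measurable_fun setT Z ->
  ip X Z = ip Y Z.
Proof.
move=> XY mX mY mZ; rewrite /ip /Rintegral; congr fine.
apply: ae_eq_integral => //.
- by apply/measurable_EFinP; exact: measurable_funM.
- by apply/measurable_EFinP; exact: measurable_funM.
- by apply: filterS XY => x -> _.
Qed.

Lemma L2_eq_ae X Y : {ae P, forall x, X x = Y x} ->
  L2 X -> measurable_fun setT Y -> L2 Y.
Proof.
move=> XY [mX iX] mY; split => //.
apply/integrableP; split; first by apply/measurable_EFinP; exact: measurable_funX.
move/integrableP : iX => [_]; rewrite (@ae_eq_integral _ _ _ P setT
  (fun x => `|(X x ^+2)%:E|%E) (fun x => `|(Y x ^+2)%:E|%E))//.
- apply: measurableT_comp => //; apply/measurable_EFinP; exact: measurable_funX.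
- apply: measurableT_comp => //; apply/measurable_EFinP; exact: measurable_funX.
- by apply: filterS XY => x /= -> _.
Qed.

(** Positivity of the second moment of e X + c Y for c = 1 and c = -1. The free weight e later makes
    a cross term negligible against the larger of the two moments. *)
Lemma ip_AMGM X Y (e : R) : L2 X -> L2 Y -> 0 < e ->
  2 * `|ip X Y| <= e * ip X X + e^-1 * ip Y Y.
Proof.
move=> LX LY e0.
have H (c : R) : 0 <= ip X X * e^+2 + 2 * e * c * ip X Y + c^+2 * ip Y Y.
  have := ip_ge0 (fun x => e * X x + c * Y x).
  have LeX := L2Z e LX; have LcY := L2Z c LY.
  rewrite ipDl//; last exact: L2D.
  rewrite !ipDr// !ipZl// !ipZr// (ipC Y X).
  by congr (_ <= _); ring.
have H' (c : R) : c^+2 = 1 -> - (2 * c * ip X Y) <= e * ip X X + e^-1 * ip Y Y.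
  move=> c1; have := H c; rewrite c1 => h.
  rewrite -(@ler_pM2l _ e)//.
  rewrite [leRHS](_ : _ = ip X X * e ^+ 2 + 1 * ip Y Y); last by field; rewrite gt_eqF.
  by lra.
have [?|?] := lerP 0 (ip X Y).
  rewrite ger0_norm//; have := H' (-1); rewrite sqrrN expr1n => /(_ erefl).
  by lra.
rewrite ltr0_norm//; have := H' 1; rewrite expr1n => /(_ erefl).
by lra.
Qed.

Lemma ip_CS X Y : L2 X -> L2 Y ->
  `|ip X Y| <= Num.sqrt (ip X X) * Num.sqrt (ip Y Y).
Proof.
move=> LX LY; apply/ler_addgt0Pr => d0 d0_gt0.
have a0 := sqrtr_ge0 (ip X X); have b0 := sqrtr_ge0 (ip Y Y).
have aE : Num.sqrt (ip X X) ^+ 2 = ip X X by rewrite sqr_sqrtr// ip_ge0.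
have bE : Num.sqrt (ip Y Y) ^+ 2 = ip Y Y by rewrite sqr_sqrtr// ip_ge0.
set a := Num.sqrt (ip X X) in a0 aE *; set b := Num.sqrt (ip Y Y) in b0 bE *.
(* The optimal weight b / a is undefined or zero when a norm vanishes. Shifting both norms by s
   keeps it positive, at a total cost s (a + b) <= d0. *)
pose s := d0 / (a + b + 1).
have ab1 : 0 < a + b + 1 by lra.
have s0 : 0 < s by rewrite divr_gt0.
have bs0 : 0 < b + s by lra.
have as0 : 0 < a + s by lra.
have := @ip_AMGM X Y ((b + s) / (a + s)) LX LY (divr_gt0 bs0 as0).
rewrite -aE -bE invf_div.
have h1 : (b + s) / (a + s) * a ^+ 2 <= (b + s) * a.
  rewrite -mulrA ler_pM2l// mulrC ler_pdivrMr// expr2 ler_wpM2l//; lra.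
have h2 : (a + s) / (b + s) * b ^+ 2 <= (a + s) * b.
  rewrite -mulrA ler_pM2l// mulrC ler_pdivrMr// expr2 ler_wpM2l//; lra.
have h3 : s * (a + b) <= d0.
  by rewrite /s mulrAC ler_pdivrMr// ler_pM2l//; lra.
have : 0 <= s * (a+b) by rewrite mulr_ge0//; lra.
by lra.
Qed.

End square_integrable.

Section L2_limits.
Context d (T : measurableType d) (R : realType) (P : probability T R).
Implicit Types X Y Z : T -> R.

Lemma EFin_ip X Y : L2 P X -> L2 P Y ->
  (\int[P]_x (X x * Y x)%:E)%E = (ip P X Y)%:E.
Proof.
move=> LX LY; rewrite /ip /Rintegral fineK//.
by apply: integrable_fin_num => //; exact: L2_integrableM.
Qed.

Lemma ip_chebyshev X (e : R) : L2 P X -> 0 < e ->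
  (P [set x | e <= `|X x|]%R <= (ip P X X / e ^+ 2)%:E)%E.
Proof.
move=> LX e0; have [mX iX] := LX.
have mA : measurable [set x | e <= `|X x|].
  rewrite -[X in measurable X]setTI.
  apply: (@measurable_fun_le _ _ _ setT (cst e) (fun x => `|X x|)) => //.
  exact: measurableT_comp.
have pf : P [set x | e <= `|X x|] \is a fin_num by exact: fin_num_measure.
rewrite -(fineK pf) lee_fin ler_pdivlMr ?exprn_gt0// mulrC -lee_fin EFinM fineK//.
rewrite -EFin_ip// -integral_cst// [leRHS](_ : _ = \int[P]_x `|(X x ^+2)%:E|)%E; last first.
  by apply: eq_integral => x _; rewrite gee0_abs// lee_fin sqr_ge0.
apply: (@le_trans _ _ (\int[P]_(x in [set x | (e <= `|X x|)%R]) `|(X x ^+2)%:E|)%E); last first.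
  apply: ge0_subset_integral => //.
  by apply: measurableT_comp => //; exact/measurable_EFinP/measurable_funX.
apply: ge0_le_integral => //.
- by move=> x _; rewrite lee_fin sqr_ge0.
- by apply: measurableT_comp => //; apply/measurable_funTS/measurable_EFinP/measurable_funX.
- move=> x /= ex; rewrite lee_fin normrX; rewrite lerXn2r ?nnegrE//; exact: ltW.
Qed.

Lemma ip_eq0_ae X : L2 P X -> ip P X X = 0 -> {ae P, forall x, X x = 0}.
Proof.
move=> LX X0; have [mX iX] := LX.
have m2 : measurable_fun setT (fun x => (X x ^+2)%:E).
  by exact/measurable_EFinP/measurable_funX.
have : (\int[P]_x `|(X x ^+2)%:E| = 0)%E.
  under eq_integral do rewrite gee0_abs ?lee_fin ?sqr_ge0// expr2.
  by rewrite EFin_ip// X0.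
move/(ae_eq_integral_abs P measurableT m2); apply: filterS => x /(_ I) /= [] /eqP.
by rewrite sqrf_eq0 => /eqP.
Qed.

(** Fatou's lemma for the squares. It yields membership of the limit in [L2] together with the
    bound, which is how almost sure limits enter the mean-square theory. *)
Lemma ip_fatou (X_ : nat -> T -> R) X (C : R) :
  (forall n, L2 P (X_ n)) -> (forall n, ip P (X_ n) (X_ n) <= C) ->
  measurable_fun setT X ->
  {ae P, forall x, X_ n x @[n --> \oo] --> X x} ->
  L2 P X /\ ip P X X <= C.
Proof.
move=> LX_ XC mX XX.
pose f n x := (X_ n x ^+ 2)%:E.
have mf n : measurable_fun setT (f n).
  by apply/measurable_EFinP/measurable_funX; have [] := LX_ n.
have m2 : measurable_fun setT (fun x => (X x ^+2)%:E).
  by exact/measurable_EFinP/measurable_funX.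
have H : (\int[P]_x (X x ^+2)%:E <= C%:E)%E.
  rewrite (@ae_eq_integral _ _ _ P setT (fun x => limn_einf (f ^~ x)) (fun x => (X x ^+2)%:E))//; last 2 first.
  - under eq_fun do rewrite /limn_einf.
    apply: measurableT_comp => //; apply: measurable_fun_limn_esup => n.
    exact: measurableT_comp.
  - apply: filterS XX => x Xx _.
    have fX : f n x @[n --> \oo] --> (X x ^+2)%:E.
      by apply: cvg_EFin; [exact: nearW|exact: (cvg_comp _ _ Xx (@exprn_continuous _ 2 (X x)))].
    rewrite is_cvg_limn_einfE; first by apply/esym/cvg_lim.
    by apply/cvg_ex; exists (X x ^+2)%:E.
  apply: le_trans (fatou P measurableT mf _) _.
    by move=> n x _; rewrite lee_fin sqr_ge0.
  rewrite limn_einf_lim; apply: lime_le; first exact: is_cvg_einfs.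
  apply: nearW => n; apply: (@le_trans _ _ (\int[P]_x f n x)%E).
    by rewrite /einfs /=; apply: ereal_inf_lbound; exists n => /=.
  by rewrite /f; under eq_integral do rewrite expr2; rewrite EFin_ip// lee_fin.
have LX : L2 P X.
  split => //; apply/integrableP; split => //.
  under eq_integral do rewrite gee0_abs ?lee_fin ?sqr_ge0//.
  by rewrite (le_lt_trans H)// ltry.
by split => //; rewrite -lee_fin -EFin_ip.
Qed.

Lemma ip_fatou_near (X_ : nat -> T -> R) X (C : R) :
  (forall n, L2 P (X_ n)) -> (\forall n \near \oo, ip P (X_ n) (X_ n) <= C) ->
  measurable_fun setT X ->
  {ae P, forall x, X_ n x @[n --> \oo] --> X x} ->
  L2 P X /\ ip P X X <= C.
Proof.
move=> LX_ [N _ NC] mX XX.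
apply: (@ip_fatou (fun n => X_ (n + N)%N)) => //.
- by move=> n; apply: NC => /=; rewrite leq_addl.
- by apply: filterS XX => x Xx; rewrite (cvg_shiftn N (X_ ^~ x)).
Qed.

(** Multiplication by the indicator of A makes the sequence converge everywhere, to 0 off A, and an
    everywhere limit is measurable. *)
Lemma ae_cvg_limit (X_ : nat -> T -> R) (A : set T) :
  (forall n, measurable_fun setT (X_ n)) -> measurable A ->
  (forall x, A x -> cvgn (X_ ^~ x)) ->
  exists2 X : T -> R, measurable_fun setT X & forall x, A x -> X_ n x @[n --> \oo] --> X x.
Proof.
move=> mX_ mA cA.
pose Y_ n x := X_ n x * \1_A x.
exists (fun x => limn (Y_ ^~ x)).
  apply: (@measurable_fun_cvg _ _ _ setT Y_) => //.
    by move=> n; apply: measurable_funM => //; exact: measurable_indic.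
  move=> x _; have [Ax|Ax] := pselect (A x).
    have -> : Y_ ^~ x = X_ ^~ x.
      by apply/funext => n; rewrite /Y_ indicE mem_set//= mulr1.
    exact: cA.
  have -> : Y_ ^~ x = cst 0.
    by apply/funext => n; rewrite /Y_ indicE memNset//= mulr0.
  by rewrite lim_cst//; exact: cvg_cst.
move=> x Ax; have -> : Y_ ^~ x = X_ ^~ x.
  by apply/funext => n; rewrite /Y_ indicE mem_set//= mulr1.
exact: cA.
Qed.

(** The good set is exhibited as a measurable set, the form required by [ae_cvg_limit]. *)
Lemma borel_cantelli_ae (D : nat -> set T) (q C : R) :
  0 <= q < 1 -> 0 <= C -> (forall n, measurable (D n)) ->
  (forall n, P (D n) <= (C * q ^+ n)%:E)%E ->
  exists A, [/\ measurable A, P (~` A) = 0%E &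
    forall x, A x -> \forall n \near \oo, ~ D n x].
Proof.
move=> /andP[q0 q1] C0 mD DC; exists (~` (lim_sup_set D)).
have mL : measurable (lim_sup_set D).
  by apply: bigcap_measurable => // n _; exact: bigcup_measurable.
split; first exact: measurableC.
  rewrite setCK; apply: lim_sup_set_cvg0 => //.
  apply: (@le_lt_trans _ _ (\sum_(n <oo) (geometric C q n)%:E)%E).
    by apply: lee_nneseries => // n _; rewrite DC.
  have cg : series (geometric C q) @ \oo --> C * (1 - q)^-1.
    by apply: cvg_geometric_series; rewrite ger0_norm.
  rewrite (_ : (\sum_(n <oo) _)%E = (C * (1 - q)^-1)%:E) ?ltry//.
  apply/cvg_lim => //.
  under eq_fun do rewrite sumEFin.
  by apply: cvg_EFin cg; exact: nearW.
move=> x /= nx; apply: contrapT => H; apply: nx => n _ /=.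
apply: contrapT => H2; apply: H; exists n => // m /= nm Dx.
by apply: H2; exists m.
Qed.

End L2_limits.

(** * Laws determined by Fourier transforms *)

Section bounded_measurable_ind.
Import HBNNSimple.
Context d (T : measurableType d) (R : realType).

Let bounded (f : T -> R) := exists M : R, forall x, `|f x| <= M.

(** The standard machine: indicators give simple functions by linearity, and these give all bounded
    measurable functions by bounded pointwise limits. *)
Lemma bounded_measurable_ind (C : (T -> R) -> Prop) :
  (forall A, measurable A -> C (\1_A)) ->
  (forall (a : R) (f g : T -> R), measurable_fun setT f -> bounded f ->
    measurable_fun setT g -> bounded g -> C f -> C g ->
    C (fun x => a * f x + g x)) ->
  (forall (f_ : nat -> T -> R) (f : T -> R) (M : R), (forall n, measurable_fun setT (f_ n)) ->
    measurable_fun setT f -> (forall n x, `|f_ n x| <= M) ->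
    (forall x, f_ n x @[n --> \oo] --> f x) -> (forall n, C (f_ n)) -> C f) ->
  forall (f : T -> R) (M : R), measurable_fun setT f -> (forall x, `|f x| <= M) -> C f.
Proof.
move=> Cind Clin Clim f M mf fM.
have M0 : 0 <= `|M| by [].
have b1 (A : set T) : bounded (\1_A).
  by exists 1 => x; rewrite indicE ger0_norm ?ler0n// lern1 leq_b1.
have C0 : C (cst 0) by rewrite -indic0; exact: Cind.
have bcst (c : R) : bounded (cst c) by exists `|c|.
have Ccst (c : R) : C (cst c).
  have : C (fun x => c * \1_setT x + cst 0 x).
    by apply: Clin => //; exact: Cind.
  by congr C; apply/funext => x /=; rewrite indicT/= mulr1 addr0.
(* Simple approximation from below requires a nonnegative function, hence the shift by [|M|];
   undoing it leaves the uniform bound 2 [|M|]. *)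
pose F x := (f x + `|M|)%:E.
have mF : measurable_fun setT F by apply/measurable_EFinP; exact: measurable_funD.
have F0 x : setT x -> (0 <= F x)%E.
  move=> _; rewrite lee_fin; have := fM x; rewrite ler_norml => /andP[+ _].
  by have := ler_norm M; lra.
pose s := nnsfun_approx measurableT mF.
have sF x : s n x @[n --> \oo] --> f x + `|M|.
  have /fine_cvgP[_] := cvg_nnsfun_approx measurableT mF F0 (I : setT x).
  exact.
have sM n x : `|s n x - `|M| | <= 2 * `|M|.
  have s0 : 0 <= s n x by exact: fun_ge0.
  have s1 : s n x <= f x + `|M|.
    rewrite -(cvg_lim _ (sF x))//; apply: nondecreasing_cvgn_le.
      by move=> m p mp; exact: (lefP _ _ (nd_nnsfun_approx measurableT mF mp)).
    by apply/cvg_ex; eexists; exact: sF.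
  have := fM x; rewrite !ler_norml; have := ler_norm M; lra.
apply: (Clim (fun n x => s n x - `|M|) f (2 * `|M|)) => //.
- by move=> n; apply: measurable_funB.
- move=> x; rewrite -[f x](addrK `|M|); apply: cvgB; [exact: sF|exact: cvg_cst].
move=> n; pose r : seq R := finmap.enum_fset (fset_set (range (s n))).
have Cs : forall k, C (fun x => \sum_(i < k) (r`_i *
    \1_(s n @^-1` [set r`_i]) x) - `|M|) /\
    bounded (fun x => \sum_(i < k) (r`_i *
    \1_(s n @^-1` [set r`_i]) x) - `|M|) /\
    measurable_fun setT (fun x => \sum_(i < k) (r`_i *
    \1_(s n @^-1` [set r`_i]) x) - `|M|).
  elim=> [|k [ih1 [ih2 ih3]]].
    under eq_fun do rewrite big_ord0 sub0r.
    by split; [exact: Ccst|split; [exact: bcst|exact: measurable_cst]].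
  under eq_fun do rewrite big_ord_recr /= addrAC addrC.
  set c := r`_k.
  have mA : measurable (s n @^-1` [set c]) by exact: measurable_sfunP.
  split; first by apply: Clin => //; exact: Cind.
  split.
    have [B BP] := ih2; exists (`|c| + B) => x.
    rewrite (le_trans (ler_normD _ _))// lerD// normrM ler_piMr//.
    by rewrite indicE ger0_norm ?ler0n// lern1 leq_b1.
  apply: measurable_funD => //; apply: measurable_funM => //.
have [+ _] := Cs (size r).
by congr C; apply/funext => x; rewrite -fimfunEord.
Qed.

End bounded_measurable_ind.

Section Fubini_real.
Context d (T : measurableType d) (R : realType) (P : probability T R).
Local Notation mu := (@lebesgue_measure R).

(** A bound depending on l alone is integrable on the product, since P has mass 1. *)
Lemma Rintegral_Fubini (phi : T -> R -> R) (G : R -> R) :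
  measurable_fun setT (fun z : T * R => phi z.1 z.2) ->
  mu.-integrable [set: R] (EFin \o G) -> (forall x l, `|phi x l| <= G l) ->
  mu.-integrable [set: R] (EFin \o (fun l => \int[P]_x phi x l)) /\
  \int[P]_x \int[mu]_l phi x l = \int[mu]_l \int[P]_x phi x l.
Proof.
move=> mphi iG phiG.
have mphi1 x : measurable_fun setT (phi x).
  exact: (measurableT_comp (f := fun z => phi z.1 z.2) (g := pair x) mphi (pair1_measurable x)).
have mphi2 l : measurable_fun setT (phi ^~ l).
  exact: (measurableT_comp (f := fun z => phi z.1 z.2) (g := pair^~ l) mphi (pair2_measurable l)).
have i1 x : mu.-integrable [set: R] (EFin \o phi x).
  apply: (le_integrable _ _ _ iG) => //; first by apply/measurable_EFinP; exact: mphi1.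
  by move=> l _ /=; rewrite lee_fin (le_trans (phiG x l))// ler_norm.
have i2 l : P.-integrable setT (EFin \o phi ^~ l).
  exact: (@bounded_integrable _ _ _ _ _ (G l)).
have im : (P \x mu)%E.-integrable setT (fun z : T * R => (phi z.1 z.2)%:E).
  apply/integrable12ltyP; first exact/measurable_EFinP.
  apply: (@le_lt_trans _ _ (\int[P]_x cst (\int[mu]_l `|(G l)%:E|) x)%E).
    apply: ge0_le_integral => //=.
    - by move=> x _; exact: integral_ge0.
    - apply: (@measurable_fun_fubini_tonelli_F _ _ _ _ _ mu (fun z : T * R => `|(phi z.1 z.2)%:E|%E)).
      by apply: measurableT_comp => //; exact/measurable_EFinP.
      by move=> z.
    - move=> x _; apply: ge0_le_integral => //=.
      + by apply/measurable_EFinP; apply: measurableT_comp => //; exact: mphi1.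
      + apply/measurable_EFinP; apply: measurableT_comp => //.
        by apply/measurable_EFinP; case/integrableP : iG.
      + by move=> l _; rewrite lee_fin (le_trans (phiG x l))// ler_norm.
  rewrite integral_cst//= probability_setT mule1.
  by case/integrableP : iG.
have := Fubini im.
rewrite /fubini_F /fubini_G /= => E.
split.
  apply: (le_integrable _ _ _ iG) => //.
    have := measurable_fubini_G im; apply: eq_measurable_fun => // l _.
    rewrite /fubini_G /= /Rintegral fineK//.
    exact: (integrable_fin_num measurableT (i2 _)).
  move=> l _ /=; rewrite lee_fin.
  apply: (@le_trans _ _ (\int[P]_x G l)); last first.
    by rewrite probability_Rintegral_cst ler_norm.
  apply: le_trans (le_normr_Rintegral measurableT (i2 l)) _.
  apply: le_Rintegral => //; first exact: (integrable_norm (i2 l)).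
  exact: (@bounded_integrable _ _ _ _ _ `|G l|).
rewrite /Rintegral; congr fine.
under eq_integral do (rewrite fineK; last exact: (integrable_fin_num measurableT (i1 _))).
under [in RHS]eq_integral do (rewrite fineK; last exact: (integrable_fin_num measurableT (i2 _))).
exact: E.
Qed.

End Fubini_real.

Section transfer.
Context d (T : measurableType d) (R : realType) (P : probability T R).
Context d' (T' : measurableType d') (P' : probability T' R).
Variables (X Y : T -> R) (X' : T' -> R) (c MY : R).
Hypotheses (mX : measurable_fun setT X) (mY : measurable_fun setT Y)
  (YM : forall x, `|Y x| <= MY) (mX' : measurable_fun setT X').
Implicit Types f g : R -> R.

(* With Y = 1 and c = 1 this compares the laws of X and X'; with X' = X and
   c = E[Y] it expresses the independence of Y and X. *)
Definition matches f :=
  \int[P]_x (Y x * f (X x)) = c * \int[P']_x f (X' x).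

Let bounded f := exists M : R, forall x, `|f x| <= M.

Let integrable_Yf f : measurable_fun setT f -> bounded f ->
  P.-integrable setT (EFin \o (fun x => Y x * f (X x))).
Proof.
move=> mf [M fM]; apply: (@bounded_integrable _ _ _ _ _ (MY * M)).
  by apply: measurable_funM => //; exact: measurableT_comp.
by move=> x; rewrite normrM ler_pM.
Qed.

Let integrable_f f : measurable_fun setT f -> bounded f ->
  P'.-integrable setT (EFin \o (fun x => f (X' x))).
Proof.
move=> mf [M fM]; apply: (@bounded_integrable _ _ _ _ _ M) => //.
exact: measurableT_comp.
Qed.

Lemma matches_lin (a : R) f g : measurable_fun setT f -> bounded f ->
  measurable_fun setT g -> bounded g -> matches f -> matches g ->
  matches (fun x => a * f x + g x).
Proof.
move=> mf bf mg bg Df Dg; rewrite /matches.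
rewrite RintegralD//; last 2 first.
- have := integrableZl measurableT a (integrable_f mf bf).
  by apply: eq_integrable.
- exact: integrable_f.
rewrite RintegralZl//; last exact: integrable_f.
under eq_Rintegral do rewrite mulrDr mulrCA.
rewrite RintegralD//; last 2 first.
- have := integrableZl measurableT a (integrable_Yf mf bf).
  by apply: eq_integrable.
- exact: integrable_Yf.
rewrite RintegralZl//; last exact: integrable_Yf.
by rewrite Df Dg mulrDr mulrCA.
Qed.

Lemma matches_cvg (f_ : nat -> R -> R) f (M : R) :
  (forall n, measurable_fun setT (f_ n)) -> measurable_fun setT f ->
  (forall n x, `|f_ n x| <= M) -> (forall x, f_ n x @[n --> \oo] --> f x) ->
  (forall n, matches (f_ n)) -> matches f.
Proof.
move=> mf_ mf fM ff Df.
have c1 : \int[P]_x (Y x * f_ n (X x)) @[n --> \oo] --> \int[P]_x (Y x * f (X x)).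
  apply: (@Rintegral_bounded_cvg _ _ _ _ (fun n x => Y x * f_ n (X x)) _ (MY * M)).
  - by move=> n; apply: measurable_funM => //; exact: measurableT_comp.
  - by apply: measurable_funM => //; exact: measurableT_comp.
  - by move=> n x; rewrite normrM ler_pM.
  - by apply/aeW => x; apply: cvgM; [exact: cvg_cst|exact: ff].
have c2 : c * \int[P']_x f_ n (X' x) @[n --> \oo] --> c * \int[P']_x f (X' x).
  apply: cvgM; first exact: cvg_cst.
  apply: (@Rintegral_bounded_cvg _ _ _ _ (fun n x => f_ n (X' x)) _ M).
  - by move=> n; exact: measurableT_comp.
  - exact: measurableT_comp.
  - by move=> n x; exact: fM.
  - by apply/aeW => x; exact: ff.
move: c2; under eq_fun do rewrite -Df; move=> c2.
exact: (cvg_unique _ c1 c2).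
Qed.

Lemma matches_indic_bounded : (forall B, measurable B -> matches (\1_B)) ->
  forall f (M : R), measurable_fun setT f -> (forall x, `|f x| <= M) -> matches f.
Proof.
move=> DB; apply: bounded_measurable_ind => //.
- exact: matches_lin.
- exact: matches_cvg.
Qed.

(** Fubini on both sides: a superposition of test functions is again a test function. Cosines thus
    give Gaussians, and Gaussians give smoothed indicators. *)
Lemma matches_Rintegral (phi : R -> R -> R) (G : R -> R) :
  measurable_fun setT (fun z : R * R => phi z.1 z.2) ->
  (@lebesgue_measure R).-integrable [set: R] (EFin \o G) ->
  (forall x l, `|phi x l| <= G l) -> (forall l, matches (phi ^~ l)) ->
  matches (fun x => \int[lebesgue_measure]_l phi x l).
Proof.
move=> mphi iG phiG Dphi; rewrite /matches.
have mphi1 x : measurable_fun setT (phi x).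
  exact: (measurableT_comp (f := fun z => phi z.1 z.2) (g := pair x) mphi (pair1_measurable x)).
have i1 x : (@lebesgue_measure R).-integrable [set: R] (EFin \o phi x).
  apply: (le_integrable _ _ _ iG) => //; first by apply/measurable_EFinP; exact: mphi1.
  by move=> l _ /=; rewrite lee_fin (le_trans (phiG x l))// ler_norm.
have iMG : (@lebesgue_measure R).-integrable [set: R] (EFin \o (fun l => MY * G l)).
  by apply: eq_integrable (integrableZl measurableT MY iG).
under eq_Rintegral do rewrite -RintegralZl//.
have [|||_ ->] := @Rintegral_Fubini _ _ _ P (fun x l => Y x * phi (X x) l) (fun l => MY * G l).
- apply: measurable_funM; first exact: (measurableT_comp mY).
  apply: (measurableT_comp (f := fun z => phi z.1 z.2) (g := fun z => (X z.1, z.2))) => //.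
  by apply/measurable_fun_pairP; split; [exact: (measurableT_comp mX measurable_fst)|exact: measurable_snd].
- exact: iMG.
- by move=> x l; rewrite normrM ler_pM.
have [|||i2 ->] := @Rintegral_Fubini _ _ _ P' (fun x l => phi (X' x) l) G => //.
  apply: (measurableT_comp (f := fun z => phi z.1 z.2) (g := fun z => (X' z.1, z.2))) => //.
  by apply/measurable_fun_pairP; split; [exact: (measurableT_comp mX' measurable_fst)|exact: measurable_snd].
by rewrite -RintegralZl//; apply: eq_Rintegral => l _; exact: Dphi.
Qed.

End transfer.

(** * Fourier transform of the normal law *)

Section normal_fourier.
Context (R : realType).
Local Notation mu := (@lebesgue_measure R).
Variables (s : R) (s0 : 0 < s).
Let p : R -> R := normal_pdf 0 s.

Let pE x : p x = normal_peak s * expR (- (x ^+ 2 / (s ^+ 2 *+ 2))).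
Proof. by rewrite /p normal_pdfE ?gt_eqF// /normal_fun subr0 mulNr. Qed.

Let p_ge0 x : 0 <= p x. Proof. exact: normal_pdf_ge0. Qed.

Let is_derive_affine (a b x : R) : is_derive x 1 (fun y => y * a + b) a.
Proof.
rewrite (_ : (fun y => y * a + b) = a \*: (@id R) + cst b); last first.
  by apply/funext => y /=; rewrite mulrC.
by apply: is_derive_eq; rewrite addr0 /GRing.scale /= mulr1.
Qed.

Let is_derive_p (x : R) : is_derive x 1 p (- (x / s ^+ 2) * p x).
Proof.
have -> : p = (normal_peak s) \*: (expR \o ((- (s ^+ 2 *+ 2)^-1) \*: (fun y : R => y ^+ 2))).
  by apply/funext => y /=; rewrite pE /GRing.scale/= mulNr (mulrC (y ^+2)).
apply: is_derive_eq.
rewrite /GRing.scale /= /GRing.scale /= !mulr1.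
by set E := expR _; field; rewrite gt_eqF.
Qed.

Let is_derive_cosl (x th l : R) :
  is_derive l 1 (fun l => cos (l * x + th)) (- (x * sin (l * x + th))).
Proof.
apply: is_derive_eq (is_derive1_comp (is_derive_cos _) (is_derive_affine x th l)) _.
by rewrite mulNr mulrC.
Qed.

Let mp : measurable_fun setT p. Proof. exact: measurable_normal_pdf. Qed.

Let ip : mu.-integrable [set: R] (EFin \o p).
Proof. exact: integrable_normal_pdf. Qed.

(** Split the exponent x^2 / (2 s^2) into two copies of t = x^2 / (4 s^2). One copy absorbs |x|,
    because |x| = 2 s sqrt t <= 2 s exp t; the other is, up to normalisation, the normal density of
    deviation sqrt 2 s. This dominates the derivative in l under the integral. *)
Let ixp : mu.-integrable [set: R] (EFin \o (fun x => `|x| * p x)).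
Proof.
pose q := @normal_pdf R 0 (Num.sqrt 2 * s).
have s20 : 0 < Num.sqrt 2 * s by rewrite mulr_gt0// sqrtr_gt0.
pose k := normal_peak s / normal_peak (Num.sqrt 2 * s).
have iq := integrableZl measurableT (2 * s * k) (integrable_normal_pdf 0 (Num.sqrt 2 * s)).
apply: le_integrable iq => //.
  by apply/measurable_EFinP; apply: measurable_funM => //; exact: measurableT_comp.
move=> x _ /=; rewrite lee_fin normrM normr_id (ger0_norm (p_ge0 x)).
have k0 : 0 <= k by rewrite divr_ge0// normal_peak_ge0.
rewrite [leRHS]ger0_norm; last first.
  apply: mulr_ge0; last exact: normal_pdf_ge0.
  by apply: mulr_ge0 => //; apply: mulr_ge0 => //; exact: ltW.
rewrite pE normal_pdfE ?gt_eqF//  /normal_fun subr0 mulNr.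
have pk : normal_peak (Num.sqrt 2 * s) != 0 by rewrite gt_eqF// normal_peak_gt0// gt_eqF.
rewrite exprMn sqr_sqrtr//.
set t := x ^+ 2 / (2 * s ^+ 2 *+ 2).
rewrite (_ : x ^+ 2 / (s ^+ 2 *+ 2) = t + t); last by rewrite /t; field; rewrite gt_eqF.
rewrite opprD expRD [leRHS](_ : _ = normal_peak s * (2 * s * expR (- t))); last first.
  by rewrite /k; field.
rewrite mulrCA ler_wpM2l ?normal_peak_ge0// mulrA ler_wpM2r ?expR_ge0//.
rewrite expRN ler_pdivrMr ?expR_gt0//.
have ht : `|x| = 2 * s * (`|x| / (2 * s)) by field; rewrite gt_eqF.
rewrite [leLHS]ht; apply: ler_wpM2l; first by apply: mulr_ge0 => //; exact: ltW.
rewrite (le_trans _ (expR_ge1Dx t))//.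
have -> : t = (`|x| / (2 * s)) ^+ 2.
  by rewrite expr_div_n real_normK ?num_real// /t; congr (_ / _); ring.
by have := sqr_ge0 (`|x| / (2 * s) - 1); nra.
Qed.

Let F (th l : R) := \int[mu]_x (cos (l * x + th) * p x).

Let mcos (th l : R) : measurable_fun setT (fun x : R => cos (l * x + th)).
Proof.
apply: measurable_cos_comp.
by apply: measurable_funD => //; exact: measurable_funM.
Qed.

Let msin (th l : R) : measurable_fun setT (fun x : R => sin (l * x + th)).
Proof.
apply: measurableT_comp; first exact: (continuous_measurable_fun (@continuous_sin R)).
by apply: measurable_funD => //; exact: measurable_funM.
Qed.

Let icos (th l : R) :
  mu.-integrable [set: R] (EFin \o (fun x => cos (l * x + th) * p x)).
Proof.
apply: le_integrable ip => //.
  by apply/measurable_EFinP; apply: measurable_funM => //; exact: mcos.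
by move=> x _ /=; rewrite lee_fin normrM ler_piMl// cos_max.
Qed.

Let isin (th l : R) :
  mu.-integrable [set: R] (EFin \o (fun x => x * sin (l * x + th) * p x)).
Proof.
apply: le_integrable ixp => //.
  by apply/measurable_EFinP; apply: measurable_funM => //; apply: measurable_funM => //; exact: msin.
move=> x _ /=; rewrite lee_fin !normrM normr_id ler_wpM2r// ler_piMr//.
exact: sin_max.
Qed.

Let is_derive_F (th l : R) :
  is_derive l 1 (F th) (- (\int[mu]_x (x * sin (l * x + th) * p x))).
Proof.
have d1 (l' x : R) : is_derive l' 1 (fun l => cos (l * x + th) * p x)
    (- (x * sin (l' * x + th) * p x)).
  rewrite (_ : (fun l => _) = p x \*: (fun l => cos (l * x + th))); last first.
    by apply/funext => y /=; rewrite mulrC.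
  apply: is_derive_eq (is_deriveZ (p x) (is_derive_cosl x th l')) _.
  by rewrite /GRing.scale/= mulrN mulrC.
have I : `]l - 1, l + 1[%classic l by rewrite /= in_itv/= ltrBlDr ltrDl ltr01.
have h1 (x : R) : `]l - 1, l + 1[%classic x ->
  mu.-integrable [set: R] (EFin \o (fun y => cos (x * y + th) * p y)).
  by move=> _; exact: icos.
have h2 (x y : R) : `]l - 1, l + 1[%classic x -> [set: R] y ->
    derivable (fun l : R => cos (l * y + th) * p y) x 1.
  by move=> _ _; apply: ex_derive; exact: d1.
have h3 (y : R) : 0 <= `|y| * p y by rewrite mulr_ge0.
have h4 (x y : R) : `]l - 1, l + 1[%classic x -> [set: R] y ->
    `|partial1of2 (fun (l y : R) => cos (l * y + th) * p y) x y| <= `|y| * p y.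
  move=> _ _; rewrite partial1of2E; have [_ ->] := d1 x y.
  by rewrite normrN !normrM (ger0_norm (p_ge0 y)) ler_wpM2r// ler_piMr// sin_max.
apply: DeriveDef.
  exact: (derivable_under_integral measurableT I h1 h2 h3 ixp h4).
rewrite -derive1E (differentiation_under_integral measurableT I h1 h2 h3 ixp h4).
rewrite -[RHS]mulN1r -RintegralZl//.
by apply: eq_Rintegral => y _; rewrite partial1of2E; have [_ ->] := d1 l y; rewrite mulN1r.
Qed.

Let dp_sin (th l x : R) : is_derive x 1 (fun x => sin (l * x + th) * p x)
  (l * cos (l * x + th) * p x - (x / s ^+ 2) * (sin (l * x + th) * p x)).
Proof.
have h : is_derive x 1 (fun x => sin (l * x + th)) (cos (l * x + th) * l).
  rewrite (_ : (fun x => _) = (@sin R) \o (fun x => x * l + th)); last first.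
    by apply/funext => y /=; rewrite mulrC.
  apply: is_derive_eq (is_derive1_comp (is_derive_sin _) (is_derive_affine l th x)) _.
  by rewrite (mulrC x).
rewrite (_ : (fun x => _) = (fun x => sin (l * x + th)) * p)//.
apply: is_derive_eq (is_deriveM h (is_derive_p x)) _; rewrite /GRing.scale/=.
ring.
Qed.

(** The function [g] is the derivative of sin (l x + th) p x. Its integral over [-n, n] is a
    boundary term that tends to 0, so by dominated convergence its integral over the line
    vanishes. *)
Let integration_by_parts0 (th l : R) :
  \int[mu]_x (x * sin (l * x + th) * p x) = s ^+ 2 * l * F th l.
Proof.
pose g (x : R) := l * cos (l * x + th) * p x - (x / s ^+ 2) * (sin (l * x + th) * p x).
have ig : mu.-integrable [set: R] (EFin \o g).
  have := integrableB measurableT (integrableZl measurableT l (icos th l))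
    (integrableZl measurableT (s ^- 2) (isin th l)).
  apply: eq_integrable => // x _ /=; rewrite -!EFinM -EFinB /g; congr EFin; field.
  by rewrite gt_eqF.
suff g0 : \int[mu]_x g x = 0.
  have : \int[mu]_x g x = l * F th l - s ^- 2 * \int[mu]_x (x * sin (l * x + th) * p x).
    rewrite -!RintegralZl// -RintegralB//.
    - apply: eq_Rintegral => x _; rewrite /g; field; by rewrite gt_eqF.
    - by have := integrableZl measurableT l (icos th l); apply: eq_integrable.
    - by have := integrableZl measurableT (s ^- 2) (isin th l); apply: eq_integrable.
  rewrite g0 => /esym/eqP; rewrite subr_eq0 => /eqP E.
  rewrite -mulrA E; field; by rewrite gt_eqF.
have cG : continuous (fun x => sin (l * x + th) * p x).
  by move=> x; apply/differentiable_continuous/derivable1_diffP; case: (dp_sin th l x).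
have cg : continuous g.
  move=> x; apply: cvgB.
    apply: cvgM; last exact: continuous_normal_pdf (lt0r_neq0 s0) x.
    apply: cvgM; first exact: cvg_cst.
    apply: cvg_comp; last exact: continuous_cos.
    by apply: cvgD; [apply: cvgM; [exact: cvg_cst|exact: cvg_id]|exact: cvg_cst].
  by apply: cvgM; [apply: cvgM; [exact: cvg_id|exact: cvg_cst]|exact: cG].
pose gn (n : nat) (x : R) := g x * \1_(`[- n%:R, n%:R]) x.
have gnE (n : nat) : (0 < n)%N -> (\int[mu]_x (gn n x)%:E)%E =
   (sin (l * n%:R + th) * p n%:R - sin (l * - n%:R + th) * p (- n%:R))%:E.
  move=> n0; have nn : - n%:R < n%:R :> R by rewrite gtrN// ltr0n.
  have := @continuous_FTC2 R g (fun x => sin (l * x + th) * p x) _ _ nn.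
  rewrite -EFinB => <-.
  - rewrite [RHS]integral_mkcond; apply: eq_integral => x _.
    rewrite /gn patchE indicE; case: ifPn => _; first by rewrite mulr1.
    by rewrite mulr0.
  - exact: continuous_subspaceT.
  - split.
    + by move=> x _; case: (dp_sin th l x).
    + exact: cvg_at_right_filter (cG _).
    + exact: cvg_at_left_filter (cG _).
  - by move=> x _; rewrite derive1E; have [_ ->] := dp_sin th l x.
have [|||||_ _ cv] := @dominated_convergence _ _ _ mu [set: R] measurableT
   (fun n => EFin \o gn n) (EFin \o g) (fun x => `|(EFin \o g) x|%E).
- move=> n; apply/measurable_EFinP; apply: measurable_funM.
    by apply/measurable_EFinP; case/integrableP: ig.
  exact: measurable_indic.
- by case/integrableP: ig.
- apply/aeW => x _; apply: cvg_EFin; first exact: nearW.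
  apply: (@cvg_trans _ (g x @[n --> \oo])); last exact: cvg_cst.
  apply: near_eq_cvg; near=> n.
  rewrite /= /gn indicE mem_set ?mulr1//= in_itv/= -ler_norml.
  by near: n; exact: nbhs_infty_ger.
- exact: integrable_abse.
- apply/aeW => x n _ /=; rewrite lee_fin normrM ler_piMr// indicE.
  by rewrite ger0_norm ?ler0n// lern1 leq_b1.
have pn0 : p n%:R @[n --> \oo] --> 0.
  rewrite -(mulr0 (normal_peak s)).
  under eq_fun do rewrite pE; apply: cvgM; first exact: cvg_cst.
  apply: (cvg_comp (fun n : nat => n%:R ^+ 2 / (s ^+ 2 *+ 2)) (fun x => expR (- x))); last exact: cvgr_expR.
  have s2 : 0 < s ^+ 2 *+ 2 by rewrite mulrn_wgt0// exprn_gt0.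
  apply/cvgryPge => A; near=> n; rewrite ler_pdivlMr//.
  have n1 : 1 <= n%:R :> R by near: n; exact: nbhs_infty_ger.
  rewrite (@le_trans _ _ n%:R)//; first by near: n; exact: nbhs_infty_ger.
  by rewrite expr2 ler_peMl// ler0n.
have pN x : p (- x) = p x by rewrite !pE sqrrN.
have c2 : (p n%:R + p n%:R) @[n --> \oo] --> (0 : R).
  by rewrite -[X in _ --> X]addr0; exact: (cvgD pn0 pn0).
have cv0 : (sin (l * n%:R + th) * p n%:R - sin (l * - n%:R + th) * p (- n%:R)) @[n --> \oo] --> (0 : R).
  apply: (@squeeze_cvgr _ _ _ _ (fun n : nat => - (p n%:R + p n%:R)) (fun n : nat => (p n%:R + p n%:R))).
  - apply: nearW => n; rewrite -ler_norml (le_trans (ler_normB _ _))//.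
    by rewrite pN !normrM (ger0_norm (p_ge0 _)) lerD// ler_piMl// sin_max.
  - by rewrite -oppr0; exact: cvgN.
  - exact: c2.
rewrite /Rintegral; suff -> : (\int[mu]_x (g x)%:E = 0)%E by [].
apply: (cvg_unique _ cv) => //.
apply: (@cvg_trans _ (EFin (sin (l * n%:R + th) * p n%:R - sin (l * - n%:R + th) * p (- n%:R)) @[n --> \oo])).
  by apply: near_eq_cvg; exists 1%N => // n /= n0; rewrite -gnE.
by apply: cvg_EFin; [exact: nearW|exact: cv0].
Unshelve. all: by end_near. Qed.

(** By parts, F' = - s^2 l F; hence F times exp (l^2 s^2 / 2) is constant in l, with value cos th at
    l = 0. *)
Lemma normal_fourier (th l : R) :
  \int[mu]_x (cos (l * x + th) * normal_pdf 0 s x) =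
  cos th * expR (- (l ^+ 2 * s ^+ 2 / 2)).
Proof.
have dF (l' : R) : is_derive l' 1 (F th) (- (s ^+ 2 * l' * F th l')).
  by have := is_derive_F th l'; rewrite integration_by_parts0.
pose H (l : R) := F th l * expR (l ^+ 2 * s ^+ 2 / 2).
have dH (l' : R) : is_derive l' 1 H 0.
  have dE : is_derive l' 1 (expR \o (s ^+ 2 / 2 \*: (fun y : R => y ^+ 2)))
      (expR (s ^+ 2 / 2 * l' ^+ 2) * (s ^+ 2 / 2 * (l' + l'))).
    by apply: is_derive_eq; rewrite /GRing.scale/= /GRing.scale/= !mulr1.
  have -> : H = F th * (expR \o (s ^+ 2 / 2 \*: (fun y : R => y ^+ 2))).
    apply/funext => y; rewrite /H; apply: (congr1 (fun z => F th y * expR z)).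
    by rewrite /= /GRing.scale/=; ring.
  apply: is_derive_eq (is_deriveM (dF l') dE) _; rewrite /GRing.scale/= /GRing.scale/=.
  by field.
have := @is_derive_0_is_cst R H l 0 dH.
rewrite /H expr0n mul0r mul0r expR0 mulr1.
have -> : F th 0 = cos th.
  rewrite /F; under eq_Rintegral do rewrite mul0r add0r.
  rewrite RintegralZl// /Rintegral.
  by rewrite integral_normal_pdf mulr1.
move=> E; rewrite -/(F th l) -E -[RHS]mulrA -expRD subrr expR0 mulr1//.
Qed.

End normal_fourier.

(** * Smoothing of half-lines by normal densities *)

Section normal_density.
Context (R : realType).
Local Notation mu := (@lebesgue_measure R).

Lemma Rintegral_normal_prob (m s : R) (f : R -> R) (M : R) :
  measurable_fun setT f -> (forall x, `|f x| <= M) ->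
  \int[normal_prob m s]_x f x = \int[mu]_x (f x * normal_pdf m s x).
Proof.
have mp : measurable_fun setT (normal_pdf m s) by exact: measurable_normal_pdf.
have ip := integrable_normal_pdf m s.
have ifp (g : R -> R) : measurable_fun setT g -> (exists M : R, forall x, `|g x| <= M) ->
    mu.-integrable [set: R] (EFin \o (fun x => g x * normal_pdf m s x)).
  move=> mg [N gN].
  apply: le_integrable (integrableZl measurableT N ip) => //.
    by apply/measurable_EFinP; exact: measurable_funM.
  move=> x _ /=; rewrite lee_fin !normrM ler_wpM2r//.
  by rewrite (le_trans (gN x))// ler_norm.
apply: (bounded_measurable_ind (C := fun f => _ = _)) => //.
- move=> A mA; rewrite {1}/Rintegral integral_indic// setIT /= /normal_prob.
  rewrite /Rintegral [in LHS]integral_mkcond; congr fine; apply: eq_integral => x _.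
  rewrite patchE indicE; case: ifPn => _; first by rewrite mul1r.
  by rewrite mul0r.
- move=> a f1 f2 mf1 bf1 mf2 bf2 E1 E2.
  have i1 : (normal_prob m s).-integrable [set: R] (EFin \o f1).
    by have [N ?] := bf1; exact: (@bounded_integrable _ _ _ _ _ N).
  have i2 : (normal_prob m s).-integrable [set: R] (EFin \o f2).
    by have [N ?] := bf2; exact: (@bounded_integrable _ _ _ _ _ N).
  have i1' := ifp f1 mf1 bf1; have i2' := ifp f2 mf2 bf2.
  rewrite RintegralD//; last first.
    by have := integrableZl measurableT a i1; apply: eq_integrable.
  rewrite RintegralZl// E1 E2 -RintegralZl// -RintegralD//.
    by apply: eq_Rintegral => x _; rewrite mulrDl mulrA.
  by have := integrableZl measurableT a i1'; apply: eq_integrable.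
- move=> f_ f1 N mf_ mf1 fN ff E.
  have c1 : \int[normal_prob m s]_x f_ n x @[n --> \oo] --> \int[normal_prob m s]_x f1 x.
    by apply: (@Rintegral_bounded_cvg _ _ _ _ _ _ N) => //; exact/aeW.
  have c2 : \int[mu]_x (f_ n x * normal_pdf m s x) @[n --> \oo] -->
      \int[mu]_x (f1 x * normal_pdf m s x).
    have [||||| _ c] := @Rintegral_cvg _ _ _ mu (fun n x => f_ n x * normal_pdf m s x)
       (fun x => f1 x * normal_pdf m s x) (fun x => N * normal_pdf m s x).
    - by move=> n; apply: measurable_funM; [exact: mf_|exact: mp].
    - by apply: measurable_funM; [exact: mf1|exact: mp].
    - by have := integrableZl measurableT N ip; apply: eq_integrable.
    - by move=> n x; rewrite normrM (ger0_norm (normal_pdf_ge0 _ _ _)) ler_wpM2r// normal_pdf_ge0.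
    - by apply/aeW => x; apply: cvgM; [exact: ff|exact: cvg_cst].
    - exact: c.
  move: c2; under eq_fun do rewrite -E; move=> c2.
  exact: (cvg_unique _ c1 c2).
Qed.

(** At distance at least dl from x, half of the exponent is at least dl^2 / (4 s^2). The other half
    belongs to the density of deviation sqrt 2 s, whose peak is lower by the factor sqrt 2, and
    whose integral over A is at most 1. *)
Lemma normal_prob_tail (x s dl : R) (A : set R) : 0 < s -> 0 <= dl ->
  measurable A -> (forall y, A y -> dl <= `|y - x|) ->
  \int[mu]_(y in A) normal_pdf x s y <=
  Num.sqrt 2 * expR (- (dl ^+ 2 / (4 * s ^+ 2))).
Proof.
move=> s0 dl0 mA AD.
have r0 : 0 < Num.sqrt 2 :> R by rewrite sqrtr_gt0.
have s20 : 0 < Num.sqrt 2 * s by rewrite mulr_gt0.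
set e := expR _.
have iA (t : R) : mu.-integrable A (EFin \o normal_pdf x t).
  by apply: integrableS (integrable_normal_pdf x t).
have iA2 : mu.-integrable A (EFin \o (fun y => Num.sqrt 2 * e * normal_pdf x (Num.sqrt 2 * s) y)).
  by apply: eq_integrable (integrableZl _ (Num.sqrt 2 * e) (iA (Num.sqrt 2 * s))).
apply: (@le_trans _ _ (\int[mu]_(y in A) (Num.sqrt 2 * e * normal_pdf x (Num.sqrt 2 * s) y))).
  apply: le_Rintegral => // y Ay.
  rewrite !normal_pdfE ?gt_eqF// /normal_fun exprMn sqr_sqrtr//.
  have -> : normal_peak s = Num.sqrt 2 * normal_peak (Num.sqrt 2 * s).
    rewrite /normal_peak exprMn sqr_sqrtr//.
    rewrite (_ : 2 * s ^+ 2 * pi *+ 2 = 2 * (s ^+ 2 * pi *+ 2)); last by ring.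
    rewrite sqrtrM// invfM mulrA divff ?mul1r// gt_eqF//.
  rewrite -!mulrA ler_pM2l// mulrCA ler_wpM2l ?normal_peak_ge0//.
  rewrite /e -expRD ler_expR.
  have s2 : 0 < s ^+ 2 by rewrite exprn_gt0.
  have hd : dl ^+ 2 <= (y - x) ^+ 2.
    by rewrite -(real_normK (num_real (y - x))) lerXn2r// ?nnegrE// AD.
  rewrite -subr_ge0 [X in 0 <= X](_ : _ = ((y - x) ^+ 2 - dl ^+ 2) / (4 * s ^+ 2)).
    by rewrite divr_ge0// ?subr_ge0// mulr_ge0// ltW.
  by field; rewrite gt_eqF.
rewrite RintegralZl// ler_piMr//.
  by apply: mulr_ge0; [exact: ltW|exact: expR_ge0].
rewrite -lee_fin /Rintegral fineK; last exact: (integrable_fin_num _ (iA _)).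
rewrite -[leRHS](integral_normal_pdf x (Num.sqrt 2 * s)).
apply: ge0_subset_integral => //.
- by apply/measurable_EFinP; exact: measurable_normal_pdf.
- by move=> y _; rewrite lee_fin normal_pdf_ge0.
Qed.

(** An interval indicator convolved with a normal density. The margin 1 / (n + 1) above a is n + 1
    times the deviation, so the values tend to 0 at every x <= a, a included, and the limit is the
    open ray exactly. The upper end a + n keeps the window bounded, so that [matches_Rintegral] has
    an integrable majorant. *)
Definition smooth_ray (a : R) (n : nat) (x : R) : R :=
  \int[mu]_y (\1_`[a + n.+1%:R^-1, a + n%:R] y * normal_pdf x (n.+1%:R ^- 2) y).

Let tail_n (n : nat) : R := Num.sqrt 2 * expR (- ((n.+1%:R^-1) ^+ 2 / (4 * (n.+1%:R ^- 2) ^+ 2))).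

Let tail_n0 : tail_n n @[n --> \oo] --> 0.
Proof.
rewrite -(mulr0 (Num.sqrt 2)); apply: cvgM; first exact: cvg_cst.
apply: (cvg_comp (fun n : nat => n.+1%:R^-1 ^+ 2 / (4 * (n.+1%:R ^- 2) ^+ 2)) (fun x => expR (- x))); last exact: cvgr_expR.
apply/cvgryPge => A; near=> n.
have n0 : n.+1%:R != 0 :> R by [].
rewrite [leRHS](_ : _ = n.+1%:R * n.+1%:R / 4); last by field.
have nA : 4 * A <= n%:R by near: n; exact: nbhs_infty_ger.
have : n.+1%:R = n%:R + 1 :> R by rewrite -natr1.
have : 0 <= n%:R :> R by [].
by nra.
Unshelve. all: by end_near. Qed.

Let smooth_rayE (a : R) (n : nat) (x : R) : smooth_ray a n x =
  \int[mu]_(y in `[a + n.+1%:R^-1, a + n%:R]) normal_pdf x (n.+1%:R ^- 2) y.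
Proof.
rewrite [RHS]Rintegral_mkcond; apply: eq_Rintegral => y _.
by rewrite patchE indicE; case: ifPn; rewrite (mul1r, mul0r).
Qed.

Let smooth_ray_le1 (a : R) (n : nat) (x : R) : 0 <= smooth_ray a n x <= 1.
Proof.
rewrite smooth_rayE; apply/andP; split.
  by apply: Rintegral_ge0 => y _; exact: normal_pdf_ge0.
have i : mu.-integrable `[a + n.+1%:R^-1, a + n%:R] (EFin \o normal_pdf x (n.+1%:R ^- 2)).
  by apply: integrableS (integrable_normal_pdf x (n.+1%:R ^- 2)).
rewrite -lee_fin /Rintegral fineK; last exact: (integrable_fin_num _ i).
rewrite -[leRHS](integral_normal_pdf x (n.+1%:R ^- 2)).
apply: ge0_subset_integral => //.
- by apply/measurable_EFinP; exact: measurable_normal_pdf.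
- by move=> y _; rewrite lee_fin normal_pdf_ge0.
Qed.

Lemma smooth_ray_bounded (a : R) (n : nat) (x : R) : `|smooth_ray a n x| <= 1.
Proof.
by have /andP[h1 h2] := smooth_ray_le1 a n x; rewrite ger0_norm.
Qed.

Lemma smooth_ray_cvg (a x : R) :
  smooth_ray a n x @[n --> \oo] --> (\1_`]a, +oo[%classic x : R).
Proof.
have sn0 (n : nat) : 0 < n.+1%:R ^- 2 :> R by rewrite invr_gt0 exprn_gt0.
have dn0 (n : nat) : 0 <= n.+1%:R^-1 :> R by [].
rewrite indicE; have [xa|ax] := leP x a.
  rewrite memNset/=; last by rewrite in_itv/= andbT; apply/negP; rewrite -leNgt.
  apply: (@squeeze_cvgr _ _ _ _ (fun=> 0) tail_n); [|exact: cvg_cst|exact: tail_n0].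
  apply: nearW => n; have /andP[-> _] /= := smooth_ray_le1 a n x.
  rewrite smooth_rayE; apply: normal_prob_tail => // y /=.
  rewrite in_itv/= => /andP[ay _].
  apply: le_trans (ler_norm _); rewrite lerBrDl; apply: le_trans ay.
  by rewrite lerD2r.
rewrite mem_set/=; last by rewrite in_itv/= andbT.
have xa2 : 0 < (x - a) / 2 by lra.
apply: (@squeeze_cvgr _ _ _ _ (fun n => 1 - tail_n n) (fun=> 1)); [| |exact: cvg_cst].
  near=> n; have /andP[_ ->] := smooth_ray_le1 a n x; rewrite andbT.
  rewrite smooth_rayE; set A := [set` _].
  have mA : measurable A by exact: measurable_itv.
  have i1 := integrable_normal_pdf x (n.+1%:R ^- 2).
  have E : \int[mu]_y normal_pdf x (n.+1%:R ^- 2) y = 1.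
    by rewrite /Rintegral integral_normal_pdf.
  have E2 : \int[mu]_(y in A) normal_pdf x (n.+1%:R ^- 2) y +
      \int[mu]_(y in ~` A) normal_pdf x (n.+1%:R ^- 2) y = 1.
    rewrite -Rintegral_setU ?setUv//; first exact: measurableC.
    by rewrite disj_set2E setICr.
  rewrite lerBlDr -[leLHS]E2 lerD2l; apply: normal_prob_tail => //; first exact: measurableC.
  have d1 : n.+1%:R^-1 <= (x - a) / 2.
    by apply: ltW; near: n; exact: (near_infty_natSinv_lt (PosNum xa2)).
  have d2 : x - a + 1 <= n%:R by near: n; exact: nbhs_infty_ger.
  have d3 : n.+1%:R^-1 <= 1 :> R by rewrite invf_le1// ler1n.
  have H (z : R) : (z < a + n.+1%:R^-1) || (a + n%:R < z) -> n.+1%:R^-1 <= `|z - x|.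
    move: d1 d2 d3; move: (n.+1%:R^-1) (n%:R : R) => e m d1 d2 d3.
    move=> /orP[za|za]; first by rewrite distrC; apply: le_trans (ler_norm _); lra.
    by apply: le_trans (ler_norm _); lra.
  by move=> y; rewrite /A /= in_itv/= => /negP; rewrite negb_and -!ltNge; exact: H.
by rewrite -[X in _ --> X](subr0 1); apply: cvgB; [exact: cvg_cst|exact: tail_n0].
Unshelve. all: by end_near. Qed.

End normal_density.

Lemma measurable_smooth_ray_kernel (R : realType) (a : R) (n : nat) :
  measurable_fun setT (fun z : R * R =>
    \1_`[a + n.+1%:R^-1, a + n%:R] z.2 * normal_pdf z.1 (n.+1%:R ^- 2) z.2 : R).
Proof.
pose s : R := n.+1%:R ^- 2.
have s0 : 0 < s by rewrite invr_gt0 exprn_gt0.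
apply: measurable_funM.
  by apply: measurableT_comp => //; exact: measurable_indic.
rewrite -/s (_ : (fun z : R * R => _) = (fun z : R * R => normal_peak s *
   expR (- ((z.2 - z.1) ^+ 2 / (s ^+ 2 *+ 2))))); last first.
  by apply/funext => z; rewrite normal_pdfE ?gt_eqF// /normal_fun mulNr.
apply: measurable_funM => //; apply: measurableT_comp => //.
apply: measurableT_comp => //; apply: measurable_funM => //.
by apply: measurable_funX; exact: measurable_funB.
Qed.

Lemma measurable_smooth_ray (R : realType) (a : R) (n : nat) :
  measurable_fun setT (smooth_ray a n).
Proof.
apply: measurableT_comp => //.
apply: (@measurable_fun_fubini_tonelli_F _ _ _ _ _ (@lebesgue_measure R) (fun z : R * R =>
  (\1_`[a + n.+1%:R^-1, a + n%:R] z.2 * normal_pdf z.1 (n.+1%:R ^- 2) z.2)%:E)).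
  by apply/measurable_EFinP; exact: measurable_smooth_ray_kernel.
by move=> z; rewrite lee_fin mulr_ge0 ?normal_pdf_ge0.
Qed.

(** * Uniqueness of laws with given Fourier transform *)

Section fourier_uniqueness.
Context d (T : measurableType d) (R : realType) (P : probability T R).
Context d' (T' : measurableType d') (P' : probability T' R).
Variables (X Y : T -> R) (X' : T' -> R) (c MY : R).
Hypotheses (mX : measurable_fun setT X) (mY : measurable_fun setT Y)
  (YM : forall x, `|Y x| <= MY) (mX' : measurable_fun setT X').
Hypothesis matches_cos : forall l th : R,
  matches P P' X Y X' c (fun x => cos (l * x + th)).

Let matches_cst (k : R) : matches P P' X Y X' c (cst k).
Proof.
have h1 : exists M : R, forall x : R, `|(cst 1 : R -> R) x| <= M.
  by exists 1 => x; rewrite normr1.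
have D1 : matches P P' X Y X' c (cst 1).
  have := matches_cos 0 0; congr matches.
  by apply/funext => x; rewrite mul0r addr0 cos0.
have := matches_lin mX mY YM mX' (k - 1) (measurable_cst _) h1 (measurable_cst _) h1 D1 D1.
by congr matches; apply/funext => x /=; rewrite mulr1 subrK.
Qed.

Let matchesZ (k : R) (f : R -> R) : measurable_fun setT f ->
  (exists M : R, forall x, `|f x| <= M) ->
  matches P P' X Y X' c f -> matches P P' X Y X' c (fun x => k * f x).
Proof.
move=> mf bf Df; have h0 : exists M : R, forall x : R, `|(cst 0 : R -> R) x| <= M.
  by exists 0 => x; rewrite normr0.
have := matches_lin mX mY YM mX' k mf bf (measurable_cst _) h0 Df (matches_cst 0).
by congr matches; apply/funext => x /=; rewrite addr0.
Qed.

(* The normal density is a superposition of cosines, by its Fourier transform. *)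
Let matches_gauss (y s : R) : 0 < s ->
  matches P P' X Y X' c (fun x => expR (- ((x - y) ^+ 2 / (s ^+ 2 *+ 2)))).
Proof.
move=> s0; have s1 : 0 < s^-1 by rewrite invr_gt0.
have -> : (fun x => expR (- ((x - y) ^+ 2 / (s ^+ 2 *+ 2)))) =
    (fun x => \int[lebesgue_measure]_l (cos ((x - y) * l + 0) * normal_pdf 0 s^-1 l)).
  apply/funext => x; rewrite normal_fourier// cos0 mul1r; congr (expR (- _)).
  by field; rewrite gt_eqF.
apply: (@matches_Rintegral _ _ _ _ _ _ _ _ _ _ c MY mX mY YM mX' _ (normal_pdf 0 s^-1)) => //.
- apply: measurable_funM.
    apply: measurable_cos_comp.
    apply: measurable_funD => //; apply: measurable_funM => //.
    exact: measurable_funB.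
  by apply: measurableT_comp => //; exact: measurable_normal_pdf.
- exact: integrable_normal_pdf.
- move=> x l; rewrite normrM (ger0_norm (normal_pdf_ge0 _ _ _)).
  by rewrite ler_piMl ?normal_pdf_ge0// cos_max.
- move=> l.
  have -> : (fun x => cos ((x - y) * l + 0) * normal_pdf 0 s^-1 l) =
     (fun x => normal_pdf 0 s^-1 l * cos (l * x - l * y)).
    by apply/funext => x; rewrite mulrC; congr (_ * cos _); ring.
  apply: matchesZ => //.
  + apply: measurable_cos_comp.
    by apply: measurable_funD => //; exact: measurable_funM.
  + by exists 1 => x; exact: cos_max.
Qed.

Let matches_smooth_ray (a : R) (n : nat) : matches P P' X Y X' c (smooth_ray a n).
Proof.
pose s : R := n.+1%:R ^- 2.
have s0 : 0 < s by rewrite invr_gt0 exprn_gt0.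
pose G (y : R) : R := \1_`[a + n.+1%:R^-1, a + n%:R] y * normal_peak s.
apply: (@matches_Rintegral _ _ _ _ _ _ _ _ _ _ c MY mX mY YM mX' _ G) => //.
- exact: measurable_smooth_ray_kernel.
- apply: eq_integrable (integrableZr _ (normal_peak s) (integrable_indic_itv (a + n.+1%:R^-1) (a + n%:R) true false)) => //.
- move=> x l; rewrite normrM indicE ger0_norm ?ler0n//.
  by rewrite ler_wpM2l// ger0_norm ?normal_pdf_ge0// normal_pdf_ub// gt_eqF.
- move=> l; rewrite -/s.
  have -> : (fun x => \1_`[a + n.+1%:R^-1, a + n%:R] l * normal_pdf x s l) =
     (fun x => (\1_`[a + n.+1%:R^-1, a + n%:R] l * normal_peak s) *
        expR (- ((x - l) ^+ 2 / (s ^+ 2 *+ 2)))).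
    apply/funext => x; rewrite normal_pdfE ?gt_eqF// /normal_fun mulrA.
    by congr (_ * expR _); rewrite mulNr -sqrrN opprB.
  apply: matchesZ; last exact: matches_gauss.
  + apply: measurableT_comp => //; apply: measurableT_comp => //.
    apply: measurable_funM => //.
    by apply: measurable_funX; exact: measurable_funB.
  + exists 1 => x; rewrite ger0_norm ?expR_ge0// -expR0 ler_expR oppr_le0.
    by rewrite divr_ge0// ?sqr_ge0// mulrn_wge0// sqr_ge0.
Qed.

Let matches_ray (a : R) : matches P P' X Y X' c (\1_`]a, +oo[%classic).
Proof.
apply: (@matches_cvg _ _ _ _ _ _ _ _ _ _ c MY mX mY YM mX' (smooth_ray a) _ 1).
- by move=> n; exact: measurable_smooth_ray.
- exact: measurable_indic.
- by move=> n x; exact: smooth_ray_bounded.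
- by move=> x; exact: smooth_ray_cvg.
- exact: matches_smooth_ray.
Qed.

(** Open rays are limits of smoothed rays, are stable under intersection and generate the Borel
    sets; Dynkin's theorem reaches the other sets, since [matches] is linear and closed under
    bounded limits. *)
Lemma matches_cos_indic (B : set R) : measurable B ->
  matches P P' X Y X' c (\1_B).
Proof.
have b1 (A : set R) : exists M : R, forall x, `|\1_A x : R| <= M.
  by exists 1 => x; rewrite indicE ger0_norm ?ler0n// lern1 leq_b1.
move=> mB.
apply: (@dynkin_induction _ _ (@RGenOInfty.G R)
   (fun B => matches P P' X Y X' c (\1_B))) => //.
- exact: RGenOInfty.measurableE.
- move=> _ _ [x ->] [y ->]; exists (Num.max x y).
  by apply/seteqP; split => z /=; rewrite !in_itv/= !andbT gt_max => /andP.
- by have := matches_cst 1; congr matches; apply/funext => x; rewrite indicT.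
- by move=> _ [x ->]; exact: matches_ray.
- move=> S mS DS.
  have := matches_lin mX mY YM mX' (-1) (measurable_indic mS) (b1 _) (measurable_indic measurableT) (b1 _) DS (_ : matches P P' X Y X' c (\1_setT)).
  rewrite (_ : (fun x => -1 * _ + _) = \1_(~` S)).
    by apply; have := matches_cst 1; congr matches; apply/funext => x; rewrite indicT.
  apply/funext => x; rewrite !indicE in_setT in_setC.
  by case: (x \in S); rewrite /= ?mulr1 ?mulr0 ?addNr ?add0r.
- move=> F mF tF DF.
  (* Disjointness makes each partial sum of indicators an indicator, hence bounded by 1, so that
     bounded convergence applies to the union. *)
  have f1 (n k0 : nat) (x : R) : F k0 x ->
      \sum_(k < n) (\1_(F k) x : R) = (k0 < n)%N%:R.
    move=> Fx; rewrite (eq_bigr (fun k : 'I_n => if k == k0 :> nat then 1 else 0)).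
      by rewrite -big_mkcond/= (big_ord1_eq _ (fun=> 1 : R)); case: ifP.
    move=> k _; rewrite indicE; case: eqP => [->|kk0]; first by rewrite mem_set.
    by rewrite memNset// => Fkx; apply: kk0; apply: (tF _ _ I I); exists x.
  have f0 (n : nat) (x : R) : (forall k, ~ F k x) -> \sum_(k < n) (\1_(F k) x : R) = 0.
    by move=> nF; apply: big1 => k _; rewrite indicE memNset.
  apply: (@matches_cvg _ _ _ _ _ _ _ _ _ _ c MY mX mY YM mX' (fun n x => \sum_(k < n) \1_(F k) x) _ 1).
  + by move=> n; apply: measurable_sum => k; exact: measurable_indic.
  + by apply: measurable_indic; exact: bigcupT_measurable.
  + move=> n x; have [[k Fx]|nF] := pselect (exists k, F k x).
      by rewrite (f1 _ k)// ger0_norm ?ler0n// lern1 leq_b1.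
    by rewrite f0 ?normr0// => k Fx; apply: nF; exists k.
  + move=> x; have [[k Fx]|nF] := pselect (exists k, F k x).
      rewrite indicE mem_set; last by exists k.
      apply: (@cvg_trans _ ((fun=> 1 : R) n @[n --> \oo])); last exact: cvg_cst.
      by apply: near_eq_cvg; exists k.+1 => // n /= kn; rewrite (f1 _ k)// kn.
    rewrite indicE memNset; last by move=> [k _ Fx]; apply: nF; exists k.
    have -> : (fun n => \sum_(k < n) (\1_(F k) x : R)) = cst 0.
      by apply/funext => n; apply: f0 => k Fx; apply: nF; exists k.
    exact: cvg_cst.
  + elim=> [|n ih].
      by have := matches_cst 0; congr matches; apply/funext => x; rewrite big_ord0.
    have := matches_lin mX mY YM mX' 1 (measurable_indic (mF n)) (b1 _)
      (_ : measurable_fun setT (fun x => \sum_(k < n) (\1_(F k) x : R))) _ (DF n) ih.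
    rewrite (_ : (fun x => 1 * _ + _) = (fun x => \sum_(k < n.+1) (\1_(F k) x : R))); last first.
      by apply/funext => x; rewrite big_ord_recr/= mul1r addrC.
    apply; first by apply: measurable_sum => k; exact: measurable_indic.
    exists 1 => x; have [[k Fx]|nF] := pselect (exists k, F k x).
      by rewrite (f1 _ k)// ger0_norm ?ler0n// lern1 leq_b1.
    by rewrite f0 ?normr0// => k Fx; apply: nF; exists k.
by move: mB; rewrite -[X in X -> _]/(@measurable _ (measurableTypeR R) B) [measurable]RGenOInfty.measurableE.
Qed.

End fourier_uniqueness.

Section trigonometric_estimates.
Context (R : realType).
Implicit Types x y : R.

(** The derivative is bounded only at points no farther from y than x. With y = 0 this allows K to
    depend on x, which gives the quadratic estimate [norm_sinB_le]. *)
Lemma lipschitz_derive (f df : R -> R) (K : R) x y :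
  (forall x, is_derive x 1 f (df x)) ->
  (forall z, `|z - y| <= `|x - y| -> `|df z| <= K) ->
  `|f x - f y| <= K * `|x - y|.
Proof.
move=> fdf dfK.
have cf (A : set R) : {within A, continuous f}.
  apply: continuous_subspaceT => z.
  by apply/differentiable_continuous/derivable1_diffP; case: (fdf z).
have [yx|/ltW xy] := leP y x.
  have [c + ->] := MVT_segment yx (fun z _ => fdf z) (cf _).
  rewrite in_itv/= => /andP[yc cx]; rewrite normrM ler_wpM2r//; apply: dfK.
  by rewrite !ger0_norm ?subr_ge0// lerD2r.
have [c + E] := MVT_segment xy (fun z _ => fdf z) (cf _).
rewrite distrC E (distrC x) in_itv/= => /andP[xc cy].
rewrite normrM ler_wpM2r//; apply: dfK.
by rewrite distrC (distrC x) !ger0_norm ?subr_ge0// lerB.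
Qed.

Lemma sin_lipschitz x y : `|sin x - sin y| <= `|x - y|.
Proof.
rewrite -[leRHS]mul1r; apply: (@lipschitz_derive (@sin R) (@cos R)).
by move=> z _; exact: cos_max.
Qed.

Lemma cos_lipschitz x y : `|cos x - cos y| <= `|x - y|.
Proof.
rewrite -[leRHS]mul1r; apply: (@lipschitz_derive (@cos R) (fun x => - sin x)).
by move=> z _; rewrite normrN sin_max.
Qed.

Lemma norm_sin_le x : `|sin x| <= `|x|.
Proof. by have := sin_lipschitz x 0; rewrite sin0 !subr0. Qed.

Lemma norm_sinB_le x : `|sin x - x| <= x ^+ 2.
Proof.
have := @lipschitz_derive (fun x => sin x - x) (fun x => cos x - 1) `|x| x 0.
rewrite sin0 !subr0 -expr2 real_normK ?num_real//; apply.
by move=> z; rewrite !subr0 => zx; have := cos_lipschitz z 0; rewrite cos0 subr0 => /le_trans; apply.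
Qed.

Lemma expRN_le x : 0 <= x -> expR (- x) <= 1 - x + x ^+ 2.
Proof.
move=> x0; rewrite expRN; have x1 : 0 < 1 + x by lra.
apply: (@le_trans _ _ (1 + x)^-1).
  by rewrite lef_pV2 ?posrE ?expR_gt0// expR_ge1Dx.
rewrite -[leLHS]mul1r ler_pdivrMr//.
by have := exprn_ge0 3 x0; nra.
Qed.

Lemma expRN_ge x : 1 - x <= expR (- x).
Proof. exact: expR_ge1Dx. Qed.

End trigonometric_estimates.

(** * Moments recovered from the Fourier transform *)

Section moments.
Context d (T : measurableType d) (R : realType) (P : probability T R).
Variables (X : T -> R) (v : R).
Hypotheses (mX : measurable_fun setT X)
  (EcosX : forall l : R, \int[P]_x cos (l * X x) = expR (- (l ^+ 2 * v / 2))).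

(** A mean of cosines is at most 1, so the exponent at l = 1 is not positive. *)
Let v0 : 0 <= v.
Proof.
have : expR (- (1 ^+ 2 * v / 2)) <= 1.
  rewrite -EcosX -(probability_Rintegral_cst P 1).
  apply: le_Rintegral => //.
  - apply: (@bounded_integrable _ _ _ _ _ 1); last by move=> x; exact: cos_max.
    apply: measurable_cos_comp.
    exact: measurable_funM.
  - by apply: (@bounded_integrable _ _ _ _ _ 1) => // x; rewrite normr1.
rewrite expR_le1 oppr_le0 expr1n mul1r => h; lra.
Qed.
(* Bounded truncations of X whose second moment is read off the Fourier
   transform, since sin^2 = (1 - cos 2x) / 2. *)
Let c_ (n : nat) : R := 2 * n.+1%:R.
Let S_ (n : nat) x := c_ n * sin (X x / c_ n).

Let c_gt0 n : 0 < c_ n. Proof. by rewrite mulr_gt0. Qed.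

Let c_ge0 n : 0 <= c_ n. Proof. exact: ltW. Qed.

Let mS n : measurable_fun setT (S_ n).
Proof.
apply: measurable_funM => //.
apply: measurableT_comp; first exact: (continuous_measurable_fun (@continuous_sin R)).
exact: measurable_funM.
Qed.

Let LS n : L2 P (S_ n).
Proof.
apply: (@L2_bounded _ _ _ _ _ (c_ n)) => // x.
by rewrite normrM (ger0_norm (c_ge0 n)) ler_piMr// sin_max.
Qed.

Let S_le n x : `|S_ n x| <= `|X x|.
Proof.
rewrite normrM; apply: (@le_trans _ _ (`|c_ n| * `|X x / c_ n|)).
  by rewrite ler_wpM2l// norm_sin_le.
by rewrite -normrM mulrC divfK// gt_eqF.
Qed.

Let S_cvg x : S_ n x @[n --> \oo] --> X x.
Proof.
apply/cvgrPdist_le => e e0.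
near=> n; rewrite distrC.
have := norm_sinB_le (X x / c_ n) => h.
have -> : S_ n x - X x = c_ n * (sin (X x / c_ n) - X x / c_ n).
  by rewrite mulrBr; congr (_ - _); rewrite mulrC divfK// gt_eqF.
rewrite normrM (ger0_norm (ltW (c_gt0 n))).
apply: (@le_trans _ _ (c_ n * (X x / c_ n) ^+ 2)); first by rewrite ler_wpM2l// ltW.
rewrite (_ : _ * _ = X x ^+ 2 / c_ n); last by field; rewrite gt_eqF.
rewrite ler_pdivrMr// mulrC -ler_pdivrMr//.
apply: (@le_trans _ _ n%:R); first by near: n; exact: nbhs_infty_ger.
by rewrite /c_ -natr1; have : 0 <= n%:R :> R by []; lra.
Unshelve. all: by end_near. Qed.

Let icos (l : R) : P.-integrable setT (EFin \o (fun x => cos (l * X x))).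
Proof.
apply: (@bounded_integrable _ _ _ _ _ 1); last by move=> x; exact: cos_max.
apply: measurable_cos_comp.
exact: measurable_funM.
Qed.

Let icst (k : R) : P.-integrable setT (EFin \o (fun=> k)).
Proof. exact: (@bounded_integrable _ _ _ _ _ `|k|). Qed.

Let u_ n : R := 2 * v / c_ n ^+ 2.

Let S_sq n x : S_ n x ^+ 2 = c_ n ^+ 2 / 2 * (1 - cos (2 / c_ n * X x)).
Proof.
have -> : 2 / c_ n * X x = (X x / c_ n) *+ 2 by rewrite mulr2n; field; rewrite gt_eqF.
by rewrite cos_mulr2n /S_ exprMn sin2cos2; field.
Qed.

Let S_ip n : ip P (S_ n) (S_ n) = c_ n ^+ 2 / 2 * (1 - expR (- u_ n)).
Proof.
rewrite /ip; under eq_Rintegral do rewrite -expr2 S_sq.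
rewrite RintegralZl//; last first.
  by apply: eq_integrable (integrableB measurableT (icst 1) (icos (2 / c_ n))).
rewrite RintegralB//.
rewrite probability_Rintegral_cst EcosX; congr (_ * (_ - expR (- _))).
by rewrite /u_; field; rewrite gt_eqF.
Qed.

Let cu n : c_ n ^+ 2 * u_ n = 2 * v.
Proof. by rewrite /u_; field; rewrite gt_eqF. Qed.

Let u0 n : 0 <= u_ n.
Proof. by rewrite /u_ divr_ge0 ?sqr_ge0// mulr_ge0. Qed.

Let S_ip_le n : ip P (S_ n) (S_ n) <= v.
Proof.
rewrite S_ip; have := expRN_ge (u_ n); have := cu n.
have : 0 < c_ n ^+ 2 by rewrite exprn_gt0.
by nra.
Qed.

(** From 1 - u <= exp (- u) the truncations have second moment at most v, and Fatou's lemma passes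
    to X; square integrability thus comes out of the Fourier transform. *)
Lemma gaussian_L2 : L2 P X /\ ip P X X <= v.
Proof. by apply: ip_fatou LS S_ip_le mX _; exact/aeW. Qed.

(** Two limits of the truncated moments are compared: dominated convergence, with X^2 as majorant,
    gives the moment of X, while the explicit formula lies between v - v^2 / n and v. *)
Lemma gaussian_variance : ip P X X = v.
Proof.
have [[_ iX] _] := gaussian_L2.
have [|||||_ c1] := @Rintegral_cvg _ _ _ P (fun n x => S_ n x * S_ n x) (fun x => X x * X x) (fun x => X x ^+ 2).
- by move=> n; exact: measurable_funM.
- exact: measurable_funM.
- exact: iX.
- by move=> n x; rewrite normrM -(real_normK (num_real (X x))) expr2 ler_pM.
- by apply/aeW => x; apply: cvgM; exact: S_cvg.
apply: (cvg_unique _ c1) => //.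
suff: ip P (S_ n) (S_ n) @[n --> \oo] --> v by [].
apply: (@squeeze_cvgr _ _ _ _ (fun n => v - v ^+ 2 / n%:R) (fun=> v)); last exact: cvg_cst.
  near=> n; rewrite S_ip_le andbT S_ip.
  have n0 : 0 < n%:R :> R by near: n; exact: nbhs_infty_gtr.
  apply: (@le_trans _ _ (v - v * u_ n)).
    rewrite lerD2l lerN2 expr2 -mulrA ler_wpM2l//.
    rewrite /u_ ler_pdivrMr ?exprn_gt0// mulrAC ler_pdivlMr//.
    rewrite mulrAC mulrC ler_wpM2l// /c_ -natr1; nra.
  have := expRN_le (u0 n); have := cu n.
  have : 0 < c_ n ^+ 2 by rewrite exprn_gt0.
  by nra.
rewrite -[X in _ --> X]subr0; apply: cvgB; first exact: cvg_cst.
rewrite -(mulr0 (v ^+ 2)); apply: cvgM; first exact: cvg_cst.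
apply/gtr0_cvgV0; last exact: cvgr_idn.
by near=> n; near: n; exact: nbhs_infty_gtr.
Unshelve. all: by end_near. Qed.

(** The fourth power of the sine is a combination of 1, cos 2x and cos 4x, so the truncated moment
    is explicit. Elementary bounds on the exponentials give 8 in place of the exact 3; any constant
    serves in the chaining. *)
Lemma gaussian_fourth_moment : L2 P (fun x => X x ^+ 2) /\
  ip P (fun x => X x ^+ 2) (fun x => X x ^+ 2) <= 8 * v ^+ 2.
Proof.
have LS2 n : L2 P (fun x => S_ n x ^+ 2).
  apply: (@L2_bounded _ _ _ _ _ (c_ n ^+ 2)); first exact: measurable_funX.
  move=> x; rewrite normrX lerXn2r ?nnegrE//.
  by rewrite normrM (ger0_norm (c_ge0 n)) ler_piMr// sin_max.
apply: (@ip_fatou _ _ _ P (fun n x => S_ n x ^+ 2)) => //.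
- move=> n.
  have S4 x : S_ n x ^+ 2 * S_ n x ^+ 2 = c_ n ^+ 4 / 4 *
      (3 / 2 - 2 * cos (2 / c_ n * X x) + 2^-1 * cos (4 / c_ n * X x)).
    rewrite S_sq (_ : 4 / c_ n * X x = (2 / c_ n * X x) *+ 2).
      by rewrite cos_mulr2n; field.
    by field; rewrite gt_eqF.
  rewrite /ip; under eq_Rintegral do rewrite S4.
  have i1 : P.-integrable setT (EFin \o (fun x : T => 3 / 2 : R)).
    by apply: (@bounded_integrable _ _ _ _ _ `|3 / 2|).
  have i2 : P.-integrable setT (EFin \o (fun x : T => 2 * cos (2 / c_ n * X x))).
    by apply: eq_integrable (integrableZl measurableT 2 (icos (2 / c_ n))).
  have i3 : P.-integrable setT (EFin \o (fun x : T => 2^-1 * cos (4 / c_ n * X x))).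
    by apply: eq_integrable (integrableZl measurableT 2^-1 (icos (4 / c_ n))).
  have i4 : P.-integrable setT (EFin \o (fun x : T => 3 / 2 - 2 * cos (2 / c_ n * X x))).
    by apply: eq_integrable (integrableB measurableT i1 i2).
  rewrite RintegralZl//; last by apply: eq_integrable (integrableD measurableT i4 i3).
  rewrite RintegralD// RintegralB// !RintegralZl// probability_Rintegral_cst !EcosX.
  have -> : (2 / c_ n) ^+ 2 * v / 2 = u_ n by rewrite /u_; field; rewrite gt_eqF.
  have -> : (4 / c_ n) ^+ 2 * v / 2 = 4 * u_ n by rewrite /u_; field; rewrite gt_eqF.
  have u4 : 0 <= 4 * u_ n by rewrite mulr_ge0.
  have -> : 8 * v ^+ 2 = c_ n ^+ 4 / 4 * (8 * u_ n ^+ 2).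
    by rewrite /u_; field; rewrite gt_eqF.
  rewrite ler_wpM2l//; first by rewrite divr_ge0// exprn_ge0// ltW.
  by have := expRN_le u4; have := expRN_ge (u_ n); lra.
- exact: measurable_funX.
- apply/aeW => x; exact: (cvg_comp _ _ (@S_cvg x) (@exprn_continuous _ 2 (X x))).
Qed.

End moments.

(** * Independence and joint Fourier transforms *)

Section independence_cos.
Context d (T : measurableType d) (R : realType) (P : probability T R).
Variables (X : nat -> T -> R) (v : nat -> R).
Hypothesis mX : forall i, measurable_fun setT (X i).
Implicit Types (B : nat -> set R) (lam : nat -> R) (th : R).

Definition indic_prod B m n x : R := \prod_(m <= i < n) \1_(B i) (X i x).

Lemma indic_prod_bounds B m n x : 0 <= indic_prod B m n x <= 1.
Proof.
apply: (big_ind (fun y : R => 0 <= y <= 1)).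
- by rewrite ler01 lexx.
- by move=> y z /andP[y0 y1] /andP[z0 z1]; rewrite mulr_ge0//= mulr_ile1.
- by move=> i _; rewrite indicE ler0n lern1 leq_b1.
Qed.

Lemma measurable_indic_prod B m n : (forall i, measurable (B i)) ->
  measurable_fun setT (indic_prod B m n).
Proof.
move=> mB; apply: measurable_prod => i _.
by apply: measurableT_comp => //; exact: measurable_indic.
Qed.

Let mcos th (F : T -> R) : measurable_fun setT F ->
  measurable_fun setT (fun x => cos (th + F x)).
Proof.
move=> mF; apply: measurable_cos_comp.
exact: measurable_funD.
Qed.

Let msum lam m n : measurable_fun setT (fun x => \sum_(m <= i < n) lam i * X i x).
Proof. by apply: measurable_sum => i; exact: measurable_funM. Qed.

Let cos_prod_le1 th (F : T -> R) B m n x : `|cos (th + F x) * indic_prod B m n x| <= 1.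
Proof.
have /andP[h0 h1] := indic_prod_bounds B m n x.
by rewrite normrM (ger0_norm h0) mulr_ile1// cos_max.
Qed.

Let prob_prod B m n : R := \prod_(m <= i < n) \int[P]_x \1_(B i) (X i x).

Let integrable_cos_prod th (F : T -> R) B m n : measurable_fun setT F ->
  (forall i, measurable (B i)) ->
  P.-integrable setT (EFin \o (fun x => cos (th + F x) * indic_prod B m n x)).
Proof.
move=> mF mB; apply: (@bounded_integrable _ _ _ _ _ 1); last exact: cos_prod_le1.
by apply: measurable_funM; [exact: mcos|exact: measurable_indic_prod].
Qed.

(** Indicators are exchanged for cosines one variable at a time: the induction runs over hybrid
    expectations, with the cosine of a combination of the first k variables and indicators of the
    others. Freeing the set [B k] lets X k be tested against any bounded function. *)
Lemma indep_cos n :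
  (forall B, (forall i, measurable (B i)) ->
    \int[P]_x indic_prod B 0 n x = \prod_(0 <= i < n) \int[P]_x \1_(B i) (X i x)) ->
  (forall i l th, (i < n)%N ->
    \int[P]_x cos (l * X i x + th) = cos th * expR (- (l ^+ 2 * v i / 2))) ->
  forall lam th, \int[P]_x cos (th + \sum_(0 <= i < n) lam i * X i x) =
    cos th * expR (- (\sum_(0 <= i < n) lam i ^+ 2 * v i / 2)).
Proof.
move=> indep cosX lam th.
suff claim k : (k <= n)%N -> forall B th, (forall i, measurable (B i)) ->
    \int[P]_x (cos (th + \sum_(0 <= i < k) lam i * X i x) * indic_prod B k n x) =
    cos th * expR (- (\sum_(0 <= i < k) lam i ^+ 2 * v i / 2)) * prob_prod B k n.
  have := claim n (leqnn n) (fun=> setT) th (fun=> measurableT).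
  rewrite /prob_prod big_geq// mulr1 => <-; apply: eq_Rintegral => x _.
  by rewrite /indic_prod big_geq// mulr1.
elim: k => [_|k ih kn] B {}th mB.
  under eq_Rintegral do rewrite big_geq// addr0.
  rewrite big_geq// oppr0 expR0 mulr1 RintegralZl//; last first.
    apply: (@bounded_integrable _ _ _ _ _ 1); first exact: measurable_indic_prod.
    by move=> x; have /andP[h0 h1] := indic_prod_bounds B 0 n x; rewrite ger0_norm.
  by rewrite indep.
have {}ih := ih (ltnW kn).
pose Y th' x := cos (th' + \sum_(0 <= i < k) lam i * X i x) * indic_prod B k.+1 n x.
pose c th' := cos th' * expR (- (\sum_(0 <= i < k) lam i ^+ 2 * v i / 2)) * prob_prod B k.+1 n.
have mY th' : measurable_fun setT (Y th').
  by apply: measurable_funM; [exact: mcos|exact: measurable_indic_prod].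
have Y1 th' x : `|Y th' x| <= 1.
  exact: (cos_prod_le1 th' (fun x => \sum_(0 <= i < k) lam i * X i x)).
have DB th' A : measurable A -> matches P P (X k) (Y th') (X k) (c th') (\1_A).
  move=> mA; pose B' i := if i == k then A else B i.
  have mB' i : measurable (B' i) by rewrite /B'; case: ifP.
  have := ih B' th' mB'.
  have Ek : B' k = A by rewrite /B' eqxx.
  have E i : (k < i)%N -> B' i = B i by move=> ki; rewrite /B' gtn_eqF.
  rewrite /prob_prod big_ltn//.
  rewrite (_ : \prod_(k.+1 <= i < n) _ = prob_prod B k.+1 n); last first.
    by apply: eq_big_nat => i /andP[ki _]; rewrite E.
  rewrite Ek [RHS]mulrCA [RHS]mulrC /matches => <-.
  apply: eq_Rintegral => x _; rewrite /Y -mulrA; congr (_ * _).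
  rewrite /indic_prod [in RHS]big_ltn// Ek mulrC; congr (_ * _).
  by apply: eq_big_nat => i /andP[ki _]; rewrite E.
have Df th' (f : R -> R) (M : R) : measurable_fun setT f -> (forall x, `|f x| <= M) ->
    matches P P (X k) (Y th') (X k) (c th') f.
  by apply: (matches_indic_bounded (mX k) (mY th') (Y1 th') (mX k)); exact: DB.
have mcl (a b : R) : measurable_fun setT (fun x : R => cos (a * x + b)).
  apply: measurable_cos_comp.
  by apply: measurable_funD => //; exact: measurable_funM.
have D1 := @Df th (fun x => cos (lam k * x + 0)) 1 (mcl _ _) (fun x => cos_max _).
(* The shift by pi / 2 turns cosines into sines. The sine term of the addition formula vanishes
   because the mean of sin (lam k * X k) is cos (- pi / 2) times a factor. *)
have D2 := @Df (th - pi / 2) (fun x => cos (lam k * x + - (pi / 2))) 1 (mcl _ _) (fun x => cos_max _).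
move: D1 D2; rewrite /matches !cosX// cos0 mul1r.
rewrite cosN cos_pihalf mul0r mulr0 => D1 D2.
rewrite big_nat_recr//=.
transitivity (\int[P]_x (Y th x * cos (lam k * X k x + 0) -
    Y (th - pi / 2) x * cos (lam k * X k x + - (pi / 2)))).
  apply: eq_Rintegral => x _; rewrite /Y big_nat_recr//= addr0.
  set S := \sum_(_ <= _ < _) _.
  rewrite (_ : th - pi / 2 + S = th + S - pi / 2); last by ring.
  by rewrite !cosBpihalf addrA [in LHS]cosD; ring.
have iY th' b : P.-integrable setT (EFin \o (fun x => Y th' x * cos (lam k * X k x + b))).
  apply: (@bounded_integrable _ _ _ _ _ 1).
    by apply: measurable_funM => //; exact: (measurableT_comp (mcl _ _) (mX k)).
  by move=> x; rewrite normrM mulr_ile1// cos_max.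
rewrite RintegralB// D1 D2 subr0 /c opprD expRD; ring.
Qed.

(** The reverse exchange: once the hybrid expectation is known against all cosines of X k,
    [matches_cos_indic] replaces the cosine by an indicator. *)
Lemma cos_indep n :
  (forall lam th, \int[P]_x cos (th + \sum_(0 <= i < n) lam i * X i x) =
    cos th * expR (- (\sum_(0 <= i < n) lam i ^+ 2 * v i / 2))) ->
  forall B, (forall i, measurable (B i)) ->
    \int[P]_x indic_prod B 0 n x = \prod_(0 <= i < n) \int[P]_x \1_(B i) (X i x).
Proof.
move=> H B mB.
(* The law of one variable is obtained by setting all other coefficients to 0. *)
have cosX i l th : (i < n)%N ->
    \int[P]_x cos (l * X i x + th) = cos th * expR (- (l ^+ 2 * v i / 2)).
  move=> ni; have := H (fun j => if j == i then l else 0) th.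
  rewrite (eq_bigr (fun j => if j == i then l ^+ 2 * v i / 2 else 0)); last first.
    by move=> j _; case: eqP => [->//|_]; rewrite expr0n/= !mul0r.
  rewrite -big_mkcond/= big_mkord (big_ord1_eq _ (fun=> l ^+ 2 * v i / 2)) ni => <-.
  apply: eq_Rintegral => x _; rewrite addrC; congr (cos (_ + _)).
  rewrite (eq_bigr (fun j => if j == i then l * X i x else 0)); last first.
    by move=> j _; case: eqP => [->//|_]; rewrite !mul0r.
  by rewrite -big_mkcond/= big_mkord (big_ord1_eq _ (fun=> l * X i x)) ni.
suff claim k : (k <= n)%N -> forall lam th,
    \int[P]_x (cos (th + \sum_(k <= i < n) lam i * X i x) * indic_prod B 0 k x) =
    cos th * expR (- (\sum_(k <= i < n) lam i ^+ 2 * v i / 2)) * prob_prod B 0 k.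
  have := claim n (leqnn n) (fun=> 0) 0.
  rewrite [in X in expR (- X)]big_geq// oppr0 expR0 cos0 !mul1r => E; rewrite -[RHS]/(prob_prod B 0 n) -E.
  by apply: eq_Rintegral => x _; rewrite big_geq// addr0 cos0 mul1r.
elim: k => [_|k ih kn] lam th.
  rewrite /prob_prod big_geq// mulr1 -H; apply: eq_Rintegral => x _.
  by rewrite /indic_prod big_geq// mulr1.
have {}ih := ih (ltnW kn).
pose Y x := cos (th + \sum_(k.+1 <= i < n) lam i * X i x) * indic_prod B 0 k x.
pose c := cos th * expR (- (\sum_(k.+1 <= i < n) lam i ^+ 2 * v i / 2)) * prob_prod B 0 k.
have mY : measurable_fun setT Y.
  by apply: measurable_funM; [exact: mcos|exact: measurable_indic_prod].
have Y1 x : `|Y x| <= 1.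
  exact: (cos_prod_le1 th (fun x => \sum_(k.+1 <= i < n) lam i * X i x)).
suff /(matches_cos_indic (mX k) mY Y1 (mX k))/(_ (B k) (mB k)) : forall l th',
    matches P P (X k) Y (X k) c (fun x => cos (l * x + th')).
  rewrite /matches /c /prob_prod big_nat_recr//= mulrA => <-.
  by apply: eq_Rintegral => x _; rewrite /indic_prod /Y big_nat_recr//= mulrA.
move=> l th'; rewrite /matches cosX//.
pose lam' s j := if j == k then s else lam j.
have E1 s : \sum_(k <= i < n) lam' s i ^+ 2 * v i / 2 =
    s ^+ 2 * v k / 2 + \sum_(k.+1 <= i < n) lam i ^+ 2 * v i / 2.
  rewrite big_ltn// {1}/lam' eqxx; congr (_ + _).
  by apply: eq_big_nat => i /andP[ki _]; rewrite /lam' gtn_eqF.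
have E2 s x : \sum_(k <= i < n) lam' s i * X i x =
    s * X k x + \sum_(k.+1 <= i < n) lam i * X i x.
  rewrite big_ltn// {1}/lam' eqxx; congr (_ + _).
  by apply: eq_big_nat => i /andP[ki _]; rewrite /lam' gtn_eqF.
(* A product of two cosines is half the sum of the cosines of the sum and of the difference; these
   are hybrids in which X k has coefficient l or - l. *)
have := ih (lam' l) (th + th'); have := ih (lam' (- l)) (th - th').
rewrite !E1 sqrrN => F1 F2.
transitivity (2^-1 * (\int[P]_x (cos (th + th' + \sum_(k <= i < n) lam' l i * X i x) * indic_prod B 0 k x) +
  \int[P]_x (cos (th - th' + \sum_(k <= i < n) lam' (- l) i * X i x) * indic_prod B 0 k x))).
  rewrite -RintegralD//; last 2 first.
  - by apply: integrable_cos_prod => //; exact: msum.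
  - by apply: integrable_cos_prod => //; exact: msum.
  rewrite -RintegralZl//; last first.
    apply: eq_integrable (integrableD measurableT (integrable_cos_prod (th + th') _ _ (msum (lam' l) k n) mB) (integrable_cos_prod (th - th') _ _ (msum (lam' (-l)) k n) mB)) => //.
  apply: eq_Rintegral => x _; rewrite /Y !E2.
  set S := \sum_(_ <= _ < _) _.
  rewrite (_ : th + th' + _ = (th + S) + (l * X k x + th')); last by ring.
  rewrite (_ : th - th' + _ = (th + S) - (l * X k x + th')); last by ring.
  by rewrite [in RHS]cosD [in RHS]cosB; field.
rewrite F1 F2 /c opprD expRD cosD cosB; by field.
Qed.

End independence_cos.

Section indicator_expectations.
Context d (T : measurableType d) (R : realType) (P : probability T R).

Lemma Rintegral_indic_preimage (X : T -> R) (B : set R) :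
  measurable_fun setT X -> measurable B ->
  (\int[P]_x (\1_B (X x) : R))%:E = P (X @^-1` B).
Proof.
move=> mX mB; have mE : measurable (X @^-1` B).
  by rewrite -[X in measurable X]setTI; exact: mX.
rewrite /Rintegral (_ : (fun x => _) = (fun x => (\1_(X @^-1` B) x)%:E)); last first.
  by apply/funext => x.
by rewrite integral_indic// setIT fineK// fin_num_measure.
Qed.

Lemma Rintegral_indic_prod (X : nat -> T -> R) (B : nat -> set R) (n : nat) :
  (forall i, measurable_fun setT (X i)) -> (forall i, measurable (B i)) ->
  (\int[P]_x indic_prod X B 0 n x)%:E = P (\bigcap_(i in [set: 'I_n]) (X i @^-1` B i)).
Proof.
move=> mX mB; have mI : measurable (\bigcap_(i in [set: 'I_n]) (X i @^-1` B i)).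
  apply: fin_bigcap_measurable => // i _.
  by rewrite -[X in measurable X]setTI; exact: mX.
rewrite /Rintegral (_ : (fun x => _) =
    (fun x => (\1_(\bigcap_(i in [set: 'I_n]) (X i @^-1` B i)) x)%:E)); last first.
  apply/funext => x; congr EFin; rewrite /indic_prod big_mkord.
  have [xI|xI] := pselect ((\bigcap_(i in [set: 'I_n]) (X i @^-1` B i)) x).
    rewrite [RHS]indicE mem_set//; apply: big1 => i _.
    by rewrite indicE mem_set//; exact: (xI i).
  rewrite [RHS]indicE memNset//.
  have [i Bi] : exists i : 'I_n, ~ B i (X i x).
    by apply: contrapT => H'; apply: xI => i _ /=; apply: contrapT => Bi; apply: H'; exists i.
  by rewrite (bigD1 i)//= indicE memNset// mul0r.
by rewrite integral_indic// setIT fineK// fin_num_measure.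
Qed.

End indicator_expectations.

Section L2_convergence.
Context d (T : measurableType d) (R : realType) (P : probability T R).
Implicit Types X Y Z : T -> R.

Definition ipsq X := ip P X X.
(** The square of the distance: the triangle inequality then costs a factor 2, but no square roots
    have to be handled. *)
Definition dist2 X Y := ipsq (fun x => X x - Y x).

Lemma ipsqD X Y : L2 P X -> L2 P Y ->
  ipsq (fun x => X x + Y x) = ipsq X + 2 * ip P X Y + ipsq Y.
Proof.
move=> LX LY; rewrite /ipsq ipDl//; last exact: L2D.
rewrite !ipDr// (ipC P Y X); ring.
Qed.

Lemma ipsqB X Y : L2 P X -> L2 P Y ->
  ipsq (fun x => X x - Y x) = ipsq X - 2 * ip P X Y + ipsq Y.
Proof.
move=> LX LY; rewrite /ipsq ipBl//; last exact: L2B.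
rewrite !ipBr// (ipC P Y X); ring.
Qed.

Lemma ipsqZ (c : R) X : L2 P X -> ipsq (fun x => c * X x) = c ^+ 2 * ipsq X.
Proof.
move=> LX; rewrite /ipsq ipZl//; last exact: L2Z.
by rewrite ipZr//; ring.
Qed.

Lemma ipsq_ge0 X : 0 <= ipsq X. Proof. exact: ip_ge0. Qed.

Lemma ipsqD_le X Y : L2 P X -> L2 P Y ->
  ipsq (fun x => X x + Y x) <= 2 * ipsq X + 2 * ipsq Y.
Proof.
move=> LX LY; have := ipsq_ge0 (fun x => X x - Y x).
rewrite ipsqB// ipsqD//; lra.
Qed.

Lemma dist2_triangle X Y Z : L2 P X -> L2 P Y -> L2 P Z ->
  dist2 X Z <= 2 * dist2 X Y + 2 * dist2 Y Z.
Proof.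
move=> LX LY LZ; have := ipsqD_le (L2B LX LY) (L2B LY LZ).
by rewrite /dist2; under [X in ipsq X <= _ -> _]eq_fun do rewrite addrA subrK.
Qed.

Lemma dist2C X Y : dist2 X Y = dist2 Y X.
Proof. by apply: eq_Rintegral => x _; ring. Qed.

Lemma dist2_ge0 X Y : 0 <= dist2 X Y. Proof. exact: ipsq_ge0. Qed.

Lemma ip_dist2 X Y Z : L2 P X -> L2 P Y -> L2 P Z ->
  `|ip P X Z - ip P Y Z| <= Num.sqrt (dist2 X Y) * Num.sqrt (ipsq Z).
Proof. by move=> LX LY LZ; rewrite -ipBl//; apply: ip_CS => //; exact: L2B. Qed.

Lemma dist2_ip_cvg (X_ : nat -> T -> R) X Y :
  (forall n, L2 P (X_ n)) -> L2 P X -> L2 P Y ->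
  dist2 (X_ n) X @[n --> \oo] --> 0 ->
  ip P (X_ n) Y @[n --> \oo] --> ip P X Y.
Proof.
move=> LX_ LX LY cX; apply/subr_cvg0/norm_cvg0P.
apply: (@squeeze_cvgr _ _ _ _ (fun=> 0) (fun n => Num.sqrt (dist2 (X_ n) X) * Num.sqrt (ipsq Y))).
- by apply: nearW => n; rewrite normr_ge0 ip_dist2.
- exact: cvg_cst.
- rewrite -(mul0r (Num.sqrt (ipsq Y))) -sqrtr0; apply: cvgM; last exact: cvg_cst.
  by apply: (cvg_comp _ _ cX); exact: sqrt_continuous.
Qed.

Lemma dist2_ipsq_cvg (X_ : nat -> T -> R) X :
  (forall n, L2 P (X_ n)) -> L2 P X ->
  dist2 (X_ n) X @[n --> \oo] --> 0 ->
  ipsq (X_ n) @[n --> \oo] --> ipsq X.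
Proof.
move=> LX_ LX cX.
have E n : ipsq (X_ n) = dist2 (X_ n) X + 2 * ip P (X_ n) X - ipsq X.
  by rewrite /dist2 ipsqB//; ring.
have : dist2 (X_ n) X + 2 * ip P (X_ n) X - ipsq X @[n --> \oo] --> 0 + 2 * ip P X X - ipsq X.
  apply: cvgB; last exact: cvg_cst.
  apply: cvgD => //; apply: cvgM; first exact: cvg_cst.
  exact: dist2_ip_cvg.
under eq_fun do rewrite -E.
by rewrite (_ : 0 + _ - _ = ipsq X)// /ipsq; ring.
Qed.

Lemma measurable_cos_affine (F : T -> R) (l th : R) : measurable_fun setT F ->
  measurable_fun setT (fun x => cos (l * F x + th)).
Proof.
move=> mF; apply: measurable_cos_comp.
by apply: measurable_funD => //; exact: measurable_funM.
Qed.

Lemma integrable_cos_affine (F : T -> R) (l th : R) : measurable_fun setT F ->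
  P.-integrable setT (EFin \o (fun x => cos (l * F x + th))).
Proof.
move=> mF; apply: (@bounded_integrable _ _ _ _ _ 1); last by move=> x; exact: cos_max.
exact: measurable_cos_affine.
Qed.

(** The cosine is 1-Lipschitz and the mean of |X_n - X| is at most the root of [dist2]. Gaussian
    Fourier transforms therefore survive mean-square limits. *)
Lemma dist2_cos_cvg (X_ : nat -> T -> R) X (l th : R) :
  (forall n, L2 P (X_ n)) -> L2 P X ->
  dist2 (X_ n) X @[n --> \oo] --> 0 ->
  \int[P]_x cos (l * X_ n x + th) @[n --> \oo] --> \int[P]_x cos (l * X x + th).
Proof.
move=> LX_ LX cX; apply/subr_cvg0/norm_cvg0P.
have mX : measurable_fun setT X by case: LX.
have mX_ n : measurable_fun setT (X_ n) by case: (LX_ n).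
apply: (@squeeze_cvgr _ _ _ _ (fun=> 0) (fun n => `|l| * Num.sqrt (dist2 (X_ n) X))).
- apply: nearW => n; rewrite normr_ge0/=.
  rewrite -RintegralB//; try exact: integrable_cos_affine.
  have LD := L2B (LX_ n) LX.
  have mD : measurable_fun setT (fun x => X_ n x - X x) by case: LD.
  have LA : L2 P (fun x => `|X_ n x - X x|).
    split; first exact: measurableT_comp.
    case: LD => _; apply: eq_integrable => // x _ /=.
    by rewrite real_normK// num_real.
  apply: (le_trans (le_normr_Rintegral _ _)) => //.
    by apply: eq_integrable (integrableB measurableT (integrable_cos_affine l th (mX_ n)) (integrable_cos_affine l th mX)).
  apply: (@le_trans _ _ (\int[P]_x (`|l| * `|X_ n x - X x|))).
    apply: le_Rintegral => //.
    + apply: integrable_norm; apply: eq_integrable (integrableB measurableT (integrable_cos_affine l th (mX_ n)) (integrable_cos_affine l th mX)) => //.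
    + by have := L2_integrable (L2Z `|l| LA).
    + move=> x _; apply: le_trans (cos_lipschitz _ _) _.
      by rewrite -normrM mulrBr opprD addrACA subrr addr0.
  rewrite RintegralZl//; last exact: L2_integrable.
  rewrite ler_wpM2l//.
  have := ip_CS LA (L2_cst P 1).
  have -> : ip P (fun=> 1) (fun=> 1) = 1.
    by rewrite /ip; under eq_Rintegral do rewrite mulr1; rewrite probability_Rintegral_cst.
  rewrite sqrtr1 mulr1.
  have -> : ip P (fun x => `|X_ n x - X x|) (fun=> 1) = \int[P]_x `|X_ n x - X x|.
    by apply: eq_Rintegral => x _; rewrite mulr1.
  have -> : ip P (fun x => `|X_ n x - X x|) (fun x => `|X_ n x - X x|) = dist2 (X_ n) X.
    by apply: eq_Rintegral => x _; rewrite -normrM ger0_norm// -expr2 sqr_ge0.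
  by apply: le_trans; exact: ler_norm.
- exact: cvg_cst.
- rewrite -(mulr0 `|l|) -sqrtr0; apply: cvgM; first exact: cvg_cst.
  by apply: (cvg_comp _ _ cX); exact: sqrt_continuous.
Qed.

Lemma dist2_ae_unique X Y (Z_ : nat -> T -> R) : L2 P X -> L2 P Y -> (forall n, L2 P (Z_ n)) ->
  dist2 (Z_ n) X @[n --> \oo] --> 0 -> dist2 (Z_ n) Y @[n --> \oo] --> 0 ->
  {ae P, forall x, X x = Y x}.
Proof.
move=> LX LY LZ cX cY.
have LD := L2B LX LY.
suff D0 : ip P (fun x => X x - Y x) (fun x => X x - Y x) = 0.
  by apply: filterS (ip_eq0_ae LD D0) => x /eqP; rewrite subr_eq0 => /eqP.
apply/eqP; rewrite eq_le ip_ge0 andbT.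
have c0 : (2 * dist2 (Z_ n) X + 2 * dist2 (Z_ n) Y) @[n --> \oo] --> (0 : R).
  rewrite -[0]addr0 -{1 2}(mulr0 2).
  by apply: cvgD; apply: cvgM => //; exact: cvg_cst.
rewrite -(cvg_lim _ c0)//; apply: limr_ge; first by apply/cvg_ex; exists 0.
by apply: nearW => n; rewrite (dist2C (Z_ n) X); exact: dist2_triangle.
Qed.

End L2_convergence.

(** * The Gaussian space of a Wiener process *)

Section wiener_increments.
Context d (T : measurableType d) (R : realType) (P : probability T R).
Variable W : R -> {RV P >-> R}.
Hypothesis hW : standard_wiener W.

Lemma mRV (X : {RV P >-> R}) : measurable_fun setT (X : T -> R).
Proof. exact: (measurable_funPT X). Qed.

Let incr (s t : R) (x : T) : R := W t x - W s x.

Let mincr s t : measurable_fun setT (incr s t).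
Proof. by apply: measurable_funB; exact: mRV. Qed.

Lemma wiener_incr_cos (s t l th : R) : 0 <= s -> s <= t -> t <= 1 ->
  \int[P]_x cos (l * (W t x - W s x) + th) = cos th * expR (- (l ^+ 2 * (t - s) / 2)).
Proof.
move=> s0 st t1.
(* The law of an increment is prescribed only for s < t. For s = t the increment is 0 and both sides
   equal cos th. *)
move: st; rewrite le_eqVlt => /predU1P[->|st].
  rewrite subrr mulr0 mul0r oppr0 expR0 mulr1.
  under eq_Rintegral do rewrite subrr mulr0 add0r.
  exact: probability_Rintegral_cst.
have [_ _ /(_ s t s0 st t1) dW _] := hW.
pose N : probability (measurableTypeR R) R := normal_prob 0 (Num.sqrt (t - s)).
have ts0 : 0 < Num.sqrt (t - s) by rewrite sqrtr_gt0 subr_gt0.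
have m1 (a b : R) : measurable_fun setT (fun x : R => cos (a * x + b)).
  apply: measurable_cos_comp.
  by apply: measurable_funD => //; exact: measurable_funM.
have DB B : measurable B -> matches P N (incr s t) (fun=> 1) (fun x : measurableTypeR R => x : R) 1 (\1_B).
  move=> mB; rewrite /matches mul1r; under eq_Rintegral do rewrite mul1r.
  apply: EFin_inj; rewrite Rintegral_indic_preimage//; apply: (etrans (dW B mB)).
  by rewrite (@Rintegral_indic_preimage _ _ _ N (fun x : measurableTypeR R => x : R)).
have := @matches_indic_bounded _ _ _ P _ _ N (incr s t) (fun=> 1) (fun x : measurableTypeR R => x : R) 1 1 (@mincr s t)
  (measurable_cst _) _ (@measurable_id _ (measurableTypeR R) setT) DB (fun x => cos (l * x + th)) 1 (m1 _ _).
move=> /(_ (fun=> _)) H.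
have {H} := H _ (fun x => cos_max _).
rewrite /matches mul1r; under eq_Rintegral do rewrite mul1r.
move=> ->; last by rewrite normr1.
rewrite (@Rintegral_normal_prob R 0 _ (fun x => cos (l * x + th)) 1)//; last by move=> x; exact: cos_max.
by rewrite normal_fourier// sqr_sqrtr// subr_ge0 ltW.
Qed.

Lemma wiener_combo_cos (n : nat) (t : nat -> R) (lam : nat -> R) (th : R) :
  0 <= t 0%N -> (forall i, (i < n)%N -> t i <= t i.+1) -> t n <= 1 ->
  \int[P]_x cos (th + \sum_(0 <= i < n) lam i * (W (t i.+1) x - W (t i) x)) =
  cos th * expR (- (\sum_(0 <= i < n) lam i ^+ 2 * (t i.+1 - t i) / 2)).
Proof.
move=> t0 tn tn1.
have mono i j : (i <= j)%N -> (j <= n)%N -> t i <= t j.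
  elim: j => [|j ih]; first by rewrite leqn0 => /eqP ->.
  rewrite leq_eqVlt => /predU1P[->//|ij] jn.
  by rewrite (le_trans (ih _ _))//; [exact: ltnW|exact: tn].
apply: (@indep_cos _ _ _ P (fun i => incr (t i) (t i.+1)) (fun i => t i.+1 - t i)) => //.
- move=> B mB.
  have [_ _ _ /(_ n t t0 tn tn1)/(_ (fun i => B i))] := hW.
  move=> /(_ (fun i => mB i)) H.
  apply: EFin_inj; rewrite big_mkord -prodEFin Rintegral_indic_prod//.
  by under [RHS]eq_bigr do rewrite Rintegral_indic_preimage//.
- move=> i l th' ni; apply: wiener_incr_cos.
  + by rewrite (le_trans t0)// mono// ltnW.
  + exact: tn.
  + by rewrite (le_trans _ tn1)// mono.
Qed.

End wiener_increments.

Section wiener_combos.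
Context d (T : measurableType d) (R : realType) (P : probability T R).
Variable W : R -> {RV P >-> R}.
Hypothesis hW : standard_wiener W.

Definition wiener_combo (t lam : nat -> R) (n : nat) (x : T) : R :=
  \sum_(0 <= i < n) lam i * (W (t i.+1) x - W (t i) x).

Lemma measurable_wiener_combo t lam n : measurable_fun setT (wiener_combo t lam n).
Proof.
apply: measurable_sum => i; apply: measurable_funM => //.
by apply: measurable_funB; exact: mRV.
Qed.

Let wiener_combo_cos_scale (t : nat -> R) n (l th : R) (lam : nat -> R) :
  0 <= t 0%N -> (forall i, (i < n)%N -> t i <= t i.+1) -> t n <= 1 ->
  \int[P]_x cos (l * wiener_combo t lam n x + th) =
  cos th * expR (- (l ^+ 2 * (\sum_(0 <= i < n) lam i ^+ 2 * (t i.+1 - t i)) / 2)).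
Proof.
move=> t0 tn t1.
have -> : l ^+ 2 * (\sum_(0 <= i < n) lam i ^+ 2 * (t i.+1 - t i)) / 2 =
    \sum_(0 <= i < n) (l * lam i) ^+ 2 * (t i.+1 - t i) / 2.
  by rewrite mulr_sumr mulr_suml; apply: eq_bigr => i _; rewrite exprMn !mulrA.
rewrite -(wiener_combo_cos hW (fun i => l * lam i) th t0 tn t1).
apply: eq_Rintegral => x _; rewrite addrC /wiener_combo mulr_sumr.
by under eq_bigr do rewrite mulrA.
Qed.

Lemma wiener_combo_L2 (t lam : nat -> R) n :
  0 <= t 0%N -> (forall i, (i < n)%N -> t i <= t i.+1) -> t n <= 1 ->
  L2 P (wiener_combo t lam n) /\
  ipsq P (wiener_combo t lam n) = \sum_(0 <= i < n) lam i ^+ 2 * (t i.+1 - t i).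
Proof.
move=> t0 tn t1.
have H (l : R) : \int[P]_x cos (l * wiener_combo t lam n x) =
    expR (- (l ^+ 2 * (\sum_(0 <= i < n) lam i ^+ 2 * (t i.+1 - t i)) / 2)).
  have := wiener_combo_cos_scale l 0 lam t0 tn t1; rewrite cos0 mul1r => <-.
  by apply: eq_Rintegral => x _; rewrite addr0.
have mX := measurable_wiener_combo t lam n.
split; first by have [] := gaussian_L2 mX H.
exact: (gaussian_variance mX H).
Qed.

Definition grid (N : nat) (i : nat) : R := i%:R / N%:R.

Lemma grid_mono N i : grid N i <= grid N i.+1.
Proof. by rewrite /grid ler_wpM2r ?invr_ge0// ler_nat. Qed.

Lemma gridN_le1 N : grid N N <= 1.
Proof.
case: N => [|N]; first by rewrite /grid mul0r.
by rewrite /grid divff.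
Qed.

Lemma combo_L2 lam N : L2 P (wiener_combo (grid N) lam N).
Proof.
have [||| //] := @wiener_combo_L2 (grid N) lam N; first by rewrite /grid mul0r.
- by move=> i _; exact: grid_mono.
- exact: gridN_le1.
Qed.

(* The Gaussian space spanned by W: the mean-square limits of combinations of
   increments over uniform grids.  Asking for an approximation on all large
   grids makes linearity immediate, without common refinements. *)
Definition gaussian_space (X : T -> R) := L2 P X /\
  forall e : R, 0 < e -> \forall N \near \oo,
    exists lam, dist2 P X (wiener_combo (grid N) lam N) <= e.

Lemma gaussian_space_L2 X : gaussian_space X -> L2 P X.
Proof. by case. Qed.

Lemma gaussian_space_measurable X : gaussian_space X -> measurable_fun setT X.
Proof. by case => -[]. Qed.

(** Combinations of increments satisfy the formula with their own second moment, and both sides are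
    continuous for mean-square convergence. *)
Lemma gaussian_space_cos X (l th : R) : gaussian_space X ->
  \int[P]_x cos (l * X x + th) = cos th * expR (- (l ^+ 2 * ipsq P X / 2)).
Proof.
move=> [LX aX].
have /choice[Z ZP] : forall k : nat, exists Nl : nat * (nat -> R),
    dist2 P X (wiener_combo (grid Nl.1) Nl.2 Nl.1) <= k.+1%:R^-1.
  move=> k; have [|M _ HM] := aX k.+1%:R^-1; first by rewrite invr_gt0.
  by have [lam hl] := HM M (leqnn M); exists (M, lam).
pose X_ k := wiener_combo (grid (Z k).1) (Z k).2 (Z k).1.
have LX_ k : L2 P (X_ k) by exact: combo_L2.
have cX : dist2 P (X_ k) X @[k --> \oo] --> 0.
  apply: (@squeeze_cvgr _ _ _ _ (fun=> 0) (fun k => k.+1%:R^-1)).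
  - by apply: nearW => k; rewrite dist2_ge0 dist2C ZP.
  - exact: cvg_cst.
  - exact: cvg_harmonic.
have c1 := dist2_cos_cvg (l := l) (th := th) LX_ LX cX.
have E k : \int[P]_x cos (l * X_ k x + th) = cos th * expR (- (l ^+ 2 * ipsq P (X_ k) / 2)).
  have [|||_ ->] := @wiener_combo_L2 (grid (Z k).1) (Z k).2 (Z k).1.
  - by rewrite /grid mul0r.
  - by move=> i _; exact: grid_mono.
  - exact: gridN_le1.
  apply: wiener_combo_cos_scale.
  - by rewrite /grid mul0r.
  - by move=> i _; exact: grid_mono.
  - exact: gridN_le1.
have c2 : cos th * expR (- (l ^+ 2 * ipsq P (X_ k) / 2)) @[k --> \oo] -->
    cos th * expR (- (l ^+ 2 * ipsq P X / 2)).
  apply: cvgM; first exact: cvg_cst.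
  apply: cvg_comp; last exact: continuous_expR.
  apply: cvgN; apply: cvgM; last exact: cvg_cst.
  apply: cvgM; first exact: cvg_cst.
  exact: dist2_ipsq_cvg.
move: c2; under eq_fun do rewrite -E; move=> c2.
exact: (cvg_unique _ c1 c2).
Qed.

Lemma gaussian_space_fourth_moment X : gaussian_space X ->
  L2 P (fun x => X x ^+ 2) /\ ipsq P (fun x => X x ^+ 2) <= 8 * ipsq P X ^+ 2.
Proof.
move=> GX; apply: (gaussian_fourth_moment (gaussian_space_measurable GX)) => l.
have := gaussian_space_cos l 0 GX; rewrite cos0 mul1r => <-.
by apply: eq_Rintegral => x _; rewrite addr0.
Qed.

Lemma gaussian_space_closed X : L2 P X ->
  (forall e : R, 0 < e -> exists2 Y, gaussian_space Y & dist2 P X Y <= e) ->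
  gaussian_space X.
Proof.
move=> LX aX; split => // e e0.
have e4 : 0 < e / 4 by rewrite divr_gt0.
have [Y [LY aY] XY] := aX _ e4.
apply: filterS (aY _ e4) => N [lam h]; exists lam.
have := dist2_triangle LX LY (combo_L2 lam N); lra.
Qed.

Lemma gaussian_space_lin (a : R) X Y : gaussian_space X -> gaussian_space Y ->
  gaussian_space (fun x => a * X x + Y x).
Proof.
move=> [LX aX] [LY aY]; split; first by apply: L2D => //; exact: L2Z.
move=> e e0; pose e' := e / (4 * (a ^+ 2 + 1)).
have a1 : 0 < a ^+ 2 + 1 by have := sqr_ge0 a; lra.
have e'0 : 0 < e' by rewrite divr_gt0// mulr_gt0.
near=> N.
have [lam hl] : exists lam, dist2 P X (wiener_combo (grid N) lam N) <= e'.
  by near: N; exact: aX.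
have [kap hk] : exists lam, dist2 P Y (wiener_combo (grid N) lam N) <= e'.
  by near: N; exact: aY.
exists (fun i => a * lam i + kap i).
have LA := L2B LX (combo_L2 lam N); have LB := L2B LY (combo_L2 kap N).
have := ipsqD_le (L2Z a LA) LB; rewrite ipsqZ//.
rewrite [X in ipsq _ X <= _](_ : _ = (fun x => a * X x + Y x -
    wiener_combo (grid N) (fun i => a * lam i + kap i) N x)); last first.
  apply/funext => x; rewrite /wiener_combo.
  under [in RHS]eq_bigr do rewrite mulrDl -mulrA.
  by rewrite big_split/= -mulr_sumr; ring.
move=> h; apply: (le_trans h).
apply: (@le_trans _ _ (2 * (a ^+ 2 * e') + 2 * e')).
  by rewrite lerD// ler_wpM2l// ler_wpM2l// sqr_ge0.
by rewrite /e' [leLHS](_ : _ = e / 2); [lra|field; rewrite gt_eqF].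
Unshelve. all: by end_near. Qed.

Lemma gaussian_space_eq_ae X Y : {ae P, forall x, X x = Y x} ->
  gaussian_space X -> measurable_fun setT Y -> gaussian_space Y.
Proof.
move=> XY [LX aX] mY; split; first exact: L2_eq_ae XY LX mY.
move=> e e0; apply: filterS (aX e e0) => N [lam h]; exists lam.
apply: le_trans h; rewrite le_eqVlt; apply/orP; left; apply/eqP.
have mX : measurable_fun setT X by case: LX.
have mC := measurable_wiener_combo (grid N) lam N.
rewrite /dist2 /ipsq /ip /Rintegral; congr fine; apply: ae_eq_integral => //.
- apply/measurable_EFinP; apply: measurable_funM; exact: measurable_funB.
- apply/measurable_EFinP; apply: measurable_funM; exact: measurable_funB.
- by apply: filterS XY => x -> _.
Qed.

Lemma gaussian_space0 : gaussian_space (fun=> 0).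
Proof.
split; first exact: L2_cst.
move=> e e0; apply: nearW => N; exists (fun=> 0).
rewrite (_ : dist2 _ _ _ = 0) ?ltW// -[RHS](probability_Rintegral_cst P 0).
apply: eq_Rintegral => x _; rewrite /wiener_combo big1 ?subrr ?mulr0//.
by move=> i _; rewrite mul0r.
Qed.

Lemma gaussian_spaceZ (a : R) X : gaussian_space X -> gaussian_space (fun x => a * X x).
Proof.
move=> GX; have := gaussian_space_lin a GX gaussian_space0.
by congr gaussian_space; apply/funext => x; rewrite addr0.
Qed.

Lemma gaussian_spaceD X Y : gaussian_space X -> gaussian_space Y ->
  gaussian_space (fun x => X x + Y x).
Proof.
move=> GX GY; have := gaussian_space_lin 1 GX GY.
by congr gaussian_space; apply/funext => x; rewrite mul1r.
Qed.

Lemma gaussian_spaceB X Y : gaussian_space X -> gaussian_space Y ->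
  gaussian_space (fun x => X x - Y x).
Proof.
move=> GX GY; have := gaussian_space_lin (-1) GY GX.
by congr gaussian_space; apply/funext => x; rewrite mulN1r addrC.
Qed.

Lemma gaussian_space_sum (F : nat -> T -> R) m n : (forall i, gaussian_space (F i)) ->
  gaussian_space (fun x => \sum_(m <= i < n) F i x).
Proof.
move=> GF; elim: (index_iota m n) => [|i s ih].
  by under eq_fun do rewrite big_nil; exact: gaussian_space0.
by under eq_fun do rewrite big_cons; exact: gaussian_spaceD.
Qed.

(* In a Gaussian space almost sure convergence forces mean-square convergence,
   since E cos(X_n - X_m) = exp(- E(X_n - X_m)^2 / 2). *)
Lemma gaussian_space_ae_cvg (X_ : nat -> T -> R) (X : T -> R) :
  (forall n, gaussian_space (X_ n)) -> measurable_fun setT X ->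
  {ae P, forall x, X_ n x @[n --> \oo] --> X x} ->
  gaussian_space X /\ dist2 P (X_ n) X @[n --> \oo] --> 0.
Proof.
move=> GX_ mX cX.
have mX_ n := gaussian_space_measurable (GX_ n).
have LX_ n := gaussian_space_L2 (GX_ n).
pose phi n := \int[P]_x cos (X_ n x - X x).
have mcB (F G : T -> R) : measurable_fun setT F -> measurable_fun setT G ->
    measurable_fun setT (fun x => cos (F x - G x)).
  move=> mF mG; apply: measurable_cos_comp.
  exact: measurable_funB.
have phi1 : phi n @[n --> \oo] --> (1 : R).
  rewrite -(probability_Rintegral_cst P 1).
  apply: (@Rintegral_bounded_cvg _ _ _ _ _ _ 1) => //.
  - by move=> n; exact: mcB.
  - by move=> n x; exact: cos_max.
  - apply: filterS cX => x Xx; rewrite -cos0.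
    apply: (cvg_comp (fun n => X_ n x - X x)); last exact: continuous_cos.
    by rewrite -(subrr (X x)); apply: cvgB => //; exact: cvg_cst.
have E n m : \int[P]_x cos (X_ n x - X_ m x) = expR (- (dist2 P (X_ n) (X_ m) / 2)).
  have := gaussian_space_cos 1 0 (gaussian_spaceB (GX_ n) (GX_ m)).
  rewrite cos0 mul1r expr1n mul1r => <-.
  by apply: eq_Rintegral => x _; rewrite mul1r addr0.
have phi_lim n : \int[P]_x cos (X_ n x - X_ m x) @[m --> \oo] --> phi n.
  apply: (@Rintegral_bounded_cvg _ _ _ _ _ _ 1) => //.
  - by move=> m; exact: mcB.
  - exact: mcB.
  - by move=> m x; exact: cos_max.
  - apply: filterS cX => x Xx.
    apply: (cvg_comp (fun m => X_ n x - X_ m x)); last exact: continuous_cos.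
    by apply: cvgB => //; exact: cvg_cst.
(* When [phi n] is close to 1, the mean of cos (X_n - X_m) exceeds exp (- e / 2) for large m, that
   is [dist2] stays below e. Fatou's lemma in m then replaces X_m by X, whose square integrability
   is obtained at the same time. *)
have key (e : R) : 0 < e -> \forall n \near \oo, L2 P (fun x => X_ n x - X x) /\ dist2 P (X_ n) X <= e.
  move=> e0; have de : expR (- (e / 2)) < 1 by rewrite expR_lt1 oppr_lt0 divr_gt0.
  near=> n.
  have pn : expR (- (e / 2)) < phi n by near: n; exact: (cvgr_gt _ phi1).
  apply: (@ip_fatou_near _ _ _ P (fun m x => X_ n x - X_ m x)).
  - by move=> m; exact: L2B.
  - near=> m.
    have : expR (- (e / 2)) < \int[P]_x cos (X_ n x - X_ m x).
      by near: m; exact: (cvgr_gt _ (phi_lim n)).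
    by rewrite E ltr_expR ltrN2 ltr_pM2r ?invr_gt0// => /ltW.
  - exact: measurable_funB.
  - apply: filterS cX => x Xx; apply: cvgB => //; exact: cvg_cst.
have LX : L2 P X.
  have [N _ HN] := key 1 ltr01; have [LD _] := HN N (leqnn N).
  have := L2B (LX_ N) LD; congr (L2 P _).
  by apply/funext => x; ring.
have cD : dist2 P (X_ n) X @[n --> \oo] --> 0.
  apply/cvgrPdist_le => e e0; apply: filterS (key e e0) => n [_ h].
  by rewrite distrC subr0 ger0_norm// dist2_ge0.
split => //; apply: gaussian_space_closed => // e e0.
have [N _ HN] := key e e0; have [_ h] := HN N (leqnn N).
by exists (X_ N); rewrite // dist2C.
Unshelve. all: by end_near. Qed.

(** Orthogonality makes the second moment of every linear combination additive, so the joint Fourier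
    transform has the product form required by [cos_indep]. *)
Lemma gaussian_space_indep (X : nat -> T -> R) n :
  (forall i, gaussian_space (X i)) ->
  (forall i j, (i < j)%N -> (j < n)%N -> ip P (X i) (X j) = 0) ->
  forall B : nat -> set R, (forall i, measurable (B i)) ->
  \int[P]_x indic_prod X B 0 n x = \prod_(0 <= i < n) \int[P]_x \1_(B i) (X i x).
Proof.
move=> GX oX.
apply: (@cos_indep _ _ _ P X (fun i => ipsq P (X i))).
  by move=> i; exact: gaussian_space_measurable.
move=> lam th.
have GZ k : gaussian_space (fun x => \sum_(0 <= i < k) lam i * X i x).
  by apply: gaussian_space_sum => i; exact: gaussian_spaceZ.
have E k : (k <= n)%N -> ipsq P (fun x => \sum_(0 <= i < k) lam i * X i x) =
    \sum_(0 <= i < k) lam i ^+ 2 * ipsq P (X i).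
  elim: k => [_|k ih kn].
    rewrite big_geq// /ipsq /ip; under eq_Rintegral do rewrite big_geq// mulr0.
    exact: probability_Rintegral_cst.
  rewrite big_nat_recr//= -ih; last exact: ltnW.
  under [X in ipsq P X = _]eq_fun do rewrite big_nat_recr//=.
  have Lk := gaussian_space_L2 (GZ k).
  have Lk1 := L2Z (lam k) (gaussian_space_L2 (GX k)).
  rewrite ipsqD// ipsqZ; last exact: gaussian_space_L2.
  rewrite ipZr//; last exact: gaussian_space_L2.
  rewrite (_ : ip P (fun x => \sum_(0 <= i < k) lam i * X i x) (X k) = 0).
    by rewrite !mulr0 addr0.
  rewrite ip_suml; first last.
  - exact: gaussian_space_L2.
  - by move=> i; apply: L2Z; exact: gaussian_space_L2.
  rewrite big_nat_cond big1// => i /andP[/andP[_ ik] _].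
  by rewrite ipZl ?oX ?mulr0//; exact: gaussian_space_L2.
have := gaussian_space_cos 1 th (GZ n); rewrite E// expr1n mul1r mulr_suml => <-.
by apply: eq_Rintegral => x _; rewrite mul1r addrC.
Qed.

End wiener_combos.

(** * Wiener integrals *)

Section segment_analysis.
Context (R : realType).
Local Notation mu := (@lebesgue_measure R).
Implicit Types (f g e : R -> R) (A : set R).

Lemma within_continuousP f A : {within A, continuous f} <->
  forall x, A x -> forall e : R, 0 < e -> exists2 dl : R, 0 < dl &
    forall y, A y -> `|y - x| < dl -> `|f y - f x| < e.
Proof.
split=> [/subspace_continuousP cf x Ax e e0|H].
  have /cvgrPdist_lt/(_ e e0) := cf x Ax.
  rewrite near_withinE => /nbhs_ballP[dl /= dl0 H]; exists dl => // y Ay yx.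
  by rewrite distrC; apply: H => //; rewrite /ball/= distrC.
apply/subspace_continuousP => x Ax; apply/cvgrPdist_lt => e e0.
have [dl dl0 H'] := H x Ax e e0.
rewrite near_withinE; apply/nbhs_ballP; exists dl => //= y; rewrite /ball/= => xy Ay.
by rewrite distrC; apply: H' => //; rewrite distrC.
Qed.

(** Compactness in near-covering form, along the filter dl -> 0+: a modulus that works near each
    point works on the whole segment. *)
Lemma heine f (a b : R) : {within `[a, b], continuous f} ->
  forall e : R, 0 < e -> exists2 dl : R, 0 < dl & forall x y,
    a <= x <= b -> a <= y <= b -> `|y - x| <= dl -> `|f y - f x| <= e.
Proof.
move=> /within_continuousP cf e e0.
have /compact_near_coveringP/(_ R^o (0^'+)
  (fun dl x => forall y, a <= x <= b -> a <= y <= b -> `|y - x| <= dl -> `|f y - f x| <= e)) := @segment_compact R a b.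
move=> /(_ _) H.
have {}H : (\forall dl \near (0:R)^'+, `[a, b]%classic `<=` (fun x => forall y, a <= x <= b ->
    a <= y <= b -> `|y - x| <= dl -> `|f y - f x| <= e)).
  apply: H => x; rewrite /= => xab.
  have e2 : 0 < e / 2 by rewrite divr_gt0.
  have [dl dl0 H] := cf x xab _ e2.
  have dl2 : 0 < dl / 2 by rewrite divr_gt0.
  exists ([set x' | `|x' - x| < dl / 2], [set i | i < dl / 2]) => /=.
    split; first by apply/nbhs_ballP; exists (dl / 2) => //= y; rewrite /ball/= distrC.
    exact: nbhs_right_lt.
  move=> [x' i] /= [x'x id] y x'ab yab yx'.
  have h1 : `|f x' - f x| < e / 2 by apply: H; [rewrite /= in_itv|lra].
  have h2 : `|f y - f x| < e / 2.
    apply: H; first by rewrite /= in_itv.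
    have := ler_normD (y - x') (x' - x); rewrite addrA subrK; lra.
  have := ler_normB (f y - f x) (f x' - f x).
  rewrite (_ : f y - f x - (f x' - f x) = f y - f x'); last by ring.
  lra.
have [dl [dl0 Hd]] : exists dl : R, 0 < dl /\ forall x y, a <= x <= b ->
    a <= y <= b -> `|y - x| <= dl -> `|f y - f x| <= e.
  near (0:R)^'+ => dl; exists dl; split.
    by near: dl; exact: nbhs_right_gt.
  have : `[a, b]%classic `<=` (fun x => forall y, a <= x <= b ->
    a <= y <= b -> `|y - x| <= dl -> `|f y - f x| <= e) by near: dl; exact: H.
  by move=> Hd x y xab; apply: Hd => //=; rewrite in_itv.
by exists dl.
Unshelve. all: by end_near. Qed.

Lemma segment_bounded f (a b : R) : {within `[a, b], continuous f} ->
  exists2 M : R, 0 < M & forall x, a <= x <= b -> `|f x| <= M.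
Proof.
move=> cf.
have /compact_bounded[M [_ HM]] : compact (f @` `[a, b]).
  by apply: continuous_compact => //; exact: segment_compact.
exists (`|M| + 1) => [|x xab]; first by have := normr_ge0 M; lra.
apply: (HM (`|M| + 1)); first by have := ler_norm M; lra.
by exists x => //=; rewrite in_itv.
Qed.

Definition subdiv (s t : R) (n i : nat) : R := s + (t - s) * i%:R / n%:R.

Lemma subdiv0 s t n : subdiv s t n 0 = s.
Proof. by rewrite /subdiv mulr0 mul0r addr0. Qed.

Lemma subdivn s t n : (0 < n)%N -> subdiv s t n n = t.
Proof. by move=> n0; rewrite /subdiv -mulrA divff ?mulr1 ?subrKC// pnatr_eq0 -lt0n. Qed.

Lemma subdivS s t n i : subdiv s t n i.+1 - subdiv s t n i = (t - s) / n%:R.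
Proof. by rewrite /subdiv -natr1; ring. Qed.

Lemma subdiv_itv s t n i : s <= t -> (i <= n)%N -> s <= subdiv s t n i <= t.
Proof.
move=> st; case: n => [|n] ni.
  by rewrite /subdiv invr0 mulr0 addr0 lexx st.
rewrite /subdiv; apply/andP; split.
  by rewrite lerDl divr_ge0// mulr_ge0// subr_ge0.
rewrite -lerBrDl -mulrA ler_piMr ?subr_ge0// ler_pdivrMr// mul1r.
by rewrite ler_nat.
Qed.

Lemma subdiv_le s t n i : s <= t -> subdiv s t n i <= subdiv s t n i.+1.
Proof. by move=> st; rewrite -subr_ge0 subdivS divr_ge0// subr_ge0. Qed.

(** The hypothesis says that dPsi = e dPhi to first order, uniformly; the errors eps (y - x) add up
    to eps (t - s) along a subdivision. The lemma serves for covariances of Wiener integrals, for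
    Riemann sums of paths and, with e = 1 and Phi the identity, for finding a function from its
    derivative. *)
Lemma riemann_stieltjes_cvg (e Phi Psi : R -> R) (s t : R) : s <= t ->
  (forall eps : R, 0 < eps -> exists2 dl : R, 0 < dl & forall x y,
    s <= x -> x <= y -> y <= t -> y - x <= dl ->
    `|Psi y - Psi x - e x * (Phi y - Phi x)| <= eps * (y - x)) ->
  \sum_(0 <= i < n) e (subdiv s t n i) *
    (Phi (subdiv s t n i.+1) - Phi (subdiv s t n i)) @[n --> \oo] --> Psi t - Psi s.
Proof.
move=> st H; apply/cvgrPdist_le => eps0 eps00.
have ts1 : 0 < t - s + 1 by lra.
have [|dl dl0 Hd] := H (eps0 / (t - s + 1)); first by rewrite divr_gt0.
near=> n.
have n0 : (0 < n)%N by near: n; exact: nbhs_infty_gt.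
have nr0 : 0 < n%:R :> R by rewrite ltr0n.
have -> : Psi t - Psi s = \sum_(0 <= i < n) (Psi (subdiv s t n i.+1) - Psi (subdiv s t n i)).
  by rewrite telescope_sumr// subdiv0 subdivn.
rewrite -sumrB (le_trans (ler_norm_sum _ _ _))//.
apply: (@le_trans _ _ (\sum_(0 <= i < n) eps0 / (t - s + 1) * ((t - s) / n%:R))).
  rewrite !big_mkord; apply: ler_sum => i _; rewrite -(subdivS s t n i).
  have /andP[h1 _] := subdiv_itv st (ltnW (ltn_ord i)).
  have /andP[_ h2] := subdiv_itv st (ltn_ord i).
  apply: Hd => //; first exact: subdiv_le.
  rewrite subdivS ler_pdivrMr// mulrC -ler_pdivrMr//.
  by near: n; exact: nbhs_infty_ger.
rewrite sumr_const_nat subn0 -mulr_natl.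
rewrite [leLHS](_ : _ = eps0 * ((t - s) / (t - s + 1))); last by field; rewrite ?gt_eqF.
apply: ler_piMr; first exact: ltW.
by rewrite ler_pdivrMr// mul1r; lra.
Unshelve. all: by end_near. Qed.

End segment_analysis.

Section int0.
Context (R : realType).
Local Notation mu := (@lebesgue_measure R).
Implicit Types (f g e : R -> R).

Definition cont_upto (t : R) f := {within `[0, t], continuous f}.

Lemma cont_upto_integrable f (t : R) : cont_upto t f ->
  mu.-integrable `[0, t] (EFin \o f).
Proof.
by move=> cf; apply: continuous_compact_integrable => //; exact: segment_compact.
Qed.

Lemma cont_uptoW f (s t : R) : s <= t -> cont_upto t f -> cont_upto s f.
Proof.
move=> st; apply: continuous_subspaceW => x /=; rewrite !in_itv/= => /andP[-> h].
exact: le_trans h st.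
Qed.

Lemma cont_uptoM f g (t : R) : cont_upto t f -> cont_upto t g ->
  cont_upto t (fun x => f x * g x).
Proof. by move=> cf cg x; apply: cvgM; [exact: cf|exact: cg]. Qed.

Lemma cont_uptoD f g (t : R) : cont_upto t f -> cont_upto t g ->
  cont_upto t (fun x => f x + g x).
Proof. by move=> cf cg x; apply: cvgD; [exact: cf|exact: cg]. Qed.

Lemma cont_upto_cst (c t : R) : cont_upto t (fun=> c).
Proof. by move=> x; exact: cvg_cst. Qed.

Lemma cont_uptoZ (c : R) f (t : R) : cont_upto t f -> cont_upto t (fun x => c * f x).
Proof. by move=> cf; apply: cont_uptoM => //; exact: cont_upto_cst. Qed.

Lemma int0D f g (t : R) : cont_upto t f -> cont_upto t g ->
  int0 (fun x => f x + g x) t = int0 f t + int0 g t.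
Proof. by move=> cf cg; rewrite /int0 RintegralD//; exact: cont_upto_integrable. Qed.

Lemma int0Z (c : R) f (t : R) : cont_upto t f ->
  int0 (fun x => c * f x) t = c * int0 f t.
Proof. by move=> cf; rewrite /int0 RintegralZl//; exact: cont_upto_integrable. Qed.

Lemma int00 f : int0 f 0 = 0.
Proof. by rewrite /int0 set_itv1 Rintegral_set1. Qed.

Lemma int0_cst (c t : R) : 0 <= t -> int0 (fun=> c) t = c * t.
Proof.
move=> t0; rewrite /int0 Rintegral_cst//; congr (_ * _).
by rewrite /= lebesgue_measure_itv/= lte_fin; case: ltrP => [_|h]; rewrite /= ?sube0 ?subr0//; lra.
Qed.

Lemma int0B_itv f (x y : R) : 0 <= x -> x <= y -> cont_upto y f ->
  int0 f y - int0 f x = \int[mu]_(u in `]x, y]) f u.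
Proof.
move=> x0 xy cf; rewrite /int0 Rintegral_itvB ?bnd_simp//.
exact: cont_upto_integrable.
Qed.

Lemma int0_increment_le f (c M x y : R) : 0 <= x -> x <= y -> cont_upto y f ->
  (forall u, x < u <= y -> `|f u - c| <= M) ->
  `|int0 f y - int0 f x - c * (y - x)| <= M * (y - x).
Proof.
move=> x0 xy cf fM.
have L : fine (mu `]x, y]) = y - x.
  rewrite lebesgue_measure_itv/= lte_fin; case: ltrP => [_//|h] /=; lra.
have i1 : mu.-integrable `]x, y] (EFin \o f).
  apply: integrableS (cont_upto_integrable cf) => // u /=.
  by rewrite !in_itv/= => /andP[xu ->]; rewrite andbT ltW// (le_lt_trans x0).
have i2 (k : R) : mu.-integrable `]x, y] (EFin \o (fun=> k)).
  apply: measurable_bounded_integrable => //.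
    by rewrite /= lebesgue_measure_itv/=; case: ifPn => // _; rewrite -EFinB ltry.
  exists `|k|; split; first exact: num_real.
  by move=> N kN u _ /=; exact: ltW.
rewrite int0B_itv// -{1}L -Rintegral_cst// -RintegralB//.
rewrite (le_trans (le_normr_Rintegral _ _))//.
  by apply: eq_integrable (integrableB _ i1 (i2 c)).
rewrite -L -Rintegral_cst//; apply: le_Rintegral => //.
  by apply: integrable_norm; apply: eq_integrable (integrableB _ i1 (i2 c)).
Qed.

Lemma int0_lipschitz f (t : R) : cont_upto t f -> exists2 M : R, 0 < M &
  forall x y, 0 <= x -> x <= y -> y <= t -> `|int0 f y - int0 f x| <= M * (y - x).
Proof.
move=> cf; have [M M0 fM] := segment_bounded cf.
exists M => // x y x0 xy yt.
have := @int0_increment_le f 0 M x y x0 xy (cont_uptoW yt cf).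
rewrite mul0r subr0; apply => u /andP[xu uy]; rewrite subr0; apply: fM.
by rewrite (le_trans uy yt) andbT ltW// (le_lt_trans x0).
Qed.

Lemma cont_upto_int0 f (t : R) : cont_upto t f -> cont_upto t (int0 f).
Proof.
move=> cf; have [M M0 fM] := int0_lipschitz cf.
apply/within_continuousP => x; rewrite /= in_itv/= => /andP[x0 xt] e e0.
exists (e / M) => [|y]; first by rewrite divr_gt0.
rewrite in_itv/= => /andP[y0 yt] xy.
have [h|h] := leP x y.
  apply: (le_lt_trans (fM _ _ x0 h yt)).
  by rewrite mulrC -ltr_pdivlMr// (le_lt_trans (ler_norm _) xy).
rewrite distrC; apply: (le_lt_trans (fM _ _ y0 (ltW h) xt)).
by rewrite mulrC -ltr_pdivlMr// (le_lt_trans (ler_norm _))// distrC.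
Qed.

(** On a short [x, y] the function e stays within eps / M of e x, where M bounds f. The cut at r
    reproduces covariances: integrals of W up to r and up to y share only the noise up to min r
    y. *)
Lemma int0_first_order e f (r t : R) : 0 <= r -> cont_upto t e -> cont_upto t f ->
  forall eps : R, 0 < eps -> exists2 dl : R, 0 < dl & forall x y,
    0 <= x -> x <= y -> y <= t -> y - x <= dl ->
    `|int0 (fun q => e q * f q) (Num.min r y) - int0 (fun q => e q * f q) (Num.min r x)
      - e x * (int0 f (Num.min r y) - int0 f (Num.min r x))| <= eps * (y - x).
Proof.
move=> r0 ce cf eps eps0; have [M M0 fM] := segment_bounded cf.
have [|dl dl0 H] := heine ce (e := eps / M); first by rewrite divr_gt0.
exists dl => // x y x0 xy yt xyd.
have [rx|xr] := leP r x.
  rewrite !min_l ?(le_trans rx xy)// !subrr mulr0 subrr normr0.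
  by rewrite mulr_ge0 ?subr_ge0// ltW.
set y' := Num.min r y.
have xy' : x <= y' by rewrite le_min xy ltW.
have y'y : y' <= y by rewrite ge_min lexx orbT.
have y't : y' <= t := le_trans y'y yt.
have cey := cont_uptoW y't ce; have cfy := cont_uptoW y't cf.
have cef := cont_uptoM cey cfy.
have cD : cont_upto y' (fun q => e q * f q + - e x * f q).
  by apply: cont_uptoD => //; exact: cont_uptoZ.
have -> : int0 (fun q => e q * f q) y' - int0 (fun q => e q * f q) x
      - e x * (int0 f y' - int0 f x) =
    int0 (fun q => e q * f q + - e x * f q) y' - int0 (fun q => e q * f q + - e x * f q) x - 0 * (y' - x).
  have cfx := cont_uptoW xy' cfy; have cefx := cont_uptoW xy' cef.
  have cfyZ := cont_uptoZ (c := - e x) cfy; have cfxZ := cont_uptoZ (c := - e x) cfx.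
  rewrite !int0D// !int0Z//.
  ring.
apply: (@le_trans _ _ (eps * (y' - x))); last by apply: ler_wpM2l; [exact: ltW|rewrite lerD2r].
apply: int0_increment_le => // u /andP[xu uy'].
rewrite subr0 -mulrDl normrM -[leRHS](divfK (lt0r_neq0 M0)).
have ut : u <= t := le_trans uy' y't.
have u0 : 0 <= u by rewrite ltW// (le_lt_trans x0).
apply: ler_pM => //; last by apply: fM; rewrite u0 ut.
have xu' := ltW xu.
apply: H; [by rewrite x0 (le_trans xy)|by rewrite u0 ut|].
by rewrite ger0_norm ?subr_ge0//; lra.
Qed.

End int0.

(** Tail of a geometric series. The index K is there because pathwise bounds from Borel-Cantelli
    start at an index depending on the path. *)
Lemma geometric_increments_cvg (R : realType) (u : nat -> R) (rho : R) (K : nat) :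
  0 <= rho < 1 -> (forall k, (K <= k)%N -> `|u k.+1 - u k| <= rho ^+ k) ->
  exists2 l : R, u k @[k --> \oo] --> l &
    forall k, (K <= k)%N -> `|u k - l| <= rho ^+ k / (1 - rho).
Proof.
move=> /andP[r0 r1] H.
have r1' : 0 < 1 - rho by rewrite subr_gt0.
have B j k : (K <= k)%N -> `|u (k + j)%N - u k| <= rho ^+ k * (1 - rho ^+ j) / (1 - rho).
  move=> Kk; elim: j => [|j ih].
    by rewrite addn0 subrr normr0 expr0 subrr mulr0 mul0r.
  rewrite addnS -(subrK (u (k + j)%N) (u (k + j).+1)) -addrA.
  rewrite (le_trans (ler_normD _ _))//.
  have h1 := H (k + j)%N (leq_trans Kk (leq_addr _ _)).
  apply: (@le_trans _ _ (rho ^+ (k + j) + rho ^+ k * (1 - rho ^+ j) / (1 - rho))).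
    by rewrite lerD.
  rewrite le_eqVlt; apply/orP; left; apply/eqP.
  by rewrite exprD exprS; field; rewrite gt_eqF.
have B' j k : (K <= k)%N -> `|u (k + j)%N - u k| <= rho ^+ k / (1 - rho).
  move=> Kk; apply: (le_trans (B j k Kk)).
  rewrite ler_pM2r ?invr_gt0// ler_piMr ?exprn_ge0//.
  by rewrite gerBl exprn_ge0.
have cg : (rho ^+ k / (1 - rho)) @[k --> \oo] --> (0 : R).
  rewrite -(mul0r (1 - rho)^-1); apply: cvgM; last exact: cvg_cst.
  by apply: cvg_expr; rewrite ger0_norm.
have cu : cvgn u.
  apply/cauchy_cvgP/cauchy_exP => e e0.
  have : \forall k \near \oo, rho ^+ k / (1 - rho) < e by exact: (cvgr_lt _ cg).
  move=> [N _ HN]; pose M := maxn N K.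
  exists (u M); exists M => // n /= Mn.
  rewrite /ball/= distrC -(subnKC Mn); apply: le_lt_trans (B' _ _ _) _.
    exact: leq_maxr.
  by apply: HN; exact: leq_maxl.
exists (limn u) => // k Kk.
have cd : `|u (j + k)%N - u k| @[j --> \oo] --> `|limn u - u k|.
  apply: cvg_norm; apply: cvgB; last exact: cvg_cst.
  by rewrite (cvg_shiftn k u).
rewrite distrC -(cvg_lim _ cd)//; apply: limr_le; first by apply/cvg_ex; eexists; exact: cd.
by apply: nearW => j; rewrite addnC; exact: B'.
Qed.

Section L2_completeness.
Context d (T : measurableType d) (R : realType) (P : probability T R).

Lemma measurable_norm_ge (F : T -> R) (e : R) : measurable_fun setT F ->
  measurable [set x | e <= `|F x|].
Proof.
move=> mF; rewrite -[X in measurable X]setTI.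
apply: (@measurable_fun_le _ _ _ setT (cst e) (fun x => `|F x|)) => //.
exact: measurableT_comp.
Qed.

(** Riesz-Fischer: a rapidly converging subsequence converges almost surely, and Fatou's lemma
    bounds the distance of the whole sequence to its limit. *)
Lemma L2_complete (X_ : nat -> T -> R) : (forall n, L2 P (X_ n)) ->
  (forall e : R, 0 < e -> exists N, forall p q, (N <= p)%N -> (N <= q)%N ->
    dist2 P (X_ p) (X_ q) <= e) ->
  exists X, L2 P X /\ dist2 P (X_ n) X @[n --> \oo] --> 0.
Proof.
move=> LX H.
have mX n : measurable_fun setT (X_ n) by case: (LX n).
(* Chebyshev's inequality at level 2^-k divides 8^-k by 4^-k: both the probabilities and the
   increments are then of order 2^-k and summable. *)
have /choice[N NP] : forall k : nat, exists N, forall p q, (N <= p)%N -> (N <= q)%N ->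
    dist2 P (X_ p) (X_ q) <= 8^-1 ^+ k by move=> k; apply: H; rewrite exprn_gt0.
(* Partial sums of the N j, so that the subsequence is nondecreasing. *)
pose n_ k := (\sum_(0 <= j < k.+1) N j)%N.
have nN k : (N k <= n_ k)%N by rewrite /n_ big_nat_recr//= leq_addl.
have nS k : (n_ k <= n_ k.+1)%N by rewrite /n_ [leqRHS]big_nat_recr//= leq_addr.
have nle k j : (k <= j)%N -> (n_ k <= n_ j)%N.
  elim: j => [|j ih]; first by rewrite leqn0 => /eqP ->.
  by rewrite leq_eqVlt => /predU1P[->//|kj]; exact: leq_trans (ih kj) (nS j).
pose D k := [set x | 2^-1 ^+ k <= `|X_ (n_ k.+1) x - X_ (n_ k) x|].
have mD k : measurable (D k).
  by apply: measurable_norm_ge; exact: measurable_funB.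
have PD k : (P (D k) <= (1 * 2^-1 ^+ k)%:E)%E.
  apply: le_trans (ip_chebyshev (L2B (LX _) (LX _)) _) _; first by rewrite exprn_gt0.
  rewrite lee_fin mul1r ler_pdivrMr ?exprn_gt0//.
  rewrite (_ : 2^-1 ^+ k * _ = 8^-1 ^+ k).
    by apply: NP; [exact: leq_trans (nN k) (nS k)|exact: nN].
  by rewrite exprAC -exprMn; congr (_ ^+ k); field.
have [||A [mA PA0 HA]] := @borel_cantelli_ae _ _ _ P D 2^-1 1 _ _ mD PD.
- by rewrite invr_ge0 ler0n /= invf_lt1// ltr1n.
- exact: ler01.
have [|X mX' XA] := @ae_cvg_limit _ _ _ (fun k => X_ (n_ k)) A (fun k => mX (n_ k)) mA.
  move=> x Ax; have [K _ HK] := HA x Ax.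
  have [||l cl _] := @geometric_increments_cvg R (fun k => X_ (n_ k) x) 2^-1 K.
  - by rewrite invr_ge0 ler0n /= invf_lt1// ltr1n.
  - by move=> k Kk; have /negP := HK k Kk; rewrite -ltNge => /ltW.
  by apply/cvg_ex; exists l.
have aeX : {ae P, forall x, X_ (n_ k) x @[k --> \oo] --> X x}.
  exists (~` A); split => //; first exact: measurableC.
  by move=> x /= nx Ax; apply: nx; exact: XA.
have key k p : (N k <= p)%N -> L2 P (fun x => X_ p x - X x) /\ dist2 P (X_ p) X <= 8^-1 ^+ k.
  move=> Np; apply: (@ip_fatou_near _ _ _ P (fun j x => X_ p x - X_ (n_ j) x)).
  - by move=> j; exact: L2B.
  - by exists k => // j /= kj; apply: NP => //; exact: leq_trans (nN k) (nle _ _ kj).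
  - exact: measurable_funB.
  - by apply: filterS aeX => x Xx; apply: cvgB => //; exact: cvg_cst.
have LX' : L2 P X.
  have [LD _] := key 0%N (N 0%N) (leqnn _).
  have := L2B (LX (N 0%N)) LD; congr (L2 P _).
  by apply/funext => x; ring.
exists X; split => //.
apply/cvgrPdist_le => e e0.
have c8 : (8^-1 : R) ^+ k @[k --> \oo] --> (0 : R).
  by apply: cvg_expr; rewrite ger0_norm ?invr_ge0// invf_lt1// ltr1n.
have [k _ Hk] : \forall k \near \oo, (8^-1 : R) ^+ k < e by exact: (cvgr_lt _ c8).
exists (N k) => // p /= Np; have [_ h] := key k p Np.
by rewrite sub0r normrN ger0_norm ?dist2_ge0// (le_trans h)// ltW// Hk//=.
Qed.

End L2_completeness.

(** * Covariance and Riemann sums of the Wiener process *)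

Section wiener_covariance.
Context d (T : measurableType d) (R : realType) (P : probability T R).
Variable W : R -> {RV P >-> R}.
Hypothesis hW : standard_wiener W.

Lemma wiener_incr_L2 (s t : R) : 0 <= s -> s <= t -> t <= 1 ->
  L2 P (fun x => W t x - W s x) /\ dist2 P (W t) (W s) = t - s.
Proof.
move=> s0 st t1.
have mI : measurable_fun setT (fun x => W t x - W s x).
  by apply: measurable_funB; exact: mRV.
have H (l : R) : \int[P]_x cos (l * (W t x - W s x)) = expR (- (l ^+ 2 * (t - s) / 2)).
  have := wiener_incr_cos hW l 0 s0 st t1; rewrite cos0 mul1r => <-.
  by apply: eq_Rintegral => x _; rewrite addr0.
split; first by have [] := gaussian_L2 mI H.
exact: (gaussian_variance mI H).
Qed.

Lemma wiener0_ae : {ae P, forall x, W 0 x = 0}.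
Proof. by case: hW. Qed.

(** On the grid with N steps, W at the last node before t is a telescoping combination of increments
    up to W 0, and its squared distance to W t is at most 1 / N. *)
Lemma gaussian_space_wiener (t : R) : 0 <= t <= 1 -> gaussian_space W (W t).
Proof.
move=> /andP[t0 t1].
suff : gaussian_space W (fun x => W t x - W 0 x).
  move/gaussian_space_eq_ae; apply; last exact: mRV.
  by apply: filterS wiener0_ae => x ->; rewrite subr0.
split; first by have [] := wiener_incr_L2 (lexx 0) t0 t1.
move=> e e0; near=> N.
have N0 : (0 < N)%N by near: N; exact: nbhs_infty_gt.
have Nr0 : 0 < N%:R :> R by rewrite ltr0n.
pose k := Num.truncn (t * N%:R).
have tN0 : 0 <= t * N%:R by rewrite mulr_ge0// ltW.
have /andP[k1 k2] := truncn_itv tN0; rewrite -/k in k1 k2.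
have kN : (k <= N)%N.
  by rewrite -(ler_nat R) (le_trans k1)// ler_piMl// ltW.
exists (fun j => (j < k)%N%:R).
have E x : wiener_combo W (grid R N) (fun j => (j < k)%N%:R) N x = W (k%:R / N%:R) x - W 0 x.
  rewrite /wiener_combo (eq_bigr (fun j => if (j < k)%N then W (grid R N j.+1) x - W (grid R N j) x else 0)).
    rewrite -big_mkcond/= -(big_nat_widen 0 k N xpredT)//.
    by rewrite telescope_sumr// /grid mul0r.
  by move=> j _; case: ifP; rewrite ?mul1r ?mul0r.
have k0 : 0 <= k%:R / N%:R :> R by rewrite divr_ge0.
have kt : k%:R / N%:R <= t by rewrite ler_pdivrMr.
have -> : dist2 P (fun x => W t x - W 0 x) (wiener_combo W (grid R N) (fun j => (j < k)%N%:R) N)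
    = t - k%:R / N%:R.
  have [_ <-] := wiener_incr_L2 k0 kt t1.
  by apply: eq_Rintegral => x _; rewrite E; ring.
apply: (@le_trans _ _ N%:R^-1).
  rewrite lerBlDr; apply: (@le_trans _ _ ((k%:R + 1) / N%:R)).
    by rewrite ler_pdivlMr// natr1 ltW.
  by rewrite mulrDl mul1r addrC.
rewrite -[leRHS]invrK lef_pV2 ?posrE ?invr_gt0//.
by near: N; exact: nbhs_infty_ger.
Unshelve. all: by end_near. Qed.

Lemma wiener_L2 (t : R) : 0 <= t <= 1 -> L2 P (W t).
Proof. by move=> t01; exact: gaussian_space_L2 (gaussian_space_wiener t01). Qed.

Lemma wiener_ipsq (t : R) : 0 <= t <= 1 -> ipsq P (W t) = t.
Proof.
move=> t01; have /andP[t0 t1] := t01.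
have [_ E] := wiener_incr_L2 (lexx 0) t0 t1.
rewrite -[RHS]subr0 -E /dist2 /ipsq /ip /Rintegral; congr fine.
apply: ae_eq_integral => //.
- apply/measurable_EFinP; apply: measurable_funM; exact: mRV.
- by apply/measurable_EFinP; apply: measurable_funM; apply: measurable_funB; exact: mRV.
- by apply: filterS wiener0_ae => x -> _; rewrite subr0.
Qed.

Lemma wiener_ip (s t : R) : 0 <= s <= 1 -> 0 <= t <= 1 ->
  ip P (W s) (W t) = Num.min s t.
Proof.
wlog st : s t / s <= t => [H|] s01 t01.
  have [st|/ltW ts] := leP s t; first by rewrite H// min_l.
  by rewrite ipC H// min_l// min_r.
have /andP[s0 s1] := s01; have /andP[t0 t1] := t01.
have [_ ] := wiener_incr_L2 s0 st t1.
rewrite /dist2 ipsqB ?wiener_ipsq//; [|exact: wiener_L2|exact: wiener_L2].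
by rewrite ipC min_l//; lra.
Qed.

Lemma riemann_sumE (f : R -> R) (r : R) n x : riemann_sum W f r n x =
  wiener_combo W (subdiv 0 r n) (fun i => f (subdiv 0 r n i)) n x.
Proof.
rewrite /riemann_sum /wiener_combo big_mkord; apply: eq_bigr => i _.
by rewrite /subdiv !add0r subr0.
Qed.

Lemma gaussian_space_riemann_sum (f : R -> R) (r : R) n : 0 <= r <= 1 ->
  gaussian_space W (riemann_sum W f r n).
Proof.
move=> /andP[r0 r1].
have GW (i : nat) : (i <= n)%N -> gaussian_space W (W (subdiv 0 r n i)).
  move=> ni; apply: gaussian_space_wiener.
  by have /andP[-> h] := subdiv_itv r0 ni; rewrite (le_trans h).
suff H k : (k <= n)%N -> gaussian_space W
    (wiener_combo W (subdiv 0 r n) (fun i => f (subdiv 0 r n i)) k).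
  by have := H n (leqnn n); congr gaussian_space; apply/funext => x; rewrite riemann_sumE.
elim: k => [_|k ih kn].
  have := gaussian_space0 W; congr gaussian_space.
  by apply/funext => x; rewrite /wiener_combo big_geq.
have := gaussian_space_lin hW (f (subdiv 0 r n k))
  (gaussian_spaceB hW (GW k.+1 kn) (GW k (ltnW kn))) (ih (ltnW kn)).
congr gaussian_space; apply/funext => x.
by rewrite /wiener_combo [in RHS]big_nat_recr//= addrC.
Qed.

Lemma riemann_sum_L2 (f : R -> R) (r : R) n : 0 <= r <= 1 ->
  L2 P (riemann_sum W f r n).
Proof. by move=> r01; exact: gaussian_space_L2 (gaussian_space_riemann_sum f n r01). Qed.

(* Both sums are combinations of the increments over the grid with n m steps. *)
Lemma riemann_sum_refine (f : R -> R) (r : R) (n m : nat) (e : R) :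
  0 <= r <= 1 -> (0 < n)%N -> (0 < m)%N -> 0 <= e ->
  (forall x y, 0 <= x <= r -> 0 <= y <= r -> `|y - x| <= r / n%:R -> `|f y - f x| <= e) ->
  dist2 P (riemann_sum W f r n) (riemann_sum W f r (n * m)) <= e ^+ 2 * r.
Proof.
move=> /andP[r0 r1] n0 m0 e0 fe.
have nr0 : n%:R != 0 :> R by rewrite pnatr_eq0 -lt0n.
have mr0 : m%:R != 0 :> R by rewrite pnatr_eq0 -lt0n.
pose t := subdiv 0 r (n * m).
have tE i : t (i * m)%N = subdiv 0 r n i.
  by rewrite /t /subdiv !natrM; field; rewrite nr0.
have block (F : nat -> R) k : \sum_(0 <= i < k * m) F i =
    \sum_(0 <= i < k) \sum_(0 <= j < m) F (i * m + j)%N.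
  elim: k => [|k ih]; first by rewrite mul0n !big_geq.
  rewrite big_nat_recr//= -ih mulSn addnC (@big_cat_nat _ _ _ (k * m))//=; last exact: leq_addr.
  congr (_ + _); rewrite -{1}[(k * m)%N]add0n big_addn addnC addnK.
  by apply: eq_bigr => j _; rewrite addnC.
(* The coarse sum written on the fine grid: on fine cell k the integrand is taken at the coarse node
   below it, of fine index [k %/ m * m]. *)
have E1 x : riemann_sum W f r n x =
    \sum_(0 <= k < n * m) f (t (k %/ m * m)%N) * (W (t k.+1) x - W (t k) x).
  rewrite block riemann_sumE /wiener_combo; apply: eq_big_nat => i /andP[_ ni].
  rewrite -!tE mulSn (addnC m).
  rewrite (eq_big_nat _ _ (F2 := fun j => f (t (i * m)%N) * (W (t (i * m + j).+1) x - W (t (i * m + j)%N) x))).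
    rewrite -mulr_sumr; congr (_ * _).
    under eq_bigr do rewrite -addnS.
    by rewrite (telescope_sumr (fun j => W (t (i * m + j)%N) x))// addn0.
  by move=> j /andP[_ jm]; rewrite divnMDl// divn_small// addn0.
have E2 x : riemann_sum W f r n x - riemann_sum W f r (n * m) x =
    wiener_combo W t (fun k => f (t (k %/ m * m)%N) - f (t k)) (n * m) x.
  rewrite E1 riemann_sumE /wiener_combo -sumrB.
  by apply: eq_bigr => k _; rewrite mulrBl.
rewrite /dist2; under [X in ipsq _ X]eq_fun do rewrite E2.
have nm0 : (0 < n * m)%N by rewrite muln_gt0 n0.
have [|||_ ->] := @wiener_combo_L2 _ _ _ _ W hW t (fun k => f (t (k %/ m * m)%N) - f (t k)) (n * m).
- by rewrite /t subdiv0.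
- by move=> i _; exact: subdiv_le.
- by rewrite /t subdivn.
apply: (@le_trans _ _ (\sum_(0 <= k < n * m) e ^+ 2 * (t k.+1 - t k))); last first.
  by rewrite -mulr_sumr telescope_sumr// /t subdiv0 subdivn// subr0.
rewrite !big_mkord; apply: ler_sum => k _; rewrite ler_wpM2r//.
  by rewrite subr_ge0 subdiv_le.
rewrite -(real_normK (num_real (f _ - f _))) lerXn2r ?nnegrE//.
have kd : (k %/ m * m <= k)%N by exact: leq_divM.
apply: fe; [exact/subdiv_itv/ltnW|apply: subdiv_itv => //; exact: leq_trans kd (ltnW (ltn_ord k))|].
rewrite /t /subdiv opprD addrACA subrr add0r subr0 -mulrBl -mulrBr.
rewrite !normrM (ger0_norm r0) normfV (ger0_norm (ler0n _ _)) distrC -natrB//.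
rewrite (ger0_norm (ler0n _ _)) -mulrA ler_wpM2l// natrM invfM mulrCA.
rewrite ler_piMr ?invr_ge0// ler_pdivrMr ?ltr0n// mul1r ler_nat.
by rewrite {1}(divn_eq k m) addKn ltnW// ltn_pmod.
Qed.

Lemma EFin_dist2 (X Y : T -> R) : L2 P X -> L2 P Y ->
  ('E_P[(fun x => (X x - Y x) ^+ 2)%R] = (dist2 P X Y)%:E)%E.
Proof.
move=> LX LY; rewrite unlock /dist2 /ipsq -EFin_ip//; exact: L2B.
Qed.

(** The expectation in the definition is an extended real. Convergence to 0 makes it finite for some
    n, and X is then square integrable as the sum of a Riemann sum and the difference. *)
Lemma is_wiener_integral_dist2 (f : R -> R) (r : R) (X : {RV P >-> R}) : 0 <= r <= 1 ->
  is_wiener_integral W f r X <->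
  L2 P X /\ dist2 P (riemann_sum W f r n) X @[n --> \oo] --> 0.
Proof.
move=> r01; split=> [H|[LX cX]]; last first.
  rewrite /is_wiener_integral.
  under eq_fun do rewrite (EFin_dist2 LX (riemann_sum_L2 _ _ r01)) dist2C.
  by apply: cvg_EFin; [exact: nearW|exact: cX].
have LS n := riemann_sum_L2 f n r01.
have /fine_cvgP[[N _ HN] _] := H.
have LX : L2 P X.
  suff LD : L2 P (fun x => X x - riemann_sum W f r N x).
    have := L2D LD (LS N); congr (L2 P _); apply/funext => x; exact: subrK.
  split; first by apply: measurable_funB; [exact: mRV|case: (LS N)].
  apply/integrableP; split.
    apply/measurable_EFinP/measurable_funX/measurable_funB; first exact: mRV.
    by case: (LS N).
  have := HN N (leqnn N); rewrite unlock fin_numElt => /andP[_].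
  by under [X in _ -> (X < _)%E]eq_integral do rewrite gee0_abs ?lee_fin ?sqr_ge0//.
split => //; move: H; rewrite /is_wiener_integral.
under eq_fun do rewrite (EFin_dist2 LX (LS _)) dist2C.
by move/fine_cvgP => [].
Qed.

End wiener_covariance.

Lemma RV_of_measurable d (T : measurableType d) (R : realType) (P : probability T R)
  (f : T -> R) : measurable_fun setT f -> exists X : {RV P >-> R}, X = f :> (T -> R).
Proof. by move=> mf; exists (mfun_Sub (mem_set mf)); exact: mfun_valP. Qed.

Section wiener_integrals.
Context d (T : measurableType d) (R : realType) (P : probability T R).
Variable W : R -> {RV P >-> R}.
Hypothesis hW : standard_wiener W.
Implicit Types (e f g : R -> R).

Local Notation I := (wiener_integral W).

(** The Riemann sums with p and q cells are both compared with the one with p q cells, which makes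
    the sequence Cauchy. Existence of a limit is what guarantees that [xget] returns a Wiener
    integral. *)
Lemma wiener_integral_spec f (r : R) : cont_upto 1 f -> 0 <= r <= 1 ->
  gaussian_space W (I f r) /\ dist2 P (riemann_sum W f r n) (I f r) @[n --> \oo] --> 0.
Proof.
move=> cf r01; have /andP[r0 r1] := r01.
have LS n := riemann_sum_L2 hW f n r01.
have GS n := gaussian_space_riemann_sum hW f n r01.
have [|X [LX cX]] := L2_complete LS.
  move=> e e0.
  have e4 : 0 < e / 4 by rewrite divr_gt0.
  (* The cap at 1 gives e'^2 <= e' <= e / 4 without a square root. *)
  pose e' := Num.min 1 (e / 4).
  have e'0 : 0 < e' by rewrite lt_min ltr01 e4.
  have e'1 : e' <= 1 by rewrite ge_min lexx.
  have e'4 : e' <= e / 4 by rewrite ge_min lexx orbT.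
  have [dl dl0 Hd] := heine (cont_uptoW r1 cf) e'0.
  have [N _ HN] : \forall n \near \oo, r / dl + 1 <= n%:R by exact: nbhs_infty_ger.
  exists N => p q Np Nq.
  have rd0 : 0 <= r / dl by rewrite divr_ge0// ltW.
  have key n m : (N <= n)%N -> (0 < m)%N ->
      dist2 P (riemann_sum W f r n) (riemann_sum W f r (n * m)) <= e / 4.
    move=> Nn m0; have hn := HN n Nn.
    have nr0 : 0 < n%:R :> R by lra.
    have n0 : (0 < n)%N by rewrite -(ltr_nat R).
    apply: (@le_trans _ _ (e' ^+ 2 * r)).
      apply: riemann_sum_refine => //; first exact: ltW.
      move=> x y x01 y01 xy; apply: Hd => //; apply: (le_trans xy).
      rewrite ler_pdivrMr// mulrC -ler_pdivrMr//; lra.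
    have e'2 : e' ^+ 2 <= e' by rewrite expr2 ler_piMl// ltW.
    apply: le_trans e'4; apply: le_trans e'2.
    by rewrite ler_piMr// sqr_ge0.
  have pos n : (N <= n)%N -> (0 < n)%N.
    by move=> Nn; have hn := HN n Nn; rewrite -(ltr_nat R); lra.
  have h1 := key p q Np (pos _ Nq).
  have h2 := key q p Nq (pos _ Np).
  have := dist2_triangle (LS p) (LS (p * q)%N) (LS q).
  have E : dist2 P (riemann_sum W f r (p * q)) (riemann_sum W f r q) = dist2 P (riemann_sum W f r q) (riemann_sum W f r (q * p)).
    by rewrite dist2C mulnC.
  lra.
have [X' X'E] := RV_of_measurable P (LX.1).
have wX' : is_wiener_integral W f r X' by apply/(is_wiener_integral_dist2 hW) => //; rewrite X'E.
have : is_wiener_integral W f r (I f r) by exact: (xgetPex _ (ex_intro _ X' wX')).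
move=> /(is_wiener_integral_dist2 hW) => /(_ r01) [LI cI]; split => //.
apply: gaussian_space_closed => // e e0.
have [N _ HN] : \forall n \near \oo, dist2 P (riemann_sum W f r n) (I f r) < e.
  exact: (cvgr_lt _ cI).
by exists (riemann_sum W f r N) => //; rewrite dist2C ltW// HN//=.
Qed.

Lemma gaussian_space_wiener_integral f (r : R) : cont_upto 1 f -> 0 <= r <= 1 ->
  gaussian_space W (I f r).
Proof. by move=> cf r01; have [] := wiener_integral_spec cf r01. Qed.

Lemma wiener_integral_L2 f (r : R) : cont_upto 1 f -> 0 <= r <= 1 -> L2 P (I f r).
Proof. by move=> cf r01; apply: gaussian_space_L2 (gaussian_space_wiener_integral cf r01). Qed.

Lemma wiener_integral_lin (a b : R) f g (r : R) : cont_upto 1 f -> cont_upto 1 g ->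
  0 <= r <= 1 ->
  {ae P, forall x, I (fun q => a * f q + b * g q) r x = a * I f r x + b * I g r x}.
Proof.
move=> cf cg r01.
have cfg : cont_upto 1 (fun q => a * f q + b * g q).
  by apply: cont_uptoD; exact: cont_uptoZ.
have [_ c1] := wiener_integral_spec cfg r01.
have [_ c2] := wiener_integral_spec cf r01.
have [_ c3] := wiener_integral_spec cg r01.
have Lf := wiener_integral_L2 cf r01; have Lg := wiener_integral_L2 cg r01.
have LSf n := riemann_sum_L2 hW f n r01; have LSg n := riemann_sum_L2 hW g n r01.
have Lc : L2 P (fun x => a * I f r x + b * I g r x) by apply: L2D; exact: L2Z.
apply: (dist2_ae_unique _ Lc (Z_ := fun n => riemann_sum W (fun q => a * f q + b * g q) r n)) => //.
- exact: wiener_integral_L2.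
- by move=> n; exact: riemann_sum_L2.
have E n x : riemann_sum W (fun q => a * f q + b * g q) r n x =
    a * riemann_sum W f r n x + b * riemann_sum W g r n x.
  by rewrite /riemann_sum !mulr_sumr -big_split/=; apply: eq_bigr => i _; ring.
apply: (@squeeze_cvgr _ _ _ _ (fun=> 0) (fun n => 2 * (a ^+ 2 * dist2 P (riemann_sum W f r n) (I f r)) +
   2 * (b ^+ 2 * dist2 P (riemann_sum W g r n) (I g r)))).
- apply: nearW => n; rewrite dist2_ge0/=.
  have LDf := L2B (LSf n) Lf; have LDg := L2B (LSg n) Lg.
  have := ipsqD_le (L2Z a LDf) (L2Z b LDg); rewrite !ipsqZ//.
  rewrite /dist2; congr (ipsq _ _ <= _); apply/funext => x.
  by rewrite E; ring.
- exact: cvg_cst.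
- have key (c : R) (u : nat -> R) : u n @[n --> \oo] --> 0 -> 2 * (c * u n) @[n --> \oo] --> 0.
    move=> cu; have : 2 * (c * u n) @[n --> \oo] --> 2 * (c * 0).
      by apply: cvgM; [exact: cvg_cst|apply: cvgM => //; exact: cvg_cst].
    by rewrite !mulr0.
  by rewrite -[X in _ --> X]addr0; apply: cvgD; exact: key.
Qed.

Lemma wiener_integral1 (t : R) : 0 <= t <= 1 ->
  {ae P, forall x, I (fun=> 1) t x = W t x}.
Proof.
move=> t01; have /andP[t0 t1] := t01.
have c1 := @cont_upto_cst R 1 1.
have [_ cI] := wiener_integral_spec c1 t01.
have LI := wiener_integral_L2 c1 t01.
have LD : L2 P (fun x => W t x - W 0 x) by have [] := wiener_incr_L2 hW (lexx 0) t0 t1.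
have : {ae P, forall x, I (fun=> 1) t x = W t x - W 0 x}.
  apply: (dist2_ae_unique LI LD (fun n => riemann_sum_L2 hW (fun=> 1) n t01) cI).
  apply: (@cvg_trans _ ((fun=> 0 : R) n @[n --> \oo])); last exact: cvg_cst.
  apply: near_eq_cvg; exists 1%N => // n /= n0.
  rewrite -[LHS](probability_Rintegral_cst P 0); apply: eq_Rintegral => x _.
  rewrite riemann_sumE /wiener_combo; under eq_bigr do rewrite mul1r.
  rewrite (telescope_sumr (fun i => W (subdiv 0 t n i) x))//.
  by rewrite subdiv0 subdivn// subrr mulr0.
move=> H; apply: filterS2 H (wiener0_ae hW) => x -> ->; exact: subr0.
Qed.

(** The isometry for one factor at a time: covariances of M with W determine those of M with the
    integral of e. It is applied to M = W s with f = 1, and then to M an integral. *)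
Let wiener_integral_ip_of e f (M : T -> R) (p q : R) : cont_upto 1 e -> cont_upto 1 f ->
  0 <= p <= 1 -> 0 <= q <= 1 -> L2 P M ->
  (forall s, 0 <= s <= 1 -> ip P (W s) M = int0 f (Num.min p s)) ->
  ip P (I e q) M = int0 (fun u => e u * f u) (Num.min p q).
Proof.
move=> ce cf p01 q01 LM WM; have [/andP[p0 p1] /andP[q0 q1]] := (p01, q01).
have [_ cI] := wiener_integral_spec ce q01.
have LS n := riemann_sum_L2 hW e n q01.
have c1 := dist2_ip_cvg LS (wiener_integral_L2 ce q01) LM cI.
have := @riemann_stieltjes_cvg R e (fun y => int0 f (Num.min p y))
  (fun y => int0 (fun q => e q * f q) (Num.min p y)) 0 q q0
  (int0_first_order p0 (cont_uptoW q1 ce) (cont_uptoW q1 cf)).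
rewrite (min_r p0) int00 subr0.
move=> c2; apply: (cvg_unique _ c1) => //.
have E n : ip P (riemann_sum W e q n) M = \sum_(0 <= i < n) e (subdiv 0 q n i) *
    (int0 f (Num.min p (subdiv 0 q n i.+1)) - int0 f (Num.min p (subdiv 0 q n i))).
  have sub01 i : (i <= n)%N -> 0 <= subdiv 0 q n i <= 1.
    by move=> ni; have /andP[-> h] := subdiv_itv q0 ni; rewrite (le_trans h).
  have LF (i : 'I_n) : L2 P (fun x => e (subdiv 0 q n i) *
      (W (subdiv 0 q n i.+1) x - W (subdiv 0 q n i) x)).
    by apply: L2Z; apply: L2B; apply: wiener_L2 => //; apply: sub01 => //; exact: ltnW.
  rewrite (_ : riemann_sum W e q n = (fun x => \sum_(i < n) e (subdiv 0 q n i) *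
      (W (subdiv 0 q n i.+1) x - W (subdiv 0 q n i) x))).
    rewrite ip_suml// big_mkord; apply: eq_bigr => i _.
    have h1 := sub01 _ (ltn_ord i); have h0 := sub01 _ (ltnW (ltn_ord i)).
    have L1 := wiener_L2 hW h1; have L0 := wiener_L2 hW h0.
    by rewrite ipZl ?ipBl ?WM//; exact: L2B.
  by apply/funext => x; rewrite riemann_sumE /wiener_combo big_mkord.
by move: c2; rewrite -(funext E).
Qed.

Lemma wiener_integral_ip e f (p q : R) : cont_upto 1 e -> cont_upto 1 f ->
  0 <= p <= 1 -> 0 <= q <= 1 ->
  ip P (I e q) (I f p) = int0 (fun u => e u * f u) (Num.min p q).
Proof.
move=> ce cf p01 q01; apply: wiener_integral_ip_of => //; first exact: wiener_integral_L2.
move=> s s01; rewrite ipC (wiener_integral_ip_of (p := s) (f := fun=> 1))//.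
- by rewrite minC; apply: eq_Rintegral => u _; rewrite mulr1.
- exact: cont_upto_cst.
- exact: wiener_L2.
move=> t t01; rewrite wiener_ip// int0_cst ?mul1r ?[Num.min t s]minC//.
by rewrite le_min; case/andP: s01 => -> _; case/andP: t01.
Qed.

Lemma wiener_integral_dist2 f (s t : R) : cont_upto 1 f -> 0 <= s -> s <= t -> t <= 1 ->
  dist2 P (I f t) (I f s) = int0 (fun u => f u * f u) t - int0 (fun u => f u * f u) s.
Proof.
move=> cf s0 st t1.
have s01 : 0 <= s <= 1 by rewrite s0 (le_trans st).
have t01 : 0 <= t <= 1 by rewrite (le_trans s0 st).
rewrite /dist2 ipsqB; [|exact: wiener_integral_L2|exact: wiener_integral_L2].
rewrite /ipsq !wiener_integral_ip// !minxx min_l//; ring.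
Qed.

End wiener_integrals.

(** * Continuous versions *)

Section dyadic_chaining.
Context (R : realType).
Implicit Types (t s : R) (n k : nat) (x : R -> R).

Definition dyadic n k : R := k%:R / 2 ^+ n.
Definition dyadic_floor n t : nat := Num.truncn (t * 2 ^+ n).

Lemma dyadic_double n k : dyadic n.+1 (2 * k) = dyadic n k.
Proof. by rewrite /dyadic natrM exprS invfM mulrACA divff ?mul1r// pnatr_eq0. Qed.

Lemma dyadic_floor_itv n t : 0 <= t ->
  (dyadic_floor n t)%:R <= t * 2 ^+ n < (dyadic_floor n t).+1%:R.
Proof. by move=> t0; rewrite truncn_itv// mulr_ge0// exprn_ge0. Qed.

Lemma dyadic_floor_lt n t : 0 <= t < 1 -> (dyadic_floor n t < 2 ^ n)%N.
Proof.
move=> /andP[t0 t1]; rewrite -(ltr_nat R) natrX.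
have /andP[h _] := dyadic_floor_itv n t0; apply: (le_lt_trans h).
by rewrite -[ltRHS]mul1r ltr_pM2r// exprn_gt0.
Qed.

Lemma dyadic_floorS n t : 0 <= t -> exists b : bool,
  dyadic_floor n.+1 t = (2 * dyadic_floor n t + b)%N.
Proof.
move=> t0; have /andP[h1 h2] := dyadic_floor_itv n t0.
have /andP[h3 h4] := dyadic_floor_itv n.+1 t0.
have E : t * 2 ^+ n.+1 = 2 * (t * 2 ^+ n) by rewrite exprS; ring.
rewrite {}E in h3 h4; move: h1 h2 h3 h4.
set a := dyadic_floor n t; set c := dyadic_floor n.+1 t; set y := t * _ => h1 h2 h3 h4.
have ac : (2 * a < c.+1)%N.
  by rewrite -(ltr_nat R) natrM; apply: le_lt_trans h4; rewrite ler_pM2l.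
have ca : (c < 2 * a.+1)%N.
  by rewrite -(ltr_nat R) natrM; apply: (le_lt_trans h3); rewrite ltr_pM2l.
exists (c != 2 * a)%N; case: eqP; lia.
Qed.

Lemma dyadic_floor_near n s t : 0 <= s -> s <= t -> (t - s) * 2 ^+ n <= 1 ->
  exists b : bool, dyadic_floor n t = (dyadic_floor n s + b)%N.
Proof.
move=> s0 st H; have /andP[h1 h2] := dyadic_floor_itv n s0.
have /andP[h3 h4] := dyadic_floor_itv n (le_trans s0 st).
have hst : s * 2 ^+ n <= t * 2 ^+ n by rewrite ler_pM2r// exprn_gt0.
rewrite mulrBl in H; move: h1 h2 h3 h4 hst H.
set a := dyadic_floor n s; set c := dyadic_floor n t => h1 h2 h3 h4 hst H.
have ac : (a < c.+1)%N by rewrite -(ltr_nat R); lra.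
have ca : (c < a.+2)%N by rewrite -(ltr_nat R) -natr1; lra.
exists (c != a)%N; case: eqP; lia.
Qed.

(** The dyadic floors of t at levels n and n + 1 are equal or neighbours at level n + 1, so a single
    increment is involved. The node 1 is left out because nothing is known there. *)
Lemma dyadic_chaining x (rho : R) (N : nat) : 0 <= rho < 1 ->
  (forall n k, (N <= n)%N -> (k.+1 < 2 ^ n)%N ->
    `|x (dyadic n k.+1) - x (dyadic n k)| <= rho ^+ n) ->
  forall t, 0 <= t < 1 -> exists2 l : R,
    x (dyadic n (dyadic_floor n t)) @[n --> \oo] --> l &
    forall n, (N <= n)%N -> `|x (dyadic n (dyadic_floor n t)) - l| <= rho ^+ n / (1 - rho).
Proof.
move=> rho01 H t t01; have /andP[r0 r1] := rho01; have /andP[t0 t1] := t01.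
apply: geometric_increments_cvg => // n Nn.
have [b E] := dyadic_floorS n t0.
have := dyadic_floor_lt n.+1 t01; rewrite E => h.
case: b {E} h => h; last by rewrite addn0 dyadic_double subrr normr0 exprn_ge0.
rewrite addn1 in h *; rewrite -(dyadic_double n).
apply: (le_trans (H _ _ _ h)); first exact: leqW.
by rewrite exprS ler_piMl ?exprn_ge0 ?(ltW r1).
Qed.

(** For |t - s| < 2^-n the floors at level n are equal or adjacent: one increment plus two tails of
    the chain give rho^n (1 + 2 / (1 - rho)). *)
Lemma dyadic_chaining_modulus x y (rho : R) (N : nat) : 0 <= rho < 1 ->
  (forall n k, (N <= n)%N -> (k.+1 < 2 ^ n)%N ->
    `|x (dyadic n k.+1) - x (dyadic n k)| <= rho ^+ n) ->
  (forall t, 0 <= t < 1 -> x (dyadic n (dyadic_floor n t)) @[n --> \oo] --> y t) ->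
  forall e : R, 0 < e -> exists2 dl : R, 0 < dl & forall s t,
    0 <= s < 1 -> 0 <= t < 1 -> `|t - s| < dl -> `|y t - y s| < e.
Proof.
move=> rho01 H cy e e0; have /andP[r0 r1] := rho01.
have r1' : 0 < 1 - rho by rewrite subr_gt0.
have cg : (rho ^+ k * (1 + 2 / (1 - rho))) @[k --> \oo] --> (0 : R).
  rewrite -(mul0r (1 + 2 / (1 - rho))); apply: cvgM; last exact: cvg_cst.
  by apply: cvg_expr; rewrite ger0_norm.
have [M _ HM] : \forall k \near \oo, rho ^+ k * (1 + 2 / (1 - rho)) < e by exact: (cvgr_lt _ cg).
pose n := maxn M N.
have Nn : (N <= n)%N by exact: leq_maxr.
have {HM}hn : rho ^+ n * (1 + 2 / (1 - rho)) < e by apply: HM; exact: leq_maxl.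
have B t : 0 <= t < 1 -> `|x (dyadic n (dyadic_floor n t)) - y t| <= rho ^+ n / (1 - rho).
  move=> t01; have [l cl Hl] := dyadic_chaining rho01 H t01.
  by rewrite -(cvg_unique _ cl (cy t t01))//; exact: Hl.
have n0 : 0 < 2 ^+ n :> R by exact: exprn_gt0.
have main s t : 0 <= s < 1 -> 0 <= t < 1 -> s <= t -> `|t - s| < (2 ^+ n)^-1 -> `|y t - y s| < e.
  move=> s01 t01 st; rewrite ger0_norm ?subr_ge0// => hst.
  have /andP[s0 _] := s01.
  have [|b E] := @dyadic_floor_near n s t s0 st.
    by rewrite -ler_pdivlMr// div1r ltW.
  have h : `|x (dyadic n (dyadic_floor n t)) - x (dyadic n (dyadic_floor n s))| <= rho ^+ n.
    have := dyadic_floor_lt n t01; rewrite E; case: b {E} => h.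
      by rewrite addn1 in h *; exact: H.
    by rewrite addn0 subrr normr0 exprn_ge0.
  apply: le_lt_trans hn.
  have := B s s01; have := B t t01.
  move: h; rewrite mulrDr mulr1 mulrCA mulr_natl mulr2n !ler_norml.
  move=> /andP[] ? ? /andP[] ? ? /andP[] ? ?; apply/andP; split; lra.
exists (2 ^+ n)^-1 => [|s t s01 t01 hst]; first by rewrite invr_gt0.
have [st|ts] := leP s t; first exact: main.
by rewrite distrC; apply: main => //; [exact: ltW|rewrite distrC].
Qed.

End dyadic_chaining.

Section chentsov.
Context d (T : measurableType d) (R : realType) (P : probability T R).
Variable W : R -> {RV P >-> R}.
Hypothesis hW : standard_wiener W.

(** Chebyshev's inequality for X^2. With second moments alone, the 2^n increments of level n would
    have total probability of order rho^(-2n), which is not summable. *)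
Lemma gaussian_space_tail X (v r : R) : gaussian_space W X -> ipsq P X <= v -> 0 < r ->
  (P [set x | r <= `|X x|]%R <= (8 * v ^+ 2 / r ^+ 4)%:E)%E.
Proof.
move=> GX Xv r0; have [LX2 m4] := gaussian_space_fourth_moment hW GX.
have := ip_chebyshev LX2 (exprn_gt0 2 r0).
rewrite (_ : [set x | r ^+ 2 <= `|X x ^+ 2|] = [set x | r <= `|X x|]); last first.
  by apply/funext => x /=; rewrite normrX ler_pXn2r// nnegrE ltW.
move=> h; apply: (le_trans h); rewrite lee_fin -exprM ler_pM2r ?invr_gt0 ?exprn_gt0//.
apply: (le_trans m4); rewrite ler_pM2l// ler_pXn2r// nnegrE; first exact: ipsq_ge0.
exact: le_trans (ipsq_ge0 P X) Xv.
Qed.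

(** The modulus of Y holds on all of [0, 1[ and for every x, with Y put to 0 off the good set; this
    uniformity is what later produces a limit at 1. *)
Lemma chentsov (X : R -> T -> R) (C : R) :
  (forall t, 0 <= t < 1 -> gaussian_space W (X t)) ->
  (forall s t, 0 <= s -> s <= t -> t < 1 -> dist2 P (X t) (X s) <= C * (t - s)) ->
  exists Y : R -> {RV P >-> R},
    (forall t, 0 <= t < 1 -> {ae P, forall x, X t x = Y t x}) /\
    (forall x (e : R), 0 < e -> exists2 dl : R, 0 < dl & forall s t,
      0 <= s < 1 -> 0 <= t < 1 -> `|t - s| < dl -> `|Y t x - Y s x| < e).
Proof.
move=> GX HX.
(* Any rho < 1 with 2 rho^4 > 1 would serve: 2^n increments, each with probability of order 4^-n
   rho^(-4n), give (2 rho^4)^-n, here at most (4 / 5)^n. *)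
pose rho : R := 9 / 10.
have r0 : 0 < rho by rewrite /rho; lra.
have r1 : rho < 1 by rewrite /rho; lra.
have dyad01 n k : (k < 2 ^ n)%N -> 0 <= dyadic R n k < 1.
  by move=> kn; rewrite divr_ge0// ltr_pdivrMr ?exprn_gt0// mul1r -natrX ltr_nat.
pose A n k := if (k.+1 < 2 ^ n)%N then
  [set x | rho ^+ n <= `|X (dyadic R n k.+1) x - X (dyadic R n k) x|] else set0.
have GA n k : (k.+1 < 2 ^ n)%N ->
    gaussian_space W (fun x => X (dyadic R n k.+1) x - X (dyadic R n k) x).
  by move=> kn; apply: (gaussian_spaceB hW); apply/GX/dyad01 => //; exact: ltnW.
have mA n k : measurable (A n k).
  rewrite /A; case: ifP => // kn; apply: measurable_norm_ge.
  exact: gaussian_space_measurable (GA _ _ kn).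
have PA n k : (P (A n k) <= (8 * (C / 2 ^+ n) ^+ 2 / (rho ^+ n) ^+ 4)%:E)%E.
  rewrite /A; case: ifP => kn; last first.
    rewrite measure0 lee_fin; apply: divr_ge0; last exact/exprn_ge0/exprn_ge0/ltW.
    by apply: mulr_ge0 => //; exact: sqr_ge0.
  apply: gaussian_space_tail; [exact: GA| |exact: exprn_gt0].
  have /andP[k0 _] := dyad01 _ _ (ltnW kn); have /andP[_ k1] := dyad01 _ _ kn.
  have E : dyadic R n k.+1 - dyadic R n k = (2 ^+ n)^-1.
    by rewrite /dyadic -mulrBl -natr1 addrAC subrr add0r mul1r.
  have := HX (dyadic R n k) (dyadic R n k.+1) k0; rewrite E; apply => //.
  by rewrite -subr_ge0 E invr_ge0 exprn_ge0.
pose D n := \big[setU/set0]_(k < 2 ^ n) A n k.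
have mD n : measurable (D n) by exact: bigsetU_measurable.
have PD n : (P (D n) <= (8 * C ^+ 2 * (4 / 5) ^+ n)%:E)%E.
  apply: (le_trans (Boole_inequality _ _)) => //.
  apply: (@le_trans _ _ (\sum_(k < 2 ^ n) (8 * (C / 2 ^+ n) ^+ 2 / (rho ^+ n) ^+ 4)%:E)%E).
    by apply: lee_sum => k _; exact: PA.
  rewrite sumEFin lee_fin sumr_const card_ord -[leLHS]mulr_natl natrX.
  have n2 : 0 < 2 ^+ n :> R by exact: exprn_gt0.
  have nr : 0 < rho ^+ n by exact: exprn_gt0.
  rewrite [leLHS](_ : _ = 8 * C ^+ 2 * ((2 * rho ^+ 4)^-1) ^+ n); last first.
    have -> : (2 * rho ^+ 4)^-1 ^+ n = (2 ^+ n * (rho ^+ n) ^+ 4)^-1 by rewrite exprVn exprMn exprAC.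
    by field; rewrite !gt_eqF.
  apply: ler_wpM2l; first by rewrite mulr_ge0// sqr_ge0.
  apply: lerXn2r; rewrite ?nnegrE ?invr_ge0 ?mulr_ge0 ?exprn_ge0 ?divr_ge0//.
  by rewrite /rho !exprS expr0; lra.
have [||A0 [mA0 PA0 HA0]] := @borel_cantelli_ae _ _ _ P D (4 / 5) (8 * C ^+ 2) _ _ mD PD.
- lra.
- by rewrite mulr_ge0// sqr_ge0.
have good (x : T) : A0 x -> exists N, forall n k, (N <= n)%N -> (k.+1 < 2 ^ n)%N ->
    `|X (dyadic R n k.+1) x - X (dyadic R n k) x| <= rho ^+ n.
  move=> /HA0[N _ HN]; exists N => n k Nn kn; rewrite leNgt; apply/negP => h.
  apply: (HN n Nn); rewrite /D -bigcup_mkord; exists k => /=; first exact: ltnW.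
  by rewrite /A kn /=; exact: ltW.
have rho01 : 0 <= rho < 1 by rewrite ltW.
have exY (t : R) : exists Y : {RV P >-> R}, 0 <= t < 1 ->
    (forall x, A0 x -> X (dyadic R n (dyadic_floor n t)) x @[n --> \oo] --> Y x) /\
    (forall x, ~ A0 x -> Y x = 0).
  have [t01|/negP nt01] := boolP (0 <= t < 1); last by exists (cst 0 : {mfun T >-> R}).
  have [n||Y mY HY] := @ae_cvg_limit _ _ _ (fun n => X (dyadic R n (dyadic_floor n t))) A0 _ mA0.
  - by apply: (gaussian_space_measurable (W := W)); apply/GX/dyad01/dyadic_floor_lt.
  - move=> x /good[N HN].
    by have [l cl _] := dyadic_chaining (x := X ^~ x) rho01 HN t01; apply/cvg_ex; exists l.
  have [|Y' Y'E] := @RV_of_measurable _ _ _ P (fun x => \1_A0 x * Y x).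
    by apply: measurable_funM => //; exact: measurable_indic.
  exists Y' => _; rewrite Y'E; split=> x Ax.
    by rewrite indicE mem_set// mul1r; exact: HY.
  by rewrite indicE memNset// mul0r.
have [Y HY] := choice exY.
exists Y; split=> [t t01|x e e0].
  have /andP[t0 t1] := t01.
  have GZ n : gaussian_space W (X (dyadic R n (dyadic_floor n t))).
    exact/GX/dyad01/dyadic_floor_lt.
  have [HYt _] := HY t t01.
  (* Along the dyadic floors of t the variables converge to Y t almost surely, hence in mean square,
     and to X t in mean square by the hypothesis on X; so X t and Y t agree. *)
  have [|GY cY] := gaussian_space_ae_cvg hW GZ (mRV (Y t)).
    exists (~` A0); split => //; first exact: measurableC.
    by move=> x /= nc Ax; apply: nc; exact: HYt.
  apply: (dist2_ae_unique (gaussian_space_L2 (GX t t01)) (gaussian_space_L2 GY)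
    (fun n => gaussian_space_L2 (GZ n)) _ cY).
  apply: (@squeeze_cvgr _ _ _ _ (fun=> 0) (fun n => `|C| * (2 ^- 1) ^+ n)).
  - apply: nearW => n; rewrite dist2_ge0 dist2C/=.
    have /andP[h1 h2] := dyadic_floor_itv n t0.
    have n2 : 0 < 2 ^+ n :> R by exact: exprn_gt0.
    have h3 : dyadic R n (dyadic_floor n t) <= t by rewrite ler_pdivrMr.
    have h4 : t - dyadic R n (dyadic_floor n t) <= (2 ^- 1) ^+ n.
      rewrite exprVn -[leRHS]mul1r ler_pdivlMr// mulrBl divfK ?gt_eqF// -natr1 in h2 *; lra.
    have h5 := HX _ _ (proj1 (andP (dyad01 n _ (dyadic_floor_lt n t01)))) h3 t1.
    apply: (le_trans h5); apply: (@le_trans _ _ (`|C| * (t - dyadic R n (dyadic_floor n t)))).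
      by rewrite ler_wpM2r ?subr_ge0// ler_norm.
    by rewrite ler_wpM2l.
  - exact: cvg_cst.
  - rewrite -(mulr0 `|C|); apply: cvgM; first exact: cvg_cst.
    by apply: cvg_expr; rewrite ger0_norm// invf_lt1// ltr1n.
have [Ax|nAx] := pselect (A0 x).
  have [N HN] := good x Ax.
  apply: (dyadic_chaining_modulus (x := X ^~ x) (y := Y ^~ x) rho01 HN) => // t t01.
  by have [h _] := HY t t01; exact: h.
exists 1 => // s t s01 t01 _.
have [_ h1] := HY s s01; have [_ h2] := HY t t01.
by rewrite h1// h2// subrr normr0.
Qed.

End chentsov.

(** * The transform of U *)

Section half_open_continuity.
Context (R : realType).
Implicit Types (f : R -> R) (t : R).

Lemma within_itv01oP f : {within `[0, 1[, continuous f} <-> forall t, t < 1 -> cont_upto t f.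
Proof.
split=> [cf t t1|H].
  apply: continuous_subspaceW cf => x /=; rewrite !in_itv/= => /andP[-> xt] /=.
  exact: le_lt_trans t1.
apply/within_continuousP => x; rewrite /= in_itv/= => /andP[x0 x1] e e0.
have t1 : (x + 1) / 2 < 1 by lra.
have [|dl dl0 Hd] := (within_continuousP _ _).1 (H _ t1) x _ e e0.
  by rewrite /= in_itv/= x0/=; lra.
have m0 : 0 < (1 - x) / 2 by lra.
exists (Num.min dl ((1 - x) / 2)) => [|y]; first by rewrite lt_min dl0 m0.
rewrite /= in_itv/= lt_min => /andP[y0 y1] /andP[h1 h2]; apply: Hd => //=.
rewrite in_itv/= y0/=; move: h2; rewrite ltr_norml => /andP[_]; lra.
Qed.

Lemma cont_uptoV f t : cont_upto t f -> (forall x, 0 <= x <= t -> f x != 0) ->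
  cont_upto t (fun x => (f x)^-1).
Proof.
move=> /subspace_continuousP cf f0; apply/subspace_continuousP => x xt.
by apply: cvgV; [apply: f0; move: xt; rewrite /= in_itv/=|exact: cf].
Qed.

Lemma uniform_cont_upto f t : t < 1 ->
  (forall e : R, 0 < e -> exists2 dl : R, 0 < dl & forall s t,
      0 <= s < 1 -> 0 <= t < 1 -> `|t - s| < dl -> `|f t - f s| < e) ->
  cont_upto t f.
Proof.
move=> t1 H; apply/within_continuousP => x; rewrite /= in_itv/= => /andP[x0 xt] e e0.
have [dl dl0 Hd] := H e e0; exists dl => // y; rewrite /= in_itv/= => /andP[y0 yt] xy.
by apply: Hd => //; rewrite ?x0 ?y0 (le_lt_trans _ t1).
Qed.

Lemma riemann_cvg f (s t : R) : 0 <= s -> s <= t -> cont_upto t f ->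
  \sum_(0 <= i < n) f (subdiv s t n i) * ((t - s) / n%:R) @[n --> \oo]
    --> int0 f t - int0 f s.
Proof.
move=> s0 st cf; have t0 := le_trans s0 st.
have E n : \sum_(0 <= i < n) f (subdiv s t n i) * ((t - s) / n%:R) =
    \sum_(0 <= i < n) f (subdiv s t n i) * (id (subdiv s t n i.+1) - id (subdiv s t n i)).
  by apply: eq_bigr => i _; rewrite subdivS.
rewrite (funext E); apply: (@riemann_stieltjes_cvg R f id (int0 f) s t st) => eps eps0; have [dl dl0 H] := int0_first_order t0 cf (@cont_upto_cst R 1 t) eps0.
exists dl => // x y sx xy yt xyd.
have x0 := le_trans s0 sx.
have := H x y x0 xy yt xyd.
rewrite (_ : (fun q => f q * 1) = f); last by apply/funext => q; rewrite mulr1.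
by rewrite !min_r ?(le_trans xy)// !int0_cst ?(le_trans x0)// !mul1r.
Qed.

End half_open_continuity.

Section coefficients.
Context (R : realType) (h g : R -> R).
Hypothesis hh : cont_upto 1 h.
Hypothesis hg : cont_upto 1 g.
Hypothesis hphi2 : forall r : R, r \in `[0, 1[ -> 0 < phi2 h g r.

(* phi1 / phi2 and psi2 / phi2 after cancelling the common factor S below. *)
Definition alpha (r : R) : R :=
  (coef_a h g r * g r - coef_b g r * h r) / coef_K h g r.
Definition beta (r : R) : R :=
  (coef_a h g r * h r + I4 h r * g r) / coef_K h g r.

Let S (r : R) : R := coef_K h g r
  + (coef_a h g r * I5 g r - coef_b g r * I3 h r) * h r
  + (coef_a h g r * I3 h r + I4 h r * I5 g r) * g r.

Let phi2E r : phi2 h g r = coef_K h g r * S r.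
Proof. by []. Qed.

Lemma coef_K_neq0 r : 0 <= r < 1 -> coef_K h g r != 0.
Proof.
move=> r01; have := hphi2 (r := r); rewrite in_itv/= => /(_ r01).
by rewrite phi2E; apply: contraTneq => ->; rewrite mul0r ltxx.
Qed.

Lemma kernel_LE r q : 0 <= r < 1 -> kernel_L h g r q = alpha r * h q + beta r * g q.
Proof.
move=> r01; have K0 := coef_K_neq0 r01.
have S0 : S r != 0.
  have := hphi2 (r := r); rewrite in_itv/= => /(_ r01).
  by rewrite phi2E; apply: contraTneq => ->; rewrite mulr0 ltxx.
have E1 : phi1 h g r = (coef_a h g r * g r - coef_b g r * h r) * S r.
  by rewrite /phi1 /S; ring.
have E2 : psi2 h g r = (coef_a h g r * h r + I4 h r * g r) * S r.
  by rewrite /psi2 /S; ring.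
rewrite /kernel_L E1 E2 phi2E /alpha /beta; field; exact/andP.
Qed.

(** Restricted to t < 1 since the common denominator may vanish at 1: for h = g = 1 it is 1 - r. *)
Lemma cont_upto_alpha_beta t : t < 1 -> cont_upto t alpha /\ cont_upto t beta.
Proof.
move=> t1; have ch := cont_uptoW (ltW t1) hh; have cg := cont_uptoW (ltW t1) hg.
have cN (f : R -> R) : cont_upto t f -> cont_upto t (fun x => - f x).
  by move=> cf; under eq_fun do rewrite -mulN1r; exact: cont_uptoZ.
have c1 := @cont_upto_cst R 1 t.
have ca : cont_upto t (coef_a h g).
  by apply: cont_uptoD => //; apply/cN/cont_upto_int0/cont_uptoM.
have cb : cont_upto t (coef_b g).
  apply: cont_uptoD => //; apply/cN/cont_upto_int0.
  by under eq_fun do rewrite expr2; exact: cont_uptoM.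
have c4 : cont_upto t (I4 h).
  by apply: cont_upto_int0; under eq_fun do rewrite expr2; exact: cont_uptoM.
have cK : cont_upto t (fun r => (coef_K h g r)^-1).
  apply: cont_uptoV => [|x /andP[x0 xt]].
    by apply: cont_uptoD; [under eq_fun do rewrite expr2|]; exact: cont_uptoM.
  by apply: coef_K_neq0; rewrite x0 (le_lt_trans xt).
split; apply: cont_uptoM => //; apply: cont_uptoD; try exact: cont_uptoM.
by apply/cN/cont_uptoM.
Qed.

End coefficients.

Section U_integrals.
Context d (T : measurableType d) (R : realType) (P : probability T R).
Variables (W : R -> {RV P >-> R}) (h g : R -> R).
Hypothesis hW : standard_wiener W.
Hypothesis hh : cont_upto 1 h.
Hypothesis hg : cont_upto 1 g.
Hypothesis hg1 : int0 (fun q => g q ^+ 2) 1 = 1.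
Implicit Types (e f : R -> R).

Local Notation I := (wiener_integral W).
Local Notation N := (U_integral W h g).

Lemma U_integralE e q : N e q = (fun x => I e q x - int0 (fun u => e u * h u) q * I g 1 x).
Proof. by apply/funext => x; rewrite /U_integral [_ * I g 1 x]mulrC. Qed.

Let one01 : 0 <= (1 : R) <= 1. Proof. by rewrite lexx ler01. Qed.

Lemma gaussian_space_U_integral e q : cont_upto 1 e -> 0 <= q <= 1 ->
  gaussian_space W (N e q).
Proof.
move=> ce q01; rewrite U_integralE; apply: (gaussian_spaceB hW).
  exact: gaussian_space_wiener_integral.
by apply: (gaussian_spaceZ hW); exact: gaussian_space_wiener_integral.
Qed.

Lemma U_integral_L2 e q : cont_upto 1 e -> 0 <= q <= 1 -> L2 P (N e q).
Proof. by move=> ce q01; apply: gaussian_space_L2 (gaussian_space_U_integral ce q01). Qed.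

(** Bilinear expansion; the normalisation of g gives the coefficient 1 of the last product. *)
Lemma U_integral_ip f e p q : cont_upto 1 f -> cont_upto 1 e ->
  0 <= p <= 1 -> 0 <= q <= 1 ->
  ip P (N f p) (N e q) = int0 (fun u => f u * e u) (Num.min p q)
    - int0 (fun u => f u * g u) p * int0 (fun u => e u * h u) q
    - int0 (fun u => f u * h u) p * int0 (fun u => e u * g u) q
    + int0 (fun u => f u * h u) p * int0 (fun u => e u * h u) q.
Proof.
move=> cf ce p01 q01; rewrite !U_integralE.
have Lf := wiener_integral_L2 hW cf p01; have Le := wiener_integral_L2 hW ce q01.
have Lg := wiener_integral_L2 hW hg one01.
rewrite ipBl//; [|exact: L2Z|by apply: L2B => //; exact: L2Z].
rewrite ipZl//; last by apply: L2B => //; exact: L2Z.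
rewrite !ipBr//; [|exact: L2Z|exact: L2Z].
rewrite !ipZr// !wiener_integral_ip//.
have [[_ p1] [_ q1]] := (andP p01, andP q01).
rewrite [Num.min q 1]min_l// [Num.min 1 p]min_r// minxx minC.
have -> : int0 (fun u => g u * e u) q = int0 (fun u => e u * g u) q.
  by congr (int0 _ q); apply/funext => u; rewrite mulrC.
have -> : int0 (fun u => g u * g u) 1 = 1.
  by rewrite -[RHS]hg1; congr (int0 _ 1); apply/funext => u; rewrite expr2.
ring.
Qed.

Hypothesis hphi2 : forall r : R, r \in `[0, 1[ -> 0 < phi2 h g r.

Definition innerU (r : R) (x : T) : R := alpha h g r * N h r x + beta h g r * N g r x.

Lemma gaussian_space_innerU r : 0 <= r <= 1 -> gaussian_space W (innerU r).
Proof.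
by move=> r01; apply: (gaussian_spaceD hW); apply: (gaussian_spaceZ hW);
  exact: gaussian_space_U_integral.
Qed.

(* The defining property of the kernel: the drift [innerU] removes the
   covariance of the increments of U with the past of U. *)
Lemma innerU_ip e q r : cont_upto 1 e -> 0 <= q -> q <= r -> r < 1 ->
  ip P (innerU r) (N e q) =
  int0 (fun u => e u * h u) q * (g r - h r) + int0 (fun u => e u * g u) q * h r.
Proof.
move=> ce q0 qr r1; have r0 := le_trans q0 qr.
have r01 : 0 <= r <= 1 by rewrite r0 ltW.
have q01 : 0 <= q <= 1 by rewrite q0 (le_trans qr)// ltW.
have Lh := U_integral_L2 hh r01; have Lg := U_integral_L2 hg r01.
have Le := U_integral_L2 ce q01.
rewrite /innerU ipDl//; [|exact: L2Z|exact: L2Z].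
rewrite !ipZl// !U_integral_ip// min_r//.
have K0 : coef_K h g r != 0 by apply: coef_K_neq0; rewrite ?r0.
rewrite /alpha /beta; move: K0; rewrite /coef_K /coef_a /coef_b /I2 /I1 /I4.
have mC f1 f2 t : int0 (fun u : R => f1 u * f2 u) t = int0 (fun u => f2 u * f1 u) t.
  by congr (int0 _ t); apply/funext => u; rewrite mulrC.
have sq f1 t : int0 (fun u : R => f1 u ^+ 2) t = int0 (fun u => f1 u * f1 u) t.
  by congr (int0 _ t); apply/funext => u; rewrite expr2.
(* Comparing the coefficients of the integrals of e h and e g gives the system alpha (a + I4) + beta
   (b - a) = g - h and beta a - alpha I4 = h. Its determinant is K, and Cramer's rule gives [alpha]
   and [beta]. *)
rewrite !sq (mC h e) (mC g e) (mC g h) => K0; field.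
by move: K0; rewrite expr2.
Qed.

End U_integrals.

(** * Continuous version of the inner integral *)

Section inner_version.
Context d (T : measurableType d) (R : realType) (P : probability T R).
Variables (W : R -> {RV P >-> R}) (h g : R -> R).
Hypothesis hW : standard_wiener W.
Hypothesis hh : cont_upto 1 h.
Hypothesis hg : cont_upto 1 g.
Hypothesis hphi2 : forall r : R, r \in `[0, 1[ -> 0 < phi2 h g r.

Local Notation I := (wiener_integral W).

Lemma U_integral_kernel r : 0 <= r < 1 ->
  {ae P, forall x, U_integral W h g (kernel_L h g r) r x = innerU W h g r x}.
Proof.
move=> r01; have /andP[r0 r1] := r01.
have r01' : 0 <= r <= 1 by rewrite r0 ltW.
rewrite (_ : kernel_L h g r = fun q => alpha h g r * h q + beta h g r * g q); last first.
  by apply/funext => q; exact: kernel_LE.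
apply: filterS (wiener_integral_lin hW (alpha h g r) (beta h g r) hh hg r01') => x Ex.
rewrite /innerU /U_integral Ex.
have ch := cont_uptoW (ltW r1) hh; have cg := cont_uptoW (ltW r1) hg.
have -> : int0 (fun q => (alpha h g r * h q + beta h g r * g q) * h q) r =
    alpha h g r * int0 (fun q => h q * h q) r + beta h g r * int0 (fun q => g q * h q) r.
  have c1 := cont_uptoM ch ch; have c2 := cont_uptoM cg ch.
  have c1' := cont_uptoZ (c := alpha h g r) c1; have c2' := cont_uptoZ (c := beta h g r) c2.
  rewrite -int0Z// -int0Z// -int0D//; congr (int0 _ r); apply/funext => q; ring.
ring.
Qed.

Lemma wiener_integral_chentsov f : cont_upto 1 f -> exists Y : R -> {RV P >-> R},
    (forall t, 0 <= t < 1 -> {ae P, forall x, I f t x = Y t x}) /\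
    (forall x t, t < 1 -> cont_upto t (Y ^~ x)).
Proof.
move=> cf; have [M M0 HM] := int0_lipschitz (cont_uptoM cf cf).
have [t /andP[t0 t1]|s t s0 st t1|Y [YE cY]] := @chentsov _ _ _ _ _ hW (I f) M.
- by apply: gaussian_space_wiener_integral => //; rewrite t0 ltW.
- rewrite (wiener_integral_dist2 hW cf s0 st (ltW t1)).
  exact: (le_trans (ler_norm _) (HM _ _ s0 st (ltW t1))).
by exists Y; split=> // x t t1; exact: (uniform_cont_upto t1 (cY x)).
Qed.

(** All dependence on r is deterministic and continuous on [0, 1[, except for the Wiener integrals
    of h and g up to r. Continuous versions of these two processes are therefore enough. *)
Lemma inner_version_ex : exists J : R -> {RV P >-> R}, is_inner_version W h g J.
Proof.
have [Yh [YhE cYh]] := wiener_integral_chentsov hh.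
have [Yg [YgE cYg]] := wiener_integral_chentsov hg.
pose F r x := alpha h g r * (Yh r x - int0 (fun u => h u * h u) r * I g 1 x)
  + beta h g r * (Yg r x - int0 (fun u => g u * h u) r * I g 1 x).
have exJ r : exists J : {RV P >-> R}, J = F r :> (T -> R).
  apply: RV_of_measurable.
  have m1 (Y : {RV P >-> R}) (a c : R) : measurable_fun setT (fun x => a * (Y x - c * I g 1 x)).
    apply: measurable_funM; first exact: measurable_cst.
    apply: measurable_funB; first exact: mRV.
    by apply: measurable_funM; [exact: measurable_cst|exact: mRV].
  exact: measurable_funD.
have [J JE] := choice exJ.
exists J; split=> [r|]; last first.
  apply: aeW => x; apply/within_itv01oP => t t1.
  have [ca cb] := cont_upto_alpha_beta hh hg hphi2 t1.
  rewrite (_ : (fun r => J r x) = (F ^~ x)); last by apply/funext => r; rewrite JE.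
  have cS (Y : R -> {RV P >-> R}) (f : R -> R) : cont_upto t (Y ^~ x) -> cont_upto 1 f ->
      cont_upto t (fun r => Y r x - int0 (fun u => f u * h u) r * I g 1 x).
    move=> cY cf; apply: cont_uptoD => //.
    rewrite (_ : (fun r => _) = (fun r => - I g 1 x * int0 (fun u => f u * h u) r)); last first.
      by apply/funext => r; ring.
    apply/cont_uptoZ/cont_upto_int0/cont_uptoM; exact: (cont_uptoW (ltW t1)).
  by apply: cont_uptoD; apply: cont_uptoM => //; apply: cS => //; [exact: cYh|exact: cYg].
rewrite in_itv/= => r01.
apply: filterS3 (U_integral_kernel r01) (YhE r r01) (YgE r r01) => x -> hx gx.
by rewrite JE /F -hx -gx /innerU !U_integralE.
Qed.

Lemma inner_integralP : is_inner_version W h g (inner_integral W h g).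
Proof. by have [J HJ] := inner_version_ex; exact: (xgetPex _ (ex_intro _ J HJ)). Qed.

Lemma inner_integral_ae r : 0 <= r < 1 ->
  {ae P, forall x, innerU W h g r x = inner_integral W h g r x}.
Proof.
move=> r01; have [H _] := inner_integralP; have := H r; rewrite in_itv/= => /(_ r01).
by apply: filterS2 (U_integral_kernel r01) => x -> ->.
Qed.

End inner_version.

Section pathwise_integrals.
Context d (T : measurableType d) (R : realType) (P : probability T R).
Variables (W : R -> {RV P >-> R}).
Hypothesis hW : standard_wiener W.

(** Each of the n^2 cross terms is at most M (c / n)^2. This is the source of the quadratic bound in
    t - s on the drift. *)
Lemma ipsq_mean_le (F : nat -> T -> R) (n : nat) (M c : R) : (forall i, L2 P (F i)) ->
  (forall i, ipsq P (F i) <= M) ->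
  ipsq P (fun x => \sum_(0 <= i < n) c / n%:R * F i x) <= M * c ^+ 2.
Proof.
move=> LF FM.
have M0 : 0 <= M by apply: le_trans (FM 0%N); exact: ipsq_ge0.
have LcF i : L2 P (fun x => c / n%:R * F i x) by exact: L2Z.
rewrite /ipsq ip_suml//; last exact: L2_sum.
apply: (@le_trans _ _ (\sum_(0 <= i < n) \sum_(0 <= j < n) M * (c / n%:R) ^+ 2)).
  apply: ler_sum => i _; rewrite ipC ip_suml//; apply: ler_sum => j _.
  rewrite ipZl// ipZr// mulrA -expr2 mulrC; apply: ler_wpM2r; first exact: sqr_ge0.
  have := ip_AMGM (LF j) (LF i) ltr01; have := FM i; have := FM j.
  rewrite /ipsq invr1 !mul1r; have := ler_norm (ip P (F j) (F i)); lra.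
rewrite !sumr_const_nat !subn0 -[leLHS]mulr_natl -[X in _ * X <= _]mulr_natl.
have [->|n0] := eqVneq n 0%N; first by rewrite !mul0r mulr_ge0// sqr_ge0.
by rewrite le_eqVlt; apply/orP; left; apply/eqP; field; rewrite pnatr_eq0.
Qed.

(** Pathwise Riemann sums lie in the Gaussian space and converge almost surely, hence in mean
    square. Expectations are thus exchanged with the integral in r without joint measurability of
    J. *)
Lemma pathwise_integral (J : R -> {RV P >-> R}) (s t M : R) :
  0 <= s -> s <= t -> t < 1 ->
  (forall r, 0 <= r < 1 -> gaussian_space W (J r)) ->
  {ae P, forall x, {within `[0, 1[, continuous (fun r => J r x)}} ->
  (forall r, s <= r <= t -> ipsq P (J r) <= M) ->
  exists Z : T -> R, [/\ gaussian_space W Z,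
    {ae P, forall x, Z x = int0 (fun r => J r x) t - int0 (fun r => J r x) s},
    ipsq P Z <= M * (t - s) ^+ 2 &
    forall (X : T -> R) (psi : R -> R), L2 P X -> cont_upto t psi ->
      (forall r, s <= r <= t -> ip P X (J r) = psi r) ->
      ip P X Z = int0 psi t - int0 psi s].
Proof.
move=> s0 st t1 GJ [N [mN PN HN]] JM.
have ts0 : 0 <= t - s by rewrite subr_ge0.
(* The nodes are capped at t so that the bounds hold for every index i; for i < n the cap changes
   nothing. *)
pose p n i := Num.min t (subdiv s t n i).
have p_itv n i : s <= p n i <= t.
  by rewrite le_min st ge_min lexx /subdiv lerDl divr_ge0// mulr_ge0.
have p01 n i : 0 <= p n i < 1.
  by have /andP[h1 h2] := p_itv n i; rewrite (le_trans s0)// (le_lt_trans h2).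
have pE n i : (0 <= i < n)%N -> p n i = subdiv s t n i.
  by move=> /= ni; rewrite /p min_r//; have /andP[] := subdiv_itv st (ltnW ni).
pose S n x := \sum_(0 <= i < n) (t - s) / n%:R * J (p n i) x.
have GS n : gaussian_space W (S n).
  by apply: (gaussian_space_sum hW) => i; apply: (gaussian_spaceZ hW); exact: GJ.
have LJ n i : L2 P (J (p n i)) by apply: (gaussian_space_L2 (W := W)); exact: GJ.
have mA : measurable (~` N) by exact: measurableC.
have cS x : (~` N) x -> S n x @[n --> \oo] --> int0 (fun r => J r x) t - int0 (fun r => J r x) s.
  move=> nNx; have cJ : {within `[0, 1[, continuous (fun r => J r x)}.
    by apply: contrapT => /HN.
  have := riemann_cvg s0 st ((within_itv01oP _).1 cJ t t1).
  rewrite (_ : (fun n => _) = S ^~ x)//; apply/funext => n.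
  by apply: eq_big_nat => i ni; rewrite pE// mulrC.
have [n|x Ax|Z mZ cZ] := @ae_cvg_limit _ _ _ S _ _ mA.
- exact: gaussian_space_measurable (GS n).
- by apply/cvg_ex; eexists; exact: cS.
have [|GZ dZ] := gaussian_space_ae_cvg hW GS mZ.
  by exists N; split=> // x /= nc; apply: contrapT => nNx; apply: nc; exact: cZ.
have LS n := gaussian_space_L2 (GS n); have LZ := gaussian_space_L2 GZ.
exists Z; split=> //.
- exists N; split=> // x /= nc; apply: contrapT => nNx; apply: nc.
  exact: (cvg_unique _ (cZ x nNx) (cS x nNx)).
- rewrite -(cvg_lim _ (dist2_ipsq_cvg LS LZ dZ))//; apply: limr_le.
    by apply/cvg_ex; eexists; exact: (dist2_ipsq_cvg LS LZ dZ).
  by apply: nearW => n; apply: ipsq_mean_le => // i; exact/JM/p_itv.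
- move=> X psi LX cpsi Hpsi.
  rewrite ipC; apply: (cvg_unique _ (dist2_ip_cvg LS LZ LX dZ)) => //.
  have E n : ip P (S n) X = \sum_(0 <= i < n) psi (subdiv s t n i) * ((t - s) / n%:R).
    rewrite /S ip_suml//; last by move=> i; exact: L2Z.
    by apply: eq_big_nat => i ni; rewrite ipZl// ipC Hpsi// pE// mulrC.
  by rewrite /= (funext E); exact: riemann_cvg.
Qed.

End pathwise_integrals.

(** * Covariance of the transformed process *)

Section transform_covariance.
Context d (T : measurableType d) (R : realType) (P : probability T R).
Variables (W : R -> {RV P >-> R}) (h g : R -> R).
Hypothesis hW : standard_wiener W.
Hypothesis hh : cont_upto 1 h.
Hypothesis hg : cont_upto 1 g.
Hypothesis hg1 : int0 (fun q => g q ^+ 2) 1 = 1.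
Hypothesis hphi2 : forall r : R, r \in `[0, 1[ -> 0 < phi2 h g r.

Local Notation I := (wiener_integral W).
Local Notation N := (U_integral W h g).
Local Notation J := (inner_integral W h g).
Local Notation L := (transform_lt1 W h g).

Let le1 (r : R) : 0 <= r < 1 -> 0 <= r <= 1.
Proof. by move=> /andP[-> /ltW->]. Qed.

Let Jae r (r01 : 0 <= r < 1) := inner_integral_ae hW hh hg hphi2 r01.

Let GJ r : 0 <= r < 1 -> gaussian_space W (J r).
Proof.
move=> r01; apply: gaussian_space_eq_ae (Jae r01) _ (mRV _).
by apply: (gaussian_space_innerU hW hh hg); exact: le1.
Qed.

Let ipJ X r : 0 <= r < 1 -> measurable_fun setT X -> ip P X (J r) = ip P (innerU W h g r) X.
Proof.
move=> r01 mX; rewrite ipC; apply/esym/ip_eq_ae; [exact: Jae| |exact: mRV|by []].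
by apply: (gaussian_space_measurable (W := W)); apply: (gaussian_space_innerU hW hh hg); exact: le1.
Qed.

Lemma inner_integral_bounded t : t < 1 ->
  exists2 M : R, 0 < M & forall r, 0 <= r <= t -> ipsq P (J r) <= M.
Proof.
move=> t1; have [ca cb] := cont_upto_alpha_beta hh hg hphi2 t1.
(* The second moment of [N f r], as given by [U_integral_ip]; its continuity bounds that of J on
   [0, t]. *)
pose A (f : R -> R) r := int0 (fun u => f u * f u) r
    - int0 (fun u => f u * g u) r * int0 (fun u => f u * h u) r
    - int0 (fun u => f u * h u) r * int0 (fun u => f u * g u) r
    + int0 (fun u => f u * h u) r * int0 (fun u => f u * h u) r.
have cA f : cont_upto 1 f -> cont_upto t (A f).
  move=> cf; have cI e : cont_upto 1 e -> cont_upto t (int0 (fun u => f u * e u)).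
    move=> ce; apply/cont_upto_int0/cont_uptoM; exact: (cont_uptoW (ltW t1)).
  have cN (e : R -> R) : cont_upto t e -> cont_upto t (fun x => - e x).
    by move=> ce; under eq_fun do rewrite -mulN1r; exact: cont_uptoZ.
  apply: cont_uptoD; last by apply: cont_uptoM; exact: cI.
  apply: cont_uptoD; last by apply/cN/cont_uptoM; exact: cI.
  by apply: cont_uptoD; [exact: cI|apply/cN/cont_uptoM; exact: cI].
have [M M0 HM] := segment_bounded (cont_uptoD (cont_uptoM (cont_uptoM ca ca) (cA h hh))
  (cont_uptoM (cont_uptoM cb cb) (cA g hg))).
exists (2 * M) => [|r /andP[r0 rt]]; first by rewrite mulr_gt0.
have r01 : 0 <= r < 1 by rewrite r0 (le_lt_trans rt).
have r01' := le1 r01.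
have Lh := U_integral_L2 h hW hg hh r01'; have Lg := U_integral_L2 h hW hg hg r01'.
have LJ := gaussian_space_L2 (gaussian_space_innerU hW hh hg r01').
have -> : ipsq P (J r) = ipsq P (innerU W h g r).
  rewrite /ipsq ipJ//.
  by rewrite ipJ//; case: LJ.
apply: (le_trans (ipsqD_le (L2Z (alpha h g r) Lh) (L2Z (beta h g r) Lg))).
rewrite !ipsqZ// /ipsq !U_integral_ip// !minxx -/(A h r) -/(A g r).
have := HM r; rewrite r0 rt => /(_ isT); have := ler_norm (alpha h g r * alpha h g r * A h r + beta h g r * beta h g r * A g r).
rewrite !expr2; lra.
Qed.

(** E collects everything of order t - s in the increment: the integral of J and the multiple of
    [I g 1] contained in U. The last clause holds because J cancels the derivative in r of the
    covariance of [N 1 r] with [N e q] as soon as r >= q. *)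
Lemma transform_increment t0 : t0 < 1 -> exists2 C : R, 0 < C &
  forall s t, 0 <= s -> s <= t -> t <= t0 -> exists E : T -> R,
  [/\ gaussian_space W E,
    {ae P, forall x, W t x - W s x + E x = L t x - L s x},
    ipsq P E <= C * (t - s) ^+ 2 &
    forall e q, cont_upto 1 e -> 0 <= q <= s ->
      ip P (fun x => W t x - W s x + E x) (N e q) = 0].
Proof.
move=> t01; have [M M0 HM] := inner_integral_bounded t01.
have [Mh Mh0 HMh] := int0_lipschitz hh.
exists (2 * M + 2 * Mh ^+ 2) => [|s t s0 st tt0].
  by have := sqr_ge0 Mh; lra.
have t1 := le_lt_trans tt0 t01; have s1 := le_lt_trans st t1.
have s01 : 0 <= s < 1 by rewrite s0.
have t01' : 0 <= t < 1 by rewrite t1 (le_trans s0).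
have one01 : 0 <= (1 : R) <= 1 by rewrite lexx ler01.
have Gxi := gaussian_space_wiener_integral hW hg one01.
have Lxi := gaussian_space_L2 Gxi.
have [r /andP[sr rt]|Z [GZ ZE ZM ipZ]] := pathwise_integral (M := M) hW s0 st t1 GJ (proj2 (inner_integralP hW hh hg hphi2)).
  by apply: HM; rewrite (le_trans s0 sr) (le_trans rt).
have LZ := gaussian_space_L2 GZ.
pose c := int0 h t - int0 h s.
pose E x := Z x - c * I g 1 x.
have GE : gaussian_space W E by apply: (gaussian_spaceB hW) => //; exact: (gaussian_spaceZ hW).
have LWt := wiener_L2 hW (le1 t01'); have LWs := wiener_L2 hW (le1 s01).
have LWi := L2B LWt LWs.
exists E; split => //.
- apply: filterS ZE => x Zx; rewrite /E Zx /transform_lt1 /process_U /c; ring.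
- have := ipsqD_le LZ (L2Z (- c) Lxi); rewrite ipsqZ//.
  have -> : ipsq P (I g 1) = 1.
    rewrite /ipsq wiener_integral_ip// minxx -[RHS]hg1; apply: eq_Rintegral => u _.
    by rewrite expr2.
  rewrite (_ : (fun x => Z x + - c * I g 1 x) = E); last by apply/funext => x; rewrite /E; ring.
  have c2 : c ^+ 2 <= Mh ^+ 2 * (t - s) ^+ 2.
    rewrite -exprMn -[c ^+ 2]real_normK ?num_real//; apply: lerXn2r; rewrite ?nnegrE// ?mulr_ge0 ?subr_ge0 ?(ltW Mh0)//.
    by apply: HMh => //; exact: ltW.
  rewrite sqrrN mulr1; lra.
- move=> e q ce /andP[q0 qs].
  have q1 := le_lt_trans qs s1.
  have q01 : 0 <= q <= 1 by rewrite q0 ltW.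
  have LN := U_integral_L2 h hW hg ce q01.
  have c1 := @cont_upto_cst R 1 1.
  have s01c := le1 s01; have t01c := le1 t01'.
  have LIt := wiener_integral_L2 hW c1 (le1 t01'); have LIs := wiener_integral_L2 hW c1 (le1 s01).
  have LNt := U_integral_L2 h hW hg c1 (le1 t01'); have LNs := U_integral_L2 h hW hg c1 (le1 s01).
  have LND := L2B LNt LNs; have LE := gaussian_space_L2 GE.
  rewrite (@ip_eq_ae _ _ _ P _ (fun x => (N (fun=> 1) t x - N (fun=> 1) s x) + Z x)).
  (* U is almost surely the U-integral of 1, so its covariances come from [U_integral_ip] with f =
     1. *)
  + rewrite ipDl// ipBl// !U_integral_ip//.
    rewrite !min_r ?(le_trans qs)//.
    have E1 (f : R -> R) : (fun u => 1 * f u) = f by apply/funext => u; rewrite mul1r.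
    rewrite !E1.
    pose Eh := int0 (fun u => e u * h u) q; pose Eg := int0 (fun u => e u * g u) q.
    rewrite -/Eh -/Eg.
    have ch := cont_uptoW (ltW t1) hh; have cg := cont_uptoW (ltW t1) hg.
    (* The right-hand side of [innerU_ip], which is also minus the derivative of the covariance of
       [N 1 u] with [N e q]. *)
    pose psi u := Eh * g u + (Eg - Eh) * h u.
    have cpsi : cont_upto t psi by apply: cont_uptoD; exact: cont_uptoZ.
    have := ipZ _ psi LN cpsi; rewrite ipC => ->; last first.
      move=> r /andP[sr rt]; have r1 := le_lt_trans rt t1.
      rewrite ipJ; [|by rewrite (le_trans s0 sr) r1|by case: LN].
      rewrite (innerU_ip hW hh hg hg1 hphi2 ce q0 (le_trans qs sr) r1) /psi /Eh /Eg; ring.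
    have psiE v : v <= t -> int0 psi v = Eh * int0 g v + (Eg - Eh) * int0 h v.
      move=> vt; have cgv := cont_uptoZ (c := Eh) (cont_uptoW vt cg).
      have chv := cont_uptoZ (c := Eg - Eh) (cont_uptoW vt ch).
      by rewrite /psi int0D// !int0Z//; exact: cont_uptoW vt _.
    rewrite !psiE//; ring.
  + apply: filterS2 (wiener_integral1 hW (le1 t01')) (wiener_integral1 hW (le1 s01)) => x <- <-.
    rewrite /E /c !U_integralE.
    rewrite (_ : (fun u => 1 * h u) = h); last by apply/funext => u; rewrite mul1r.
    ring.
  + by have [] := L2D LWi LE.
  + by have [] := L2D LND LZ.
  + by case: LN.
Qed.

Lemma transform0_ae : {ae P, forall x, L 0 x = 0}.
Proof.
apply: filterS (wiener0_ae hW) => x Wx.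
by rewrite /transform_lt1 /process_U Wx !int00 mulr0 subr0 addr0.
Qed.

(** [L t] contains a pathwise integral that is controlled only on almost every path; V t is a
    genuine random variable equal to it almost surely, for each t separately. *)
Lemma transform_RV : exists V : R -> {RV P >-> R}, forall t, 0 <= t < 1 ->
  gaussian_space W (V t) /\ {ae P, forall x, L t x = V t x}.
Proof.
suff exV t : exists X : {RV P >-> R}, 0 <= t < 1 ->
    gaussian_space W X /\ {ae P, forall x, L t x = X x}.
  by have [V HV] := choice exV; exists V.
have [t01|/negP nt01] := boolP (0 <= t < 1); last by exists (cst 0 : {mfun T >-> R}).
have /andP[t0 t1] := t01.
have [C _ H] := transform_increment t1.
have [E [GE EL _ _]] := H 0 t (lexx 0) t0 (lexx t).
have GV : gaussian_space W (fun x => W t x - W 0 x + E x).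
  apply: (gaussian_spaceD hW) => //; apply: (gaussian_spaceB hW);
    by apply: (gaussian_space_wiener hW); rewrite ?lexx ?ler01//; exact: le1.
have [V VE] := RV_of_measurable P (gaussian_space_measurable GV).
exists V => _; rewrite VE; split => //.
by apply: filterS2 EL transform0_ae => x -> ->; rewrite subr0.
Qed.

Variable V : R -> {RV P >-> R}.
Hypothesis HV : forall t, 0 <= t < 1 ->
  gaussian_space W (V t) /\ {ae P, forall x, L t x = V t x}.

Let LV t : 0 <= t < 1 -> L2 P (V t).
Proof. by move=> /HV[G _]; exact: gaussian_space_L2 G. Qed.

(** V s is almost surely [N 1 s] plus the integral of J over [0, s], and each J r is a combination
    of U-integrals up to r <= s. The last clause of [pathwise_integral], with psi = 0, carries the
    orthogonality through the integral. *)
Lemma transform_past_orth s t : 0 <= s -> s <= t -> t < 1 ->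
  ip P (fun x => V t x - V s x) (V s) = 0.
Proof.
move=> s0 st t1; have s1 := le_lt_trans st t1.
have s01 : 0 <= s < 1 by rewrite s0.
have t01 : 0 <= t < 1 by rewrite t1 (le_trans s0).
have s01c := le1 s01; have t01c := le1 t01.
have [C _ H] := transform_increment t1.
have [E [GE EL _ orth]] := H s t s0 st (lexx t).
have LE := gaussian_space_L2 GE.
have LWi := L2B (wiener_L2 hW t01c) (wiener_L2 hW s01c).
pose D x := W t x - W s x + E x.
have LD : L2 P D by exact: L2D.
have LVi := L2B (LV t01) (LV s01).
have -> : ip P (fun x => V t x - V s x) (V s) = ip P D (V s).
  apply: ip_eq_ae; [|by case: LVi|by case: LD|exact: mRV].
  by apply: filterS3 EL (HV t01).2 (HV s01).2 => x; rewrite /D => -> -> ->.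
have [M M0 HM] := inner_integral_bounded s1.
have [r /andP[sr rt]|Z [GZ ZE _ ipZ]] := pathwise_integral (M := M) hW (lexx 0) s0 s1 GJ (proj2 (inner_integralP hW hh hg hphi2)).
  by apply: HM; rewrite sr.
have LZ := gaussian_space_L2 GZ.
have c1 := @cont_upto_cst R 1 1.
have LN := U_integral_L2 h hW hg c1 s01c.
have LNZ := L2D LN LZ.
rewrite ipC (@ip_eq_ae _ _ _ P _ (fun x => N (fun=> 1) s x + Z x)); last 3 first.
- exact: mRV.
- by case: LNZ.
- by case: LD.
  rewrite ipDl// ![ip P _ D]ipC orth ?s0 ?lexx//.
  rewrite (ipZ _ (fun=> 0) LD); first by rewrite int00 int0_cst// mul0r subrr addr0.
    exact: cont_upto_cst.
  move=> r /andP[r0 rs]; have r01 : 0 <= r < 1 by rewrite r0 (le_lt_trans rs).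
  have r01c := le1 r01.
  rewrite ipJ//; last by case: LD.
  have Lh := U_integral_L2 h hW hg hh r01c; have Lg := U_integral_L2 h hW hg hg r01c.
  rewrite /innerU ipDl//; [|exact: L2Z|exact: L2Z].
  by rewrite !ipZl// ![ip P _ D]ipC !orth ?r0// !mulr0 addr0.
apply: filterS3 (HV s01).2 ZE (wiener_integral1 hW s01c) => x <- -> Ws.
rewrite U_integralE /transform_lt1 /process_U Ws.
rewrite (_ : (fun u => 1 * h u) = h); last by apply/funext => u; rewrite mul1r.
by rewrite int00; ring.
Qed.

(* By orthogonality of increments v(t) = E[V_t^2] grows over [x, y] by
   E[(V_y - V_x)^2], which is y - x up to o(y - x). *)
Lemma transform_ipsq t : 0 <= t < 1 -> ipsq P (V t) = t.
Proof.
move=> t01; have /andP[t0 t1] := t01.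
have [C C0 H] := transform_increment t1.
pose v r := ipsq P (V r).
have v0 : v 0 = 0.
  have O01 : 0 <= (0 : R) < 1 by rewrite lexx ltr01.
  rewrite /v /ipsq (@ip_eq_ae _ _ _ P _ (fun=> 0)); [| |exact: mRV|exact: measurable_cst|exact: mRV].
    rewrite -[RHS](probability_Rintegral_cst P 0).
    by apply: eq_Rintegral => x _; rewrite mul0r.
  by apply: filterS2 transform0_ae (HV O01).2 => x L0 <-.
have vi x y : 0 <= x -> x <= y -> y <= t -> v y - v x = ipsq P (fun z => V y z - V x z).
  move=> x0 xy yt; have y1 := le_lt_trans yt t1; have x1 := le_lt_trans xy y1.
  have Lx : L2 P (V x) by apply: LV; rewrite x0.
  have Ly : L2 P (V y) by apply: LV; rewrite y1 (le_trans x0).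
  have := transform_past_orth x0 xy y1; rewrite ipBl// ipsqB// /v /ipsq; lra.
have key : forall eps : R, 0 < eps -> exists2 dl : R, 0 < dl & forall x y,
    0 <= x -> x <= y -> y <= t -> y - x <= dl ->
    `|v y - v x - (fun=> 1) x * (id y - id x)| <= eps * (y - x).
  move=> eps eps0.
  pose eta := eps / 2; have eta0 : 0 < eta by rewrite divr_gt0.
  have k0 : 0 < C * (1 + eta^-1) by rewrite mulr_gt0// addr_gt0// invr_gt0.
  (* With AM-GM weight eta, twice the cross term is at most eta (y - x) + q / eta, where q <= C (y -
     x)^2 is the second moment of E. This radius makes q (1 + 1 / eta) at most eta (y - x), for a
     total of 2 eta = eps. *)
  exists (eta / (C * (1 + eta^-1))) => [|x y x0 xy yt xyd]; first by rewrite divr_gt0.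
  rewrite vi// mul1r.
  have x01 : 0 <= x < 1 by rewrite x0 (le_lt_trans (le_trans xy yt)).
  have y01 : 0 <= y < 1 by rewrite (le_trans x0 xy) (le_lt_trans yt).
  have x01c := le1 x01; have y01c := le1 y01.
  have [E [GE EL EC _]] := H x y x0 xy yt.
  have LE := gaussian_space_L2 GE.
  have [LWi Wi] := wiener_incr_L2 hW x0 xy (proj2 (andP y01c)).
  have LD := L2D LWi LE; have LVi := L2B (LV y01) (LV x01).
  have -> : ipsq P (fun z => V y z - V x z) = ipsq P (fun z => W y z - W x z + E z).
    have ae : {ae P, forall z, V y z - V x z = W y z - W x z + E z}.
      by apply: filterS3 EL (HV y01).2 (HV x01).2 => z -> -> ->.
    have [[m1 _] [m2 _]] := (LVi, LD).
    by rewrite /ipsq (ip_eq_ae ae)// ipC (ip_eq_ae ae).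
  rewrite ipsqD// -/(dist2 P (W y) (W x)) Wi.
  have := ip_AMGM LWi LE eta0; rewrite -/(ipsq P _) -/(dist2 P (W y) (W x)) Wi -/(ipsq P E).
  set c := ip P _ E; set q := ipsq P E in EC *.
  have q0 : 0 <= q by exact: ipsq_ge0.
  have h1 : q * (1 + eta^-1) <= eta * (y - x).
    apply: (@le_trans _ _ (C * (y - x) ^+ 2 * (1 + eta^-1))).
      by rewrite ler_wpM2r// addr_ge0// invr_ge0 ltW.
    rewrite mulrAC expr2 mulrA ler_wpM2r ?subr_ge0//.
    by rewrite mulrC -ler_pdivlMr.
  have := ler_norm c; have := ler_norm (- c); rewrite normrN.
  have eE : eps = 2 * eta by rewrite /eta; field.
  rewrite mulrDr mulr1 mulrC in h1; rewrite eE.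
  move=> h2 h3 h4; rewrite addrAC [y - x + _]addrC addrAC.
  rewrite ler_norml; apply/andP; split; lra.
(* Here e = 1 and Phi is the identity: for n >= 1 the sums telescope to t, while their limit is v
   t. *)
have := riemann_stieltjes_cvg t0 key.
rewrite v0 subr0 -/(v t) => cv.
apply: (cvg_unique _ cv) => //=.
apply: (@cvg_trans _ ((fun=> t) n @[n --> \oo])); last exact: cvg_cst.
apply: near_eq_cvg; exists 1%N => // n /= n0.
under eq_bigr do rewrite mul1r.
by rewrite (telescope_sumr (subdiv 0 t n))// subdiv0 subdivn// subr0.
Qed.

Lemma transform_ip s t : 0 <= s -> s <= t -> t < 1 -> ip P (V s) (V t) = s.
Proof.
move=> s0 st t1; have s1 := le_lt_trans st t1.
have s01 : 0 <= s < 1 by rewrite s0.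
have t01 : 0 <= t < 1 by rewrite t1 (le_trans s0).
have := transform_past_orth s0 st t1; rewrite ipBl; [|exact: LV..].
by move/subr0_eq; rewrite ipC => ->; exact: transform_ipsq.
Qed.

End transform_covariance.

(** * Wiener processes recognised by their covariance *)

Section wiener_of_covariance.
Context d (T : measurableType d) (R : realType) (P : probability T R).
Variable W : R -> {RV P >-> R}.
Hypothesis hW : standard_wiener W.

Lemma gaussian_space_law (X : T -> R) (v : R) (B : set R) :
  gaussian_space W X -> 0 < v -> ipsq P X = v -> measurable B ->
  P (X @^-1` B) = normal_prob 0 (Num.sqrt v) B.
Proof.
move=> GX v0 Xv mB; have mX := gaussian_space_measurable GX.
have sv0 : 0 < Num.sqrt v by rewrite sqrtr_gt0.
pose N : probability (measurableTypeR R) R := normal_prob 0 (Num.sqrt v).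
have := @matches_cos_indic _ _ _ P _ _ N X (fun=> 1) (fun x : measurableTypeR R => x : R) 1 1 mX
  (measurable_cst _) _ (@measurable_id _ (measurableTypeR R) setT) _ B mB.
rewrite /matches mul1r; under eq_Rintegral do rewrite mul1r.
move=> H; rewrite -Rintegral_indic_preimage// H.
- by rewrite (@Rintegral_indic_preimage _ _ _ N (fun x : measurableTypeR R => x : R)).
- by move=> x; rewrite normr1.
move=> l th; rewrite /matches mul1r; under eq_Rintegral do rewrite mul1r.
rewrite (gaussian_space_cos hW)// Xv.
rewrite (@Rintegral_normal_prob R 0 _ (fun x => cos (l * x + th)) 1).
- by rewrite normal_fourier// sqr_sqrtr// ltW.
- apply: measurable_cos_comp.
  by apply: measurable_funD => //; exact: measurable_funM.
- by move=> x; exact: cos_max.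
Qed.

(** The covariance gives increments of variance t - s, orthogonal on successive intervals; normal
    laws and independence follow inside the Gaussian space. *)
Lemma gaussian_space_standard_wiener (w : R -> {RV P >-> R}) :
  (forall t, 0 <= t <= 1 -> gaussian_space W (w t)) ->
  (forall s t, 0 <= s -> s <= t -> t <= 1 -> ip P (w s) (w t) = s) ->
  {ae P, forall x, {within `[0, 1], continuous (fun t => w t x)}} ->
  standard_wiener w.
Proof.
move=> Gw ipw cw.
have Lw t : 0 <= t <= 1 -> L2 P (w t) by move=> t01; exact: gaussian_space_L2 (Gw t t01).
have Gi s t : 0 <= s -> s <= t -> t <= 1 -> gaussian_space W (fun x => w t x - w s x).
  move=> s0 st t1; apply: (gaussian_spaceB hW); apply: Gw.
    by rewrite t1 (le_trans s0).
  by rewrite s0 (le_trans st).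
split => //.
- by apply: ip_eq0_ae; [apply: Lw; rewrite lexx ler01|rewrite ipw// ler01].
- move=> s t s0 st t1 B mB.
  have t0 := le_trans s0 (ltW st); have s1 := le_trans (ltW st) t1.
  have Lt : L2 P (w t) by apply: Lw; rewrite t0.
  have Ls : L2 P (w s) by apply: Lw; rewrite s0.
  apply: (@gaussian_space_law (fun x => w t x - w s x)) => //.
  + by apply: Gi => //; exact: ltW.
  + by rewrite subr_gt0.
  + rewrite ipsqB// /ipsq [ip P (w t) (w s)]ipC !ipw ?lexx ?(ltW st)//; ring.
- move=> n t t0 tn tn1 B mB.
  have mono i j : (i <= j)%N -> (j <= n)%N -> t i <= t j.
    elim: j => [|j ih]; first by rewrite leqn0 => /eqP ->.
    rewrite leq_eqVlt => /predU1P[->//|ij] jn.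
    by rewrite (le_trans (ih _ _))//; [exact: ltnW|exact: tn].
  have ti0 i : (i <= n)%N -> 0 <= t i by move=> ni; rewrite (le_trans t0)// mono.
  have ti1 i : (i <= n)%N -> t i <= 1 by move=> ni; rewrite (le_trans _ tn1)// mono.
  (* [gaussian_space_indep] works with families indexed by all naturals: the increments are
     continued by 0 and the sets by [setT] beyond n. *)
  pose X i x := if (i < n)%N then w (t i.+1) x - w (t i) x else 0.
  pose B' i := oapp B setT (insub i : option 'I_n).
  have mB' i : measurable (B' i).
    by rewrite /B'; case: (insub i) => [k|]; [exact: mB|exact: measurableT].
  have B'E (i : 'I_n) : B' i = B i by rewrite /B' valK.
  have XE (i : 'I_n) : X i = (increment w (t i) (t i.+1) : T -> R).
    by apply/funext => x; rewrite /X ltn_ord.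
  have GX i : gaussian_space W (X i).
    rewrite /X; have [ni|ni] := ltnP i n; last exact: gaussian_space0.
    by apply: Gi; [apply: ti0; exact: ltnW|exact: tn|exact: ti1].
  have mX i := gaussian_space_measurable (GX i).
  have H := @gaussian_space_indep _ _ _ _ _ hW X n GX _ B' mB'.
  transitivity (P (\bigcap_(i in [set: 'I_n]) (X i @^-1` B' i))).
    by congr (P _); apply: eq_bigcapr => i _; rewrite B'E XE.
  rewrite -Rintegral_indic_prod// H.
    rewrite big_mkord -prodEFin; apply: eq_bigr => i _.
    by rewrite Rintegral_indic_preimage// B'E XE.
  move=> i j ij jn; have ni := ltn_trans ij jn.
  have Lti k : (k <= n)%N -> L2 P (w (t k)) by move=> nk; apply: Lw; rewrite ti0// ti1.
  have L1 := Lti _ ni; have L2 := Lti _ (ltnW ni); have L3 := Lti _ jn; have L4 := Lti _ (ltnW jn).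
  rewrite /X ni jn ipBl//; last exact: L2B.
  have iple a b : (a <= b)%N -> (b <= n)%N -> ip P (w (t a)) (w (t b)) = t a.
    by move=> ab bn; apply: ipw; [exact/ti0/(leq_trans ab)|exact: mono|exact: ti1].
  by rewrite !ipBr// !iple// ?subrr ?subr0 // ltnW// ltnW.
Qed.

End wiener_of_covariance.

(** * Extension of paths to time 1 *)

Section extension_to_one.
Context (R : realType).
Implicit Types (f y : R -> R) (t : R).

Lemma dyadic_floor_cvg f t : 0 <= t -> cont_upto t f ->
  f (dyadic R n (dyadic_floor n t)) @[n --> \oo] --> f t.
Proof.
move=> t0 cf; apply/cvgrPdist_lt => e e0.
have [|dl dl0 H] := (within_continuousP _ _).1 cf t _ e e0.
  by rewrite /= in_itv/= t0 lexx.
have c0 : (2^-1 ^+ n : R) @[n --> \oo] --> (0 : R).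
  by apply: cvg_expr; rewrite ger0_norm// invf_lt1// ltr1n.
have : \forall n \near \oo, (2^-1 ^+ n : R) < dl by exact: (cvgr_lt _ c0).
apply: filterS => n hn; rewrite distrC.
have n2 : 0 < 2 ^+ n :> R by exact: exprn_gt0.
have /andP[h1 h2] := dyadic_floor_itv n t0.
have h3 : dyadic R n (dyadic_floor n t) <= t by rewrite ler_pdivrMr.
apply: H; first by rewrite /= in_itv/= h3 divr_ge0// ltW.
rewrite distrC ger0_norm ?subr_ge0//; apply: le_lt_trans hn.
rewrite exprVn -[leRHS]mul1r ler_pdivlMr// mulrBl divfK ?gt_eqF// -natr1 in h2 *; lra.
Qed.

Definition approach1 (n : nat) : R := 1 - n.+2%:R^-1.

Lemma approach1_itv n : 0 <= approach1 n < 1.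
Proof.
by rewrite /approach1 subr_ge0 invf_le1// ler1n/= ltrBlDr ltrDl invr_gt0.
Qed.

Lemma approach1_cvg : approach1 n @[n --> \oo] --> (1 : R).
Proof.
rewrite -[X in _ --> X](subr0 1); apply: cvgB; first exact: cvg_cst.
by have := @cvg_harmonic R; rewrite -(cvg_shiftn 1%N); under eq_fun do rewrite addn1.
Qed.

Variable y : R -> R.
Hypothesis yU : forall e : R, 0 < e -> exists2 dl : R, 0 < dl & forall s t,
  0 <= s < 1 -> 0 <= t < 1 -> `|t - s| < dl -> `|y t - y s| < e.

Lemma uniform_approach1_cvg : cvgn (y \o approach1).
Proof.
apply/cauchy_cvgP/cauchy_exP => e e0; have [dl dl0 H] := yU e0.
have : \forall n \near \oo, `|1 - approach1 n| < dl / 2.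
  by move: approach1_cvg => /cvgrPdist_lt; apply; rewrite divr_gt0.
move=> [N _ HN]; exists (y (approach1 N)); exists N => // n /= Nn.
rewrite /ball/=; apply: H; rewrite ?approach1_itv//.
have := HN n Nn; have := HN N (leqnn N).
have /andP[_ h1] := approach1_itv n; have /andP[_ h2] := approach1_itv N.
have E m : `|1 - approach1 m| = 1 - approach1 m.
  by have /andP[_ h] := approach1_itv m; rewrite ger0_norm// subr_ge0 ltW.
rewrite /= !E ltr_norml => h3 h4; apply/andP; split; lra.
Qed.

Lemma uniform_limit (l : R) : y (approach1 n) @[n --> \oo] --> l ->
  forall e : R, 0 < e -> exists2 dl : R, 0 < dl & forall t,
    0 <= t < 1 -> `|1 - t| < dl -> `|l - y t| < e.
Proof.
move=> cl e e0; have e20 : 0 < e / 2 by rewrite divr_gt0.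
have [dl dl0 H] := yU e20.
exists (dl / 2) => [|t t01 ht]; first by rewrite divr_gt0.
apply: (@le_lt_trans _ _ (e / 2)); last by lra.
have cn : `|y (approach1 n) - y t| @[n --> \oo] --> `|l - y t|.
  by apply: cvg_norm; apply: cvgB => //; exact: cvg_cst.
rewrite -(cvg_lim _ cn)//; apply: limr_le; first by apply/cvg_ex; eexists; exact: cn.
have : \forall n \near \oo, `|1 - approach1 n| < dl / 2.
  by move: approach1_cvg => /cvgrPdist_lt; apply; rewrite divr_gt0.
apply: filterS => n hn; apply/ltW/H => //; first exact: approach1_itv.
rewrite -(subrK 1 (approach1 n)) -addrA; apply: (le_lt_trans (ler_normD _ _)).
rewrite distrC in hn; lra.
Qed.

Lemma uniform_extension (l : R) : y (approach1 n) @[n --> \oo] --> l ->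
  {within `[0, 1], continuous (fun t => if t < 1 then y t else l)}.
Proof.
move=> cl; apply/within_continuousP => x; rewrite /= in_itv/= => /andP[x0 x1] e e0.
have [d1 d10 H1] := yU e0; have [d2 d20 H2] := uniform_limit cl e0.
exists (Num.min d1 d2) => [|z]; first by rewrite lt_min d10.
rewrite /= in_itv/= lt_min => /andP[z0 z1] /andP[h1 h2].
have [xlt|xge] := ltP x 1; have [zlt|zge] := ltP z 1.
- by apply: H1; rewrite ?x0 ?z0.
- have zE : z = 1 by lra.
  by apply: H2; [rewrite x0|rewrite -zE].
- have xE : x = 1 by lra.
  by rewrite distrC; apply: H2; [rewrite z0|rewrite distrC -xE].
- by rewrite subrr normr0.
Qed.

Lemma uniform_left_limit (l : R) (f : R -> R) : y (approach1 n) @[n --> \oo] --> l ->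
  (forall t, 0 <= t < 1 -> f t = y t) -> f t @[t --> 1^'-] --> l.
Proof.
move=> cl fy; apply/cvgrPdist_lt => e e0; have [dl dl0 H] := uniform_limit cl e0.
have m0 : 1 - Num.min dl 1 < 1 by rewrite ltrBlDr ltrDl lt_min dl0 ltr01.
near=> t.
have t1 : t < 1 by near: t; exact: nbhs_left_lt.
have : 1 - Num.min dl 1 < t by near: t; exact: nbhs_left_gt.
rewrite ltrBlDl -ltrBlDr lt_min => /andP[h1 h2].
have t01 : 0 <= t < 1 by rewrite t1 andbT; lra.
by rewrite fy//; apply: H => //; rewrite ger0_norm// subr_ge0 ltW.
Unshelve. all: by end_near. Qed.

End extension_to_one.

Section transform_paths.
Context d (T : measurableType d) (R : realType) (P : probability T R).
Variables (W : R -> {RV P >-> R}) (h g : R -> R).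
Hypothesis hW : standard_wiener W.
Hypothesis hh : cont_upto 1 h.
Hypothesis hg : cont_upto 1 g.
Hypothesis hg1 : int0 (fun q => g q ^+ 2) 1 = 1.
Hypothesis hphi2 : forall r : R, r \in `[0, 1[ -> 0 < phi2 h g r.

Local Notation L := (transform_lt1 W h g).

Lemma transform_lt1_continuous :
  {ae P, forall x, {within `[0, 1[, continuous (fun t => L t x)}}.
Proof.
have [_ cW _ _] := hW; have [_ cJ] := inner_integralP hW hh hg hphi2.
apply: filterS2 cW cJ => x cWx /within_itv01oP cJx; apply/within_itv01oP => t t1.
apply: cont_uptoD; last by apply: cont_upto_int0; exact: cJx.
rewrite /process_U (_ : (fun s => _) =
  (fun s => W s x + - wiener_integral W g 1 x * int0 h s)); last first.
  by apply/funext => s; rewrite mulNr.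
apply: cont_uptoD; first exact: (cont_uptoW (ltW t1) cWx).
by apply/cont_uptoZ/cont_upto_int0; exact: (cont_uptoW (ltW t1) hh).
Qed.

(** L has almost surely continuous paths on [0, 1[ but no control near 1, whereas Y is uniformly
    continuous. They agree at all dyadic times outside one null set, hence at all times by
    continuity. *)
Lemma transform_uniform_version : exists Y : R -> {RV P >-> R},
  [/\ forall t, 0 <= t < 1 -> gaussian_space W (Y t),
    forall s t, 0 <= s -> s <= t -> t < 1 -> ip P (Y s) (Y t) = s,
    forall x (e : R), 0 < e -> exists2 dl : R, 0 < dl & forall s t,
      0 <= s < 1 -> 0 <= t < 1 -> `|t - s| < dl -> `|Y t x - Y s x| < e &
    {ae P, forall x t, 0 <= t < 1 -> L t x = Y t x}].
Proof.
have [V HV] := transform_RV hW hh hg hg1 hphi2.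
have ipV := transform_ip hW hh hg hg1 hphi2 HV.
have [t t01|s t s0 st t1|Y [YE YU]] := chentsov (X := V) (C := 1) hW.
- exact: (HV t t01).1.
- have t01 : 0 <= t < 1 by rewrite t1 (le_trans s0).
  have s01 : 0 <= s < 1 by rewrite s0 (le_lt_trans st).
  have Lt := gaussian_space_L2 (HV t t01).1; have Ls := gaussian_space_L2 (HV s s01).1.
  rewrite /dist2 ipsqB// /ipsq [ip P (V t) (V s)]ipC !ipV ?(le_lt_trans st)//; last by case/andP: t01.
  rewrite mul1r; lra.
have GY t : 0 <= t < 1 -> gaussian_space W (Y t).
  by move=> t01; apply: gaussian_space_eq_ae (YE t t01) (HV t t01).1 (mRV _).
exists Y; split=> // [s t s0 st t1|].
  have t01 : 0 <= t < 1 by rewrite t1 (le_trans s0).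
  have s01 : 0 <= s < 1 by rewrite s0 (le_lt_trans st).
  rewrite -[RHS](ipV s t s0 st t1) (ip_eq_ae (Y := Y s) (X := V s) (YE s s01)); try exact: mRV.
  by rewrite [RHS]ipC (ip_eq_ae (Y := Y t) (X := V t) (YE t t01)); [exact: ipC|exact: mRV..].
have eqD : {ae P, forall x n k, (k < 2 ^ n)%N -> L (dyadic R n k) x = Y (dyadic R n k) x}.
  apply: ae_foralln => n; apply: ae_foralln => k.
  have [kn|kn] := ltnP k (2 ^ n)%N; last by apply: aeW.
  have k01 : 0 <= dyadic R n k < 1.
    by rewrite divr_ge0// ltr_pdivrMr ?exprn_gt0// mul1r -natrX ltr_nat.
  by apply: filterS2 (HV _ k01).2 (YE _ k01) => x -> ->.
apply: filterS2 eqD transform_lt1_continuous => x eqDx /within_itv01oP cL t t01.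
have /andP[t0 t1] := t01.
have c1 := dyadic_floor_cvg t0 (cL t t1).
have c2 := dyadic_floor_cvg t0 (uniform_cont_upto t1 (YU x)).
apply: (cvg_unique _ c1) => //; move: c2.
rewrite (_ : (fun n => Y _ x) = (fun n => L (dyadic R n (dyadic_floor n t)) x))//.
by apply/funext => n; rewrite eqDx// dyadic_floor_lt.
Qed.

End transform_paths.

Theorem theorem1 (d : measure_display) (T : measurableType d) (R : realType)
    (P : probability T R) (W : R -> {RV P >-> R}) (h g : R -> R)
    (hW : standard_wiener W)
    (hh : {within `[0, 1], continuous h})
    (hg : {within `[0, 1], continuous g})
    (hg1 : \int[lebesgue_measure]_(q in `[0, 1]) (g q) ^+ 2 = 1)
    (hphi2 : forall r : R, r \in `[0, 1[ -> 0 < phi2 h g r) :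
  exists w : R -> {RV P >-> R},
    standard_wiener w /\
    {ae P, forall x,
      cvg (transform_lt1 W h g t x @[t --> 1^'-]) /\
      forall nu : R, nu \in `[0, 1] -> transform_L W h g nu x = w nu x}.
Proof.
have [Y [GY ipY YU YE]] := transform_uniform_version hW hh hg hg1 hphi2.
have [n|x _|Y1f mY1f cY1f] := @ae_cvg_limit _ _ _ (fun n => Y (approach1 R n)) setT _ measurableT.
- exact: mRV.
- exact: (uniform_approach1_cvg (YU x)).
have [Y1 Y1E] := RV_of_measurable P mY1f.
have cY1 x : Y (approach1 R n) x @[n --> \oo] --> Y1 x by rewrite Y1E; exact: cY1f.
have GYn n : gaussian_space W (Y (approach1 R n)) by apply: GY; exact: approach1_itv.
(* Pathwise convergence to the endpoint value is also mean-square convergence, which carries the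
   covariance to time 1. *)
have [|GY1 dY1] := gaussian_space_ae_cvg hW GYn (mRV Y1); first exact: aeW.
have LYn n := gaussian_space_L2 (GYn n); have LY1 := gaussian_space_L2 GY1.
pose w (t : R) : {RV P >-> R} := if t < 1 then Y t else Y1.
have wlt t : t < 1 -> w t = Y t by rewrite /w => ->.
have w1 : w 1 = Y1 by rewrite /w ltxx.
exists w; split.
  apply: (gaussian_space_standard_wiener hW).
  - by move=> t /andP[t0 t1]; rewrite /w; case: ifPn => // tlt; apply: GY; rewrite t0.
  - move=> s t s0 st; rewrite le_eqVlt => /predU1P[t1|t1]; last first.
      by rewrite !wlt ?(le_lt_trans st)//; exact: ipY.
    move: st; rewrite t1 le_eqVlt => /predU1P[s1|s1].
      rewrite s1 w1; apply: (cvg_unique _ (dist2_ipsq_cvg LYn LY1 dY1)) => //=.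
      rewrite (_ : (fun n => _) = @approach1 R); first exact: approach1_cvg.
      apply/funext => n; have /andP[a0 a1] := approach1_itv R n.
      exact: ipY.
    rewrite w1 wlt// ipC.
    have LYs := gaussian_space_L2 (GY s (introT andP (conj s0 s1))).
    apply: (cvg_unique _ (dist2_ip_cvg LYn LY1 LYs dY1)) => //=.
    apply: (@cvg_trans _ ((fun=> s) n @[n --> \oo])); last exact: cvg_cst.
    apply: near_eq_cvg.
    have : \forall n \near \oo, s < approach1 R n by exact: (cvgr_gt _ (@approach1_cvg R)).
    apply: filterS => n sn; have /andP[_ a1] := approach1_itv R n.
    by rewrite ipC ipY// ltW.
  - apply: aeW => x; rewrite (_ : (fun t => w t x) = (fun t => if t < 1 then Y t x else Y1 x)).
      exact: (uniform_extension (YU x) (cY1 x)).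
    by apply/funext => t; rewrite /w; case: ifP.
apply: filterS YE => x YEx.
(* On almost every path L and Y agree at all times of [0, 1[ at once, so the left limit of L at 1
   exists and equals Y1. *)
have cL := uniform_left_limit (YU x) (cY1 x) (f := fun t => transform_lt1 W h g t x) YEx.
split=> [|nu]; first by apply/cvg_ex; exists (Y1 x).
rewrite in_itv/= /transform_L => /andP[nu0 nu1].
case: ifPn => nul; first by rewrite wlt// YEx// nu0.
by rewrite (cvg_lim _ cL)// /w (negbTE nul).
Qed.
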